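(* For every positive integer $s$, $$k\otimes_{G(4)}\mathscr{P}_A((P_4)_{2^{s+3}+2^{s+1}-3}^{*})=\begin{cases}\langle[\zeta]\rangle & \text{if } s=1,\\ 0 & \text{if } s=2,\\ \langle[a_2^{(2^{s}-1)}a_3^{(2^{s}-1)}a_4^{(2^{s+3}-1)}]\rangle & \text{if } s\geqslant 3,\end{cases}$$ where $\zeta\in (P_4)^*_{17}$ is the sum $a_1^{(5)}a_2^{(5)}a_3^{(5)}a_4^{(2)}+a_1^{(5)}a_2^{(5)}a_3^{(6)}a_4^{(1)}+a_1^{(3)}a_2^{(5)}a_3^{(8)}a_4^{(1)}+a_1^{(5)}a_2^{(3)}a_3^{(8)}a_4^{(1)}+a_1^{(3)}a_2^{(6)}a_3^{(7)}a_4^{(1)} +a_1^{(5)}a_2^{(7)}a_3^{(4)}a_4^{(1)}+a_1^{(7)}a_2^{(5)}a_3^{(4)}a_4^{(1)}+a_1^{(3)}a_2^{(9)}a_3^{(4)}a_4^{(1)}+a_1^{(9)}a_2^{(3)}a_3^{(4)}a_4^{(1)}+a_1^{(3)}a_2^{(9)}a_3^{(3)}a_4^{(2)} +a_1^{(9)}a_2^{(3)}a_3^{(3)}a_4^{(2)}+a_1^{(5)}a_2^{(9)}a_3^{(2)}a_4^{(1)}+a_1^{(9)}a_2^{(5)}a_3^{(2)}a_4^{(1)}+a_1^{(5)}a_2^{(10)}a_3^{(1)}a_4^{(1)}+a_1^{(9)}a_2^{(6)}a_3^{(1)}a_4^{(1)} +a_1^{(3)}a_2^{(11)}a_3^{(2)}a_4^{(1)}+a_1^{(11)}a_2^{(3)}a_3^{(2)}a_4^{(1)}+a_1^{(5)}a_2^{(5)}a_3^{(3)}a_4^{(4)}+a_1^{(5)}a_2^{(3)}a_3^{(5)}a_4^{(4)}+a_1^{(3)}a_2^{(5)}a_3^{(5)}a_4^{(4)}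 +a_1^{(3)}a_2^{(12)}a_3^{(1)}a_4^{(1)}+a_1^{(11)}a_2^{(4)}a_3^{(1)}a_4^{(1)}+a_1^{(7)}a_2^{(8)}a_3^{(1)}a_4^{(1)}+a_1^{(7)}a_2^{(7)}a_3^{(1)}a_4^{(2)}+a_1^{(13)}a_2^{(2)}a_3^{(1)}a_4^{(1)} +a_1^{(14)}a_2^{(1)}a_3^{(1)}a_4^{(1)}+a_1^{(6)}a_2^{(5)}a_3^{(3)}a_4^{(3)}+a_1^{(5)}a_2^{(3)}a_3^{(6)}a_4^{(3)}+a_1^{(3)}a_2^{(6)}a_3^{(5)}a_4^{(3)}+a_1^{(6)}a_2^{(3)}a_3^{(3)}a_4^{(5)} +a_1^{(3)}a_2^{(3)}a_3^{(6)}a_4^{(5)}+a_1^{(3)}a_2^{(6)}a_3^{(3)}a_4^{(5)}+a_1^{(5)}a_2^{(3)}a_3^{(3)}a_4^{(6)}+a_1^{(3)}a_2^{(5)}a_3^{(3)}a_4^{(6)}+a_1^{(3)}a_2^{(3)}a_3^{(5)}a_4^{(6)} +a_1^{(3)}a_2^{(3)}a_3^{(3)}a_4^{(8)}+a_1^{(3)}a_2^{(3)}a_3^{(4)}a_4^{(7)}+a_1^{(3)}a_2^{(5)}a_3^{(2)}a_4^{(7)}+a_1^{(3)}a_2^{(6)}a_3^{(1)}a_4^{(7)}+a_1^{(3)}a_2^{(3)}a_3^{(9)}a_4^{(2)} +a_1^{(3)}a_2^{(3)}a_3^{(10)}a_4^{(1)}+a_1^{(5)}a_2^{(3)}a_3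^{(7)}a_4^{(2)}+a_1^{(5)}a_2^{(7)}a_3^{(3)}a_4^{(2)}+a_1^{(7)}a_2^{(5)}a_3^{(3)}a_4^{(2)}$.
   Context: $k=\mathbb{Z}/2$, $A$ is the mod 2 Steenrod algebra and $G(4)=GL_4(k)$. $P_4=k[x_1,\dots,x_4]$, $\deg x_i=1$, with the usual $A$-action and $G(4)$ acting by linear substitution. $(P_4)^*$ is the divided power algebra on $a_1^{(1)},\dots,a_4^{(1)}$ (dual to $x_1,\dots,x_4$), with basis $a_1^{(j_1)}\cdots a_4^{(j_4)}$ dual to the monomials $x_1^{j_1}\cdots x_4^{j_4}$ (a factor $a_i^{(0)}$ is $1$ and omitted), with the dual right $A$-action. $\mathscr{P}_A((P_4)_n^* )$ is the subspace of $(P_4)_n^*$ annihilated by all $Sq^i$, $i>0$; $k\otimes_{G(4)}\mathscr{P}_A((P_4)_n^* )$ denotes its $G(4)$-coinvariants and $[\cdot]$ the class of an element there. *)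

(* Defs.v *)
From HB Require Import structures.
From mathcomp Require Import all_boot all_order all_algebra.
From mathcomp Require Import mpoly.
Set Implicit Arguments. Unset Strict Implicit. Unset Printing Implicit Defensive.
Import GRing.Theory.
Local Open Scope ring_scope.

Notation k := 'F_2.
(* P_4 = k[x_1,...,x_4]; variable x_(i+1) is 'X_i, i : 'I_4. *)
Notation P4 := {mpoly k[4]}.
Notation mon := 'X_{1..4}.

Definition mon4 (j1 j2 j3 j4 : nat) : mon := [multinom [tuple j1; j2; j3; j4]].

(* An element of (P_4)^*: a linear functional on P_4, given by its values on
   the monomial basis.  The divided-power basis element
   a_1^{(j_1)}...a_4^{(j_4)} is the functional dual to x_1^{j_1}...x_4^{j_4}. *)
Definition dual := mon -> k.

Definition pair (f : dual) (p : P4) : k := \sum_(m <- msupp p) p@_m * f m.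

Definition in_deg (n : nat) (f : dual) : Prop := forall m, f m != 0 -> mdeg m = n.

Definition dzero : dual := fun _ => 0.
Definition dadd (f g : dual) : dual := fun m => f m + g m.
Definition dscale (c : k) (f : dual) : dual := fun m => c * f m.
Definition dsum (fs : seq dual) : dual := foldr dadd dzero fs.

Definition amon (j1 j2 j3 j4 : nat) : dual := fun m => (m == mon4 j1 j2 j3 j4)%:R.

Definition Sq_total (p : P4) : P4 :=
  comp_mpoly [tuple ('X_i + 'X_i ^+ 2 : P4) | i < 4] p.

Definition hcomp (d : nat) (p : P4) : P4 :=
  \sum_(m <- msupp p | mdeg m == d) p@_m *: 'X_[m].

Definition Sq (i : nat) (p : P4) : P4 :=
  \sum_(m <- msupp p) p@_m *: hcomp (mdeg m + i) (Sq_total 'X_[m]).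

Definition dSq (f : dual) (i : nat) : dual := fun m => pair f (Sq i 'X_[m]).

Definition GL4 (g : 'M[k]_4) : bool := g \in unitmx.

Definition gsub (g : 'M[k]_4) (p : P4) : P4 :=
  comp_mpoly [tuple (\sum_(i < 4) g i j *: 'X_i : P4) | j < 4] p.

Definition dact (f : dual) (g : 'M[k]_4) : dual := fun m => pair f (gsub g 'X_[m]).

Definition PA (n : nat) (f : dual) : Prop :=
  in_deg n f /\ forall i m, (0 < i)%N -> dSq f i m = 0.

(* f lies in the subspace spanned by the f g - f, f in P_A((P_4)^*_n), g in G(4);
   i.e. its class in k (x)_{G(4)} P_A((P_4)^*_n) is zero. *)
Definition coinv_zero (n : nat) (f : dual) : Prop :=
  exists s : seq (dual * 'M[k]_4),
    foldr (fun fg P => [/\ GL4 fg.2, PA n fg.1 & P]) True s /\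
    forall m, f m = dsum [seq dadd (dact fg.1 fg.2) (dscale (-1) fg.1) | fg <- s] m.

Definition coinv_trivial (n : nat) : Prop :=
  forall f, PA n f -> coinv_zero n f.

Definition coinv_spanned_by (n : nat) (z : dual) : Prop :=
  PA n z /\ ~ coinv_zero n z /\
  forall f, PA n f -> exists c : k, coinv_zero n (dadd f (dscale (- c) z)).

Definition zeta : dual := dsum [::
 amon 5 5 5 2; amon 5 5 6 1; amon 3 5 8 1; amon 5 3 8 1; amon 3 6 7 1;
 amon 5 7 4 1; amon 7 5 4 1; amon 3 9 4 1; amon 9 3 4 1; amon 3 9 3 2;
 amon 9 3 3 2; amon 5 9 2 1; amon 9 5 2 1; amon 5 10 1 1; amon 9 6 1 1;
 amon 3 11 2 1; amon 11 3 2 1; amon 5 5 3 4; amon 5 3 5 4; amon 3 5 5 4;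
 amon 3 12 1 1; amon 11 4 1 1; amon 7 8 1 1; amon 7 7 1 2; amon 13 2 1 1;
 amon 14 1 1 1; amon 6 5 3 3; amon 5 3 6 3; amon 3 6 5 3; amon 6 3 3 5;
 amon 3 3 6 5; amon 3 6 3 5; amon 5 3 3 6; amon 3 5 3 6; amon 3 3 5 6;
 amon 3 3 3 8; amon 3 3 4 7; amon 3 5 2 7; amon 3 6 1 7; amon 3 3 9 2;
 amon 3 3 10 1; amon 5 3 7 2; amon 5 7 3 2; amon 7 5 3 2].

(* Main.v *)
(* Let S be the total square, a ring endomorphism. A homogeneous functional f is annihilated
   by all Sq^i, i > 0, iff f o S = f. In degree 2 d + 3 with d odd, Singer's criterion makes
   such an f vanish on x^E y^2, E the set of odd exponents, unless #|E| = 3; hence f amounts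
   to its components f_i(y) = f(x_1 x_2 x_3 x_4 / x_i . y^2), four annihilated functionals of
   degree d subject to the single relation sum_i f_i(x_i u) = 0. After three such steps the
   components f_ijl depend only on the set {i, j, l}, and inclusion-exclusion shows that for
   s >= 3 the annihilated functionals are the direct sum, over the fifteen hyperplanes of
   F_2^4, of those supported on a hyperplane. The latter all come from degree 7 by iterating
   Kameko's a^(b) |-> a^(2 b + 1); there they are spanned by divided seventh powers of linear
   forms ("points") and by lifts of products of two linear forms ("wedges"). Lifted wedges
   vanish in the coinvariants, all lifted points have the same class, and the number of
   points modulo 2 is a well defined invariant.
   For s <= 2 the sum over the hyperplanes is not direct: seven lifts of one point add up to
   zero, which kills the class of a point. For s = 2 this sum is still everything, and for
   s = 1 it is a complement of the line spanned by zeta; both facts are linear algebra on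
   components in degree 7, and are checked by computation. *)
From HB Require Import structures.
Require Import Defs.
From mathcomp Require Import all_boot all_order all_algebra.
From mathcomp Require Import mpoly.
From mathcomp Require Import all_fingroup ring.
From Stdlib Require Import FunctionalExtensionality.
Set Implicit Arguments. Unset Strict Implicit. Unset Printing Implicit Defensive.
Import GRing.Theory.
Local Open Scope ring_scope.

Lemma F2_cases (a : k) : a = 0 \/ a = 1.
Proof. by case: a => [[|[|n]]] // i; [left|right]; apply/val_inj. Qed.

Lemma F2_addxx (a : k) : a + a = 0.
Proof. by case: (F2_cases a) => ->; apply/val_inj. Qed.

Lemma F2_opp (a : k) : - a = a.
Proof. by case: (F2_cases a) => ->; apply/val_inj. Qed.

Lemma F2_mulxx (a : k) : a * a = a.
Proof. by case: (F2_cases a) => ->; apply/val_inj. Qed.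

Lemma F2_neq0 (a : k) : a != 0 -> a = 1.
Proof. by case: (F2_cases a) => ->; rewrite ?eqxx. Qed.

Lemma F2_addK (a b : k) : a + b = 0 -> a = b.
Proof. by move/eqP; rewrite addr_eq0 F2_opp => /eqP. Qed.

Lemma P4_addxx (p : P4) : p + p = 0.
Proof. by rewrite -[p]scale1r -scalerDl F2_addxx scale0r. Qed.

Lemma P4_sqrD (p q : P4) : (p + q) ^+ 2 = p ^+ 2 + q ^+ 2.
Proof. by rewrite sqrrD mulr2n P4_addxx addr0. Qed.

Lemma pair_widen (f : dual) (p : P4) (s : seq mon) :
  uniq s -> {subset msupp p <= s} -> pair f p = \sum_(m <- s) p@_m * f m.
Proof.
move=> us sub; rewrite /pair [RHS](bigID (mem (msupp p))) /= [X in _ + X]big1 ?addr0; last first.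
  by move=> m /memN_msupp_eq0 ->; rewrite mul0r.
rewrite -[RHS]big_filter; apply: perm_big; apply: uniq_perm => //.
- exact: filter_uniq.
by move=> m; rewrite mem_filter; case: (boolP (m \in msupp p)) => //= /sub.
Qed.

HB.lock Definition ev (f : dual) (p : P4) : k := pair f p.

Lemma ev_is_zmod (f : dual) : zmod_morphism (ev f).
Proof.
rewrite ev.unlock =>  p q /=; pose s := undup (msupp p ++ msupp q ++ msupp (p - q)).
have us : uniq s by exact: undup_uniq.
rewrite !(@pair_widen _ _ s) //; try by move=> m; rewrite mem_undup !mem_cat => ->; rewrite ?orbT.
by rewrite -sumrB; apply: eq_bigr => m _; rewrite mcoeffB mulrBl.
Qed.

HB.lock Definition act (f : dual) (g : 'M[k]_4) : dual := dact f g.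
HB.lock Definition sub (g : 'M[k]_4) (p : P4) : P4 := gsub g p.
HB.lock Definition St (p : P4) : P4 := Sq_total p.

HB.instance Definition _ (f : dual) :=
  GRing.isZmodMorphism.Build P4 k (ev f) (ev_is_zmod f).

Lemma evX (f : dual) m : ev f 'X_[m] = f m.
Proof. by rewrite ev.unlock /pair msuppX big_seq1 mcoeffX eqxx mul1r. Qed.

Lemma evZ (f : dual) (c : k) p : ev f (c *: p) = c * ev f p.
Proof.
case: (F2_cases c) => ->; first by rewrite scale0r raddf0 mul0r.
by rewrite scale1r mul1r.
Qed.

Lemma P4_ind (Q : P4 -> Prop) : Q 0 -> (forall p q, Q p -> Q q -> Q (p + q)) ->
  (forall m, Q 'X_[m]) -> forall p, Q p.
Proof.
move=> Q0 QD QX p; rewrite (mpolyE p); apply: big_ind => // m _.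
by case: (F2_cases p@_m) => ->; rewrite ?scale0r ?scale1r.
Qed.

Lemma mon_ind (Q : mon -> Prop) : Q 0%MM -> (forall i m, Q m -> Q (U_(i) + m)%MM) ->
  forall m, Q m.
Proof.
move=> Q0 QU m; have [d] := ubnP (mdeg m); elim: d m => // d IH m lt.
case: (eqVneq m 0%MM) => [-> //|]; rewrite -mdeg_eq0 mdegE => nz.
have [i hi] : exists i, m i != 0%N.
  apply/existsP; apply: contraNT nz => /existsPn H.
  by apply/eqP; apply: big1 => i _; apply/eqP; have := H i; rewrite negbK.
have e : m = (U_(i) + (m - U_(i)))%MM by rewrite addmC submK // lep1mP.
move: (m - _)%MM e => m1 e; move: lt; rewrite e mdegD mdeg1 add1n ltnS => lt.
exact: QU (IH _ lt).
Qed.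

Lemma ev_ext (f g : dual) : f =1 g -> ev f =1 ev g.
Proof. by move=> e p; rewrite ev.unlock /pair; apply: eq_bigr => m _; rewrite e. Qed.

Lemma evD (f g : dual) p : ev (dadd f g) p = ev f p + ev g p.
Proof. by rewrite ev.unlock /pair -big_split; apply: eq_bigr => m _; rewrite /dadd mulrDr. Qed.

Lemma ev_sum (I : Type) (r : seq I) (P : pred I) (F : I -> dual) p :
  ev (fun m => \sum_(i <- r | P i) F i m) p = \sum_(i <- r | P i) ev (F i) p.
Proof.
rewrite ev.unlock /pair exchange_big; apply: eq_bigr => m _; exact: mulr_sumr.
Qed.

Lemma ev_scale (c : k) (f : dual) p : ev (fun m => c * f m) p = c * ev f p.
Proof. by rewrite ev.unlock /pair mulr_sumr; apply: eq_bigr => m _; rewrite mulrCA. Qed.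

(** * The total square and linear substitutions *)

Lemma St_is_zmod : zmod_morphism St.
Proof. by rewrite St.unlock => p q; rewrite /Sq_total raddfB. Qed.

Lemma St_is_monoid : monoid_morphism St.
Proof. by rewrite St.unlock /Sq_total; split=> [|p q]; rewrite ?rmorph1 ?rmorphM. Qed.

HB.instance Definition _ := GRing.isZmodMorphism.Build P4 P4 St St_is_zmod.
HB.instance Definition _ := GRing.isMonoidMorphism.Build P4 P4 St St_is_monoid.

Lemma sub_is_zmod g : zmod_morphism (sub g).
Proof. by rewrite sub.unlock => p q; rewrite /gsub raddfB. Qed.

Lemma sub_is_monoid g : monoid_morphism (sub g).
Proof. by rewrite sub.unlock /gsub; split=> [|p q]; rewrite ?rmorph1 ?rmorphM. Qed.

HB.instance Definition _ g := GRing.isZmodMorphism.Build P4 P4 (sub g) (sub_is_zmod g).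
HB.instance Definition _ g := GRing.isMonoidMorphism.Build P4 P4 (sub g) (sub_is_monoid g).

Lemma StX i : St 'X_i = 'X_i + 'X_i ^+ 2.
Proof. by rewrite St.unlock /Sq_total comp_mpolyXU -tnth_nth tnth_mktuple. Qed.

HB.lock Definition lin (v : 'cV[k]_4) : P4 := \sum_(i < 4) v i 0 *: 'X_i.

Lemma subX g i : sub g 'X_i = lin (col i g).
Proof.
by rewrite sub.unlock /gsub comp_mpolyXU lin.unlock -tnth_nth tnth_mktuple; apply: eq_bigr => j _; rewrite mxE.
Qed.

Lemma St_scale c p : St (c *: p) = c *: St p.
Proof. by rewrite St.unlock; exact: comp_mpolyZ. Qed.

Lemma subZ g c p : sub g (c *: p) = c *: sub g p.
Proof. by rewrite sub.unlock; exact: comp_mpolyZ. Qed.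

Lemma sub_lin g v : sub g (lin v) = lin (g *m v).
Proof.
rewrite lin.unlock raddf_sum /=; under eq_bigr => i _ do rewrite subZ subX lin.unlock scaler_sumr.
rewrite exchange_big; apply: eq_bigr => j _ /=; rewrite mxE scaler_suml.
by apply: eq_bigr => i _; rewrite mxE scalerA mulrC.
Qed.

Lemma lin_sqr v : lin v ^+ 2 = \sum_(i < 4) v i 0 *: 'X_i ^+ 2.
Proof.
rewrite lin.unlock; elim/big_rec2: _ => [|i p q _ <-]; first by rewrite expr0n.
by rewrite P4_sqrD exprZn expr2 F2_mulxx.
Qed.

Lemma Sq_lin v : St (lin v) = lin v + lin v ^+ 2.
Proof.
rewrite lin_sqr lin.unlock -big_split raddf_sum /=.
by apply: eq_bigr => i _; rewrite St_scale StX scalerDr.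
Qed.

Lemma P4_rmorph_eq (a b : {rmorphism P4 -> P4}) : (forall i, a 'X_i = b 'X_i) -> a =1 b.
Proof.
move=> e; apply: P4_ind => [|p q e1 e2|]; rewrite ?rmorph0 ?rmorphD ?e1 ?e2 //.
by elim/mon_ind => [|i m IH]; rewrite ?mpolyX0 ?rmorph1 // mpolyXD !rmorphM /= e IH.
Qed.

Lemma sub_Sq g p : sub g (St p) = St (sub g p).
Proof.
apply: (@P4_rmorph_eq (sub g \o St) (St \o sub g)) => i /=.
by rewrite StX rmorphD rmorphXn /= subX Sq_lin.
Qed.

Lemma sub_mul g h p : sub g (sub h p) = sub (g *m h) p.
Proof.
apply: (@P4_rmorph_eq (sub g \o sub h) (sub (g *m h))) => i /=.
by rewrite !subX sub_lin; congr lin; apply/colP => j; rewrite !mxE; apply: eq_bigr => l _; rewrite mxE.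
Qed.

Lemma lin_delta i : lin (delta_mx i 0) = 'X_i.
Proof.
rewrite lin.unlock (bigD1 i) //= big1 ?addr0 => [|j ji]; rewrite mxE eqxx.
  by rewrite eqxx scale1r.
by rewrite (negbTE ji) scale0r.
Qed.

Lemma sub1 p : sub 1%:M p = p.
Proof.
apply: (@P4_rmorph_eq (sub 1%:M) idfun) => i /=.
by rewrite subX -[RHS]lin_delta; congr lin; apply/colP => j; rewrite !mxE eqxx andbT.
Qed.

Lemma actE f g p : ev (act f g) p = ev f (sub g p).
Proof.
elim/P4_ind: p => [|p q e1 e2|m]; rewrite ?raddf0 ?raddfD /= ?e1 ?e2 //.
by rewrite evX act.unlock /dact ev.unlock sub.unlock.
Qed.


Lemma dual_ext (f g : dual) : (forall p, ev f p = ev g p) -> f = g.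
Proof. by move=> e; apply: functional_extensionality => m; rewrite -!evX. Qed.

Lemma actM f g h : act (act f g) h = act f (g *m h).
Proof. by apply: dual_ext => p; rewrite !actE sub_mul. Qed.

Lemma act1 f : act f 1%:M = f.
Proof. by apply: dual_ext => p; rewrite actE sub1. Qed.

Lemma actD f g h : act (dadd f g) h = dadd (act f h) (act g h).
Proof. by apply: dual_ext => p; rewrite actE !evD !actE. Qed.

(** * Functionals annihilated by the Steenrod algebra *)


HB.lock Definition cap (p : P4) (f : dual) : dual := fun m => ev f (p * 'X_[m]).

Lemma capE p f u : ev (cap p f) u = ev f (p * u).
Proof.
elim/P4_ind: u => [|u v e1 e2|m]; rewrite ?mulr0 ?raddf0 ?mulrDr ?raddfD /= ?e1 ?e2 //.
by rewrite evX cap.unlock.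
Qed.

Lemma capXE i f m : cap 'X_i f m = f (U_(i) + m)%MM.
Proof. by rewrite cap.unlock -mpolyXD evX. Qed.

Lemma in_deg_cap n i f : in_deg n.+1 f -> in_deg n (cap 'X_i f).
Proof.
by move=> h m; rewrite capXE => /h; rewrite mdegD mdeg1 add1n => -[].
Qed.

Lemma in_deg0 n f m : in_deg n f -> mdeg m != n -> f m = 0.
Proof. by move=> h; apply: contraNeq => /h ->. Qed.

Lemma ev_homog n d f p : in_deg n f -> p \is d.-homog -> d != n -> ev f p = 0.
Proof.
move=> hf /dhomogP hp dn; rewrite ev.unlock /pair big_seq big1 // => m /hp e.
by rewrite (in_deg0 hf) ?mulr0 // e.
Qed.

Lemma Sq_XM i p : St ('X_i * p) = 'X_i * St p + 'X_i * ('X_i * St p).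
Proof. by rewrite rmorphM /= StX mulrDl mulrA expr2. Qed.

Lemma mpolyXUD i m : 'X_[U_(i) + m] = 'X_i * 'X_[m] :> P4.
Proof. exact: mpolyXD. Qed.

Lemma Sq_bottom n f m : in_deg n f -> (n <= mdeg m)%N -> ev f (St 'X_[m]) = f m.
Proof.
elim/mon_ind: m n f => [|i m IH] n f hf; first by rewrite mpolyX0 rmorph1 -mpolyX0 evX.
rewrite mdegD mdeg1 add1n => le; rewrite mpolyXUD Sq_XM raddfD /= -!capE.
case: n hf le => [|n] hf le.
  have z : cap 'X_i f =1 dzero by move=> u; rewrite capXE (in_deg0 hf) // mdegD mdeg1.
  have zp p : ev (cap 'X_i f) p = 0 by rewrite (ev_ext z) ev.unlock /pair big1 // => u _; rewrite mulr0.
  by rewrite (capE 'X_i (cap _ _)) !zp addr0 (in_deg0 hf) // mdegD mdeg1.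
have hi := in_deg_cap (i := i) hf; rewrite (IH n) // capXE.
suff -> : ev (cap 'X_i (cap 'X_i f)) (St 'X_[m]) = 0 by rewrite addr0.
case: n hf le hi => [|n] hf le hi.
  rewrite ev.unlock /pair big1 // => u _; rewrite capXE (in_deg0 hi) ?mulr0 // mdegD mdeg1 //.
rewrite (IH n _ (in_deg_cap hi) (ltnW le)).
by rewrite (in_deg0 (in_deg_cap (i := i) hi)) // gtn_eqF.
Qed.

Lemma Sq_top n f m : in_deg n f -> (2 * mdeg m <= n)%N ->
  ev f (St 'X_[m]) = ev f ('X_[m] ^+ 2).
Proof.
elim/mon_ind: m n f => [|i m IH] n f hf; first by rewrite mpolyX0 rmorph1 expr1n.
rewrite mdegD mdeg1 add1n mulnS => le; rewrite mpolyXUD Sq_XM raddfD /= -!capE.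
case: n hf le => [|[|n]] // hf; rewrite !ltnS => le.
have h1 := in_deg_cap (i := i) hf; have h2 := in_deg_cap (i := i) h1.
rewrite (IH n.+1) ?ltnS // 1?leqW // -capE (IH n) // !capE.
rewrite -mulrA [in RHS](mulrCA 'X_[m]) -[RHS]add0r; congr (_ + _).
rewrite -capE -expr2 mpolyXn evX (in_deg0 h1) // mdegMn mulnC.
by rewrite ltn_eqF.
Qed.

Definition annih n (f : dual) : Prop := in_deg n f /\ forall p, ev f (St p) = ev f p.

Lemma ev_hcomp n f p : in_deg n f -> ev f (hcomp n p) = ev f p.
Proof.
move=> hf; rewrite /hcomp raddf_sum /= [in RHS]ev.unlock /pair [RHS](bigID (fun m => mdeg m == n)) /=.
rewrite [X in _ + X]big1 ?addr0 => [|m /(in_deg0 hf) ->]; last by rewrite mulr0.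
by apply: eq_bigr => m _; rewrite evZ evX.
Qed.

Lemma ev_hcomp0 n d f p : in_deg n f -> d != n -> ev f (hcomp d p) = 0.
Proof.
move=> hf dn; rewrite /hcomp raddf_sum /= big1 // => m /eqP e.
by rewrite evZ evX (in_deg0 hf) ?mulr0 // e.
Qed.

Lemma PA_annih n f : PA n f <-> annih n f.
Proof.
have sq i m : pair f (Sq i 'X_[m]) = ev f (hcomp (mdeg m + i) (St 'X_[m])).
  by rewrite ev.unlock St.unlock /Sq msuppX big_seq1 mcoeffX eqxx scale1r.
split=> -[hf h]; split=> //.
  elim/P4_ind => [|p q e1 e2|m]; rewrite ?raddf0 ?raddfD /= ?e1 ?e2 //.
  rewrite evX; case: (leqP n (mdeg m)) => [/(Sq_bottom hf) //|lt].
  rewrite (in_deg0 hf) ?ltn_eqF // -(ev_hcomp _ hf).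
  by have := h (n - mdeg m)%N m; rewrite /dSq sq subn_gt0 subnKC ?(ltnW lt) // => ->.
move=> i m i0; rewrite /dSq sq; case: (eqVneq (mdeg m + i)%N n) => [e|/(ev_hcomp0 _ hf) //].
rewrite e ev_hcomp // h evX (in_deg0 hf) // -e ltn_eqF //.
by rewrite -{1}[mdeg m]addn0 ltn_add2l.
Qed.

(* The lowest-degree part of the total square is the identity, so a homogeneous
   functional is determined by its values on the image of the total square. *)
Lemma Sq_image_dense n f : in_deg n f -> (forall u, ev f (St u) = 0) -> f = dzero.
Proof.
move=> hf h; apply: functional_extensionality => m.
case: (eqVneq (mdeg m) n) => [e|/(in_deg0 hf) //].
by rewrite -(Sq_bottom hf) ?h // e.
Qed.

Lemma ev0 p : ev dzero p = 0.
Proof. by rewrite ev.unlock /pair big1 // => m _; rewrite mulr0. Qed.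

Lemma annih0 n : annih n dzero.
Proof. by split=> [m|p]; rewrite ?eqxx // !ev0. Qed.

Lemma annihD n f g : annih n f -> annih n g -> annih n (dadd f g).
Proof.
move=> [d1 h1] [d2 h2]; split=> [m|p]; last by rewrite !evD h1 h2.
apply: contraNeq => dn; rewrite /dadd (in_deg0 d1) ?(in_deg0 d2) ?addr0 //;
 by apply/eqP.
Qed.

Lemma lin_homog v : lin v \is 1.-homog.
Proof. by rewrite lin.unlock; apply: rpred_sum => i _; apply: rpredZ; rewrite dhomogX /= mdeg1 eqxx. Qed.

Lemma sub_homog g m : sub g 'X_[m] \is (mdeg m).-homog.
Proof.
elim/mon_ind: m => [|i m IH]; first by rewrite mpolyX0 rmorph1 mdeg0 dhomog1.
rewrite mpolyXUD rmorphM /= subX mdegD mdeg1; apply: dhomogM IH; exact: lin_homog.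
Qed.

Lemma in_deg_act n f g : in_deg n f -> in_deg n (act f g).
Proof.
move=> hf m; rewrite -evX actE => h; apply/eqP; apply: contraNT h => dn.
by rewrite (ev_homog hf (sub_homog g m)).
Qed.

Lemma annih_act n f g : annih n f -> annih n (act f g).
Proof.
move=> [d h]; split=> [|p]; first exact: in_deg_act.
by rewrite !actE sub_Sq h.
Qed.

(* [f] comes from the divided power algebra, in three variables, of the hyperplane [v = 0]. *)
Definition killed (v : 'cV[k]_4) (f : dual) := forall u, ev f (lin v * u) = 0.

Lemma killed_act v v' g f : g *m v' = v -> killed v f -> killed v' (act f g).
Proof. by move=> e h u; rewrite actE rmorphM /= sub_lin e h. Qed.

Lemma annih_cap_Sq n f v u : annih n f ->
  ev f (lin v * u) = ev f (lin v * St u) + ev f (lin v * (lin v * St u)).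
Proof. by move=> [_ h]; rewrite -h rmorphM /= Sq_lin mulrDl raddfD /= expr2 -mulrA. Qed.

(** * Components with respect to squares *)

HB.lock Definition xs (E : {set 'I_4}) : P4 := \prod_(i in E) 'X_i.

Definition mk (E : {set 'I_4}) (m : mon) : mon := [multinom ((i \in E) + 2 * m i)%N | i < 4].
Definition oddset (m : mon) : {set 'I_4} := [set i | odd (m i)].
Definition halfm (m : mon) : mon := [multinom (m i)./2 | i < 4].

Lemma oddset_mk E m : oddset (mk E m) = E.
Proof. by apply/setP => i; rewrite inE mnmE oddD mul2n odd_double addbF; case: (i \in E). Qed.

Lemma halfm_mk E m : halfm (mk E m) = m.
Proof. by apply/mnmP => i; rewrite !mnmE mul2n half_bit_double. Qed.

Lemma mk_halfm m : mk (oddset m) (halfm m) = m.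
Proof. by apply/mnmP => i; rewrite !mnmE inE mul2n odd_double_half. Qed.

Lemma mpolyX_mk E m : 'X_[mk E m] = xs E * 'X_[m] ^+ 2.
Proof.
rewrite !mpolyXE_id xs.unlock -prodrXl [X in X * _]big_mkcond -big_split.
by apply: eq_bigr => i _; rewrite mnmE exprD mulnC exprM; case: (i \in E).
Qed.

Lemma P4_sq_ind (Q : P4 -> Prop) : Q 0 -> (forall p q, Q p -> Q q -> Q (p + q)) ->
  (forall E m, Q (xs E * 'X_[m] ^+ 2)) -> forall p, Q p.
Proof.
by move=> Q0 QD QX; apply: P4_ind => // m; rewrite -[m]mk_halfm mpolyX_mk.
Qed.

Lemma xsU i (E : {set 'I_4}) : i \notin E -> 'X_i * xs E = xs (i |: E).
Proof. by move=> h; rewrite xs.unlock big_setU1. Qed.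

Lemma xsD i (E : {set 'I_4}) : i \in E -> 'X_i * xs E = xs (E :\ i) * 'X_i ^+ 2.
Proof. by move=> h; rewrite xs.unlock (big_setD1 i h) /= mulrA -expr2 mulrC. Qed.

Lemma xs1 i : xs [set i] = 'X_i.
Proof. by rewrite xs.unlock big_set1. Qed.

Lemma xs_homog E : xs E \is #|E|.-homog.
Proof.
rewrite xs.unlock -sum1_card; apply: (big_rec2 (fun p d => p \is d.-homog)) => [|i p d _ h].
  exact: dhomog1.
by apply: dhomogM h; rewrite dhomogX /= mdeg1.
Qed.

Lemma xs_sqr_homog E m : xs E * 'X_[m] ^+ 2 \is (#|E| + 2 * mdeg m).-homog.
Proof.
apply: dhomogM; first exact: xs_homog.
by rewrite mpolyXn dhomogX /= mdegMn mulnC.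
Qed.

Lemma St_xs E : St (xs E) = \sum_(J : {set 'I_4} | J \subset E) xs (E :\: J) * xs J ^+ 2.
Proof.
rewrite xs.unlock rmorph_prod /=; under eq_bigr => i _ do rewrite StX addrC.
pose F i : P4 := if i \in E then 'X_i ^+ 2 else 0.
pose G i : P4 := if i \in E then 'X_i else 1.
transitivity (\prod_i (F i + G i)).
  rewrite big_mkcond; apply: eq_bigr => i _; rewrite /F /G.
  by case: ifP => // _; rewrite add0r.
rewrite bigA_distr [RHS]big_mkcond; apply: eq_bigr => J _.
case: ifPn => [sJE|/subsetPn [i iJ iE]]; last first.
  by rewrite (bigD1 i) //= iJ /F (negbTE iE) mul0r.
rewrite -prodrXl [X in X * _]big_mkcond [X in _ * X]big_mkcond -big_split.
apply: eq_bigr => i _ /=; rewrite /F /G inE; case: ifP => iJ /=; last by rewrite mulr1.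
by rewrite (subsetP sJE) // mul1r.
Qed.

Definition X3 (i : 'I_4) : P4 := xs (~: [set i]).

Lemma cards3P (E : {set 'I_4}) : #|E| = 3%N -> exists i, E = ~: [set i].
Proof.
move=> h; have := cardsC E; rewrite h card_ord => /eqP; rewrite -[4%N]/(3 + 1)%N eqn_add2l.
by move=> /cards1P [i e]; exists i; rewrite -e setCK.
Qed.

Lemma cards4P (E : {set 'I_4}) : #|E| = 4%N -> E = setT.
Proof. by move=> h; apply/eqP; rewrite eqEcard subsetT cardsT card_ord h. Qed.

Lemma card_setC1 (i : 'I_4) : #|~: [set i]| = 3%N.
Proof. by rewrite cardsC1 card_ord. Qed.

(* [three_odd f]: among the monomials [x^E y^2] with [E] the set of odd exponents, [f] only
   sees those with [#|E| = 3]. *)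
Definition three_odd (f : dual) := forall (E : {set 'I_4}) (y : P4), #|E| != 3%N -> ev f (xs E * y ^+ 2) = 0.

Definition sing (f : dual) := forall i (y : P4), ev f ('X_i * y ^+ 2) = 0.

Lemma sing_lin f v (y : P4) : sing f -> ev f (lin v * y ^+ 2) = 0.
Proof.
move=> h; rewrite lin.unlock mulr_suml raddf_sum /= big1 // => i _.
by rewrite -scalerAl evZ h mulr0.
Qed.

Lemma sing_act f g : sing f -> sing (act f g).
Proof. by move=> h i y; rewrite actE rmorphM rmorphXn /= subX sing_lin. Qed.

Lemma three_odd_sing n f : in_deg n f -> odd n -> sing f -> three_odd f.
Proof.
move=> hf on hs E y; case: (boolP (odd #|E|)) => oE E3.
  have : (#|E| <= 4)%N by have := max_card (mem E); rewrite card_ord.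
  move: oE E3; case e: #|E| => [|[|[|[|[|]]]]] // _ _ _.
  by have /eqP/cards1P[i ->] := e; rewrite xs1 hs.
elim/P4_ind: y => [|p q e1 e2|m]; first by rewrite expr0n mulr0 raddf0.
  by rewrite P4_sqrD mulrDr raddfD /= e1 e2 addr0.
rewrite (ev_homog hf (xs_sqr_homog E m)) //; apply: contraNneq oE => e.
by move: on; rewrite -e oddD mul2n odd_double addbF.
Qed.

Lemma sing_three_odd f : three_odd f -> sing f.
Proof. by move=> h i y; rewrite -xs1 h // cards1. Qed.

Section T3.
Variables (f : dual) (tf : three_odd f).

Lemma three_odd_St_low (E : {set 'I_4}) (y : P4) : (#|E| < 3)%N -> ev f (St (xs E) * y ^+ 2) = 0.
Proof.
move=> h; rewrite St_xs mulr_suml raddf_sum /= big1 //= => J _.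
rewrite -mulrA -exprMn tf // neq_ltn (leq_ltn_trans _ h) //.
exact: subset_leq_card (subsetDl _ _).
Qed.

Lemma three_odd_St3 i (y : P4) : ev f (St (X3 i) * y ^+ 2) = ev f (X3 i * y ^+ 2).
Proof.
rewrite St_xs mulr_suml raddf_sum (bigD1 set0) ?sub0set //= setD0 {2}xs.unlock big_set0.
rewrite expr1n mulr1 big1 ?addr0 // => J /andP[sJ J0].
rewrite -mulrA -exprMn tf // cardsD (setIidPr sJ) card_setC1 neq_ltn ltn_subrL card_gt0 J0 //.
Qed.

Lemma three_odd_St4 (y : P4) :
  ev f (St (xs setT) * y ^+ 2) = \sum_i ev f (X3 i * ('X_i * y) ^+ 2).
Proof.
rewrite St_xs mulr_suml raddf_sum /=.
rewrite (bigID (fun J : {set 'I_4} => J \in [set [set i] | i : 'I_4])) /=.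
rewrite [X in _ + X]big1 ?addr0 => [|J /andP[_ Jn]].
  under eq_bigl => J do rewrite subsetT.
  rewrite big_imset /= => [|i j _ _]; last exact: set1_inj.
  by apply: eq_bigr => i _; rewrite setTD xs1 -mulrA -exprMn.
rewrite -mulrA -exprMn tf // setTD.
apply: contraNneq Jn => /cards3P [i /setC_inj ->]; exact: imset_f.
Qed.

End T3.

HB.lock Definition kcomp (i : 'I_4) (f : dual) : dual := fun m => ev f (X3 i * 'X_[m] ^+ 2).

Lemma kcompE i f y : ev (kcomp i f) y = ev f (X3 i * y ^+ 2).
Proof.
elim/P4_ind: y => [|p q e1 e2|m]; first by rewrite expr0n mulr0 !raddf0.
  by rewrite P4_sqrD mulrDr !raddfD /= e1 e2.
by rewrite evX kcomp.unlock.
Qed.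

Lemma three_odd_ext f g : three_odd f -> three_odd g -> (forall i, kcomp i f = kcomp i g) -> f = g.
Proof.
move=> tf tg e; apply: dual_ext; apply: P4_sq_ind => [|p q e1 e2|E m]; rewrite ?raddf0 ?raddfD /= ?e1 ?e2 //.
case: (eqVneq #|E| 3%N) => [/cards3P [i ->]|h]; last by rewrite tf ?tg.
by rewrite -!kcompE e.
Qed.

Lemma cards2C (E : {set 'I_4}) : #|E| = 2%N -> exists i j, i != j /\ E = ~: [set i; j].
Proof.
move=> h; have := cardsC E; rewrite h card_ord => /eqP; rewrite -[4%N]/(2 + 2)%N eqn_add2l.
by move=> /cards2P [i [j [ij e]]]; exists i, j; split=> //; rewrite -e setCK.
Qed.

Section Family.
Variables (g : 'I_4 -> dual) (tg : forall l, three_odd (g l)).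

Lemma fam2 i j (y : P4) : i != j ->
  \sum_l ev (g l) ('X_l * (xs (~: [set i; j]) * y ^+ 2)) =
  ev (kcomp j (g i)) y + ev (kcomp i (g j)) y.
Proof.
move=> ij; rewrite !kcompE (bigD1 i) //= (bigD1 j) 1?eq_sym //= (mulrA 'X_i) (mulrA 'X_j).
have ei : i |: ~: [set i; j] = ~: [set j].
  by apply/setP => l; rewrite !inE; case: (eqVneq l i) => //= ->; rewrite ij.
have ej : j |: ~: [set i; j] = ~: [set i].
  by apply/setP => l; rewrite !inE; case: (eqVneq l j) => //= [->|]; rewrite ?orbF // eq_sym ij.
rewrite !xsU ?ei ?ej; try by rewrite !inE eqxx ?orbT.
rewrite big1 ?addr0 // => l /andP[li lj].
have hl : l \in ~: [set i; j] by rewrite !inE negb_or li lj.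
rewrite mulrA xsD // -mulrA -exprMn tg //.
have := cardsD1 l (~: [set i; j]); rewrite hl cardsCs setCK cards2 ij card_ord.
by case: #|_| => [|[|[|]]].
Qed.

Lemma famT (y : P4) :
  \sum_l ev (g l) ('X_l * (xs setT * y ^+ 2)) = \sum_l ev (kcomp l (g l)) ('X_l * y).
Proof.
apply: eq_bigr => l _; rewrite mulrA xsD ?inE // -mulrA -exprMn kcompE /X3.
by rewrite setTD.
Qed.

Lemma fam_other (E : {set 'I_4}) (y : P4) : #|E| != 2%N -> #|E| != 4%N ->
  \sum_l ev (g l) ('X_l * (xs E * y ^+ 2)) = 0.
Proof.
move=> E2 E4; rewrite big1 // => l _; rewrite mulrA; case: (boolP (l \in E)) => lE.
  rewrite xsD // -mulrA -exprMn tg //; move: E4; rewrite (cardsD1 l E) lE.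
  by rewrite add1n eqSS.
by rewrite xsU // tg // cardsU1 lE add1n eqSS.
Qed.

Hypothesis sum0 : forall u, \sum_l ev (g l) ('X_l * u) = 0.

Lemma fam_sym i j : kcomp j (g i) = kcomp i (g j).
Proof.
case: (eqVneq i j) => [->//|ij]; apply: dual_ext => y; apply: F2_addK.
by rewrite -fam2.
Qed.

Lemma fam_diag y : \sum_l ev (kcomp l (g l)) ('X_l * y) = 0.
Proof. by rewrite -famT. Qed.

End Family.

(** * The Kameko step *)

Lemma P4_frob (p q : P4) j : (p + q) ^+ (2 ^ j) = p ^+ (2 ^ j) + q ^+ (2 ^ j).
Proof.
elim: j => [|j IH]; first by rewrite !expr1.
by rewrite expnSr !exprM IH P4_sqrD.
Qed.

Lemma xpow2_telescope n f i u j : annih n f -> (forall j, ev f ('X_i ^+ (2 ^ j) * u) = 0) ->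
  ev f ('X_i ^+ (2 ^ j) * St u) = ev f ('X_i * St u).
Proof.
move=> [_ h] z; elim: j => [|j <-]; first by rewrite expr1.
apply: F2_addK; rewrite expnS mulnC addrC -raddfD -mulrDl.
have -> : ('X_i ^+ (2 ^ j) + 'X_i ^+ (2 ^ j * 2) : P4) = St ('X_i ^+ (2 ^ j)).
  by rewrite rmorphXn /= StX P4_frob -exprM mulnC.
by rewrite -rmorphM /= h z.
Qed.

(* Singer's criterion in the case used here: [x y^2] is the top part of [x Sq(y)], which
   agrees with [x^(2^j) Sq(y)] modulo hits, and the latter vanishes for large [j]. *)
Lemma annih_sing e f : annih (2 * e + 1) f -> ~~ odd e -> (0 < e)%N -> sing f.
Proof.
move=> Kf oe e0 i y; have [df _] := Kf.
elim/P4_ind: y => [|p q e1 e2|m]; first by rewrite expr0n mulr0 raddf0.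
  by rewrite P4_sqrD mulrDr raddfD /= e1 e2 addr0.
have hom j u : ('X_i ^+ j * 'X_[u] : P4) \is (j + mdeg u).-homog.
  by rewrite mpolyXn -mpolyXD dhomogX /= mdegD mdegMn mdeg1 mul1n eqxx.
case: (eqVneq (mdeg m) e) => [dm|dm]; last first.
  rewrite mpolyXn -[X in ev f (X * _)]expr1 (ev_homog df (hom _ _)) // mdegMn.
  by rewrite addnC eqn_add2r mulnC eqn_mul2l.
have d1 : in_deg (2 * e) (cap 'X_i f) by apply: in_deg_cap; rewrite -addn1.
rewrite -capE -(Sq_top d1) ?dm // capE.
rewrite -(@xpow2_telescope _ _ _ _ (2 * e).+2 Kf) => [|j].
  elim/P4_ind: (St _) => [|p q e1 e2|u]; rewrite ?mulr0 ?raddf0 ?mulrDr ?raddfD /= ?e1 ?e2 ?addr0 //.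
  rewrite (ev_homog df (hom _ _)) // gtn_eqF // addn1 ltn_addr //.
  by apply: ltn_trans (ltn_expl _ _).
rewrite (ev_homog df (hom _ _)) // dm mul2n -addnn -addnA [X in _ != X]addnC eqn_add2r addn1.
by case: j => [|j]; [rewrite expn0 eqSS eq_sym -lt0n | apply: contraNneq oe => h; have := congr1 odd h; rewrite oddX /= => /esym/negbFE].
Qed.

Section Down.
Variables (d : nat) (f : dual).
Hypotheses (Kf : annih (2 * d + 3) f) (tf : three_odd f).

Lemma annih_kcomp i : annih d (kcomp i f).
Proof.
have [df h] := Kf; split=> [m|y].
  rewrite kcomp.unlock => nz; apply/eqP; apply: contraNT nz => dm.
  rewrite (ev_homog df (xs_sqr_homog _ m)) // card_setC1 addnC eqn_add2r eqn_mul2l //.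
by rewrite !kcompE -(three_odd_St3 tf) -rmorphXn -rmorphM h.
Qed.

Lemma kcomp_rel u : \sum_l ev (kcomp l f) ('X_l * u) = 0.
Proof.
have [df h] := Kf.
pose e : dual := fun m => \sum_l cap 'X_l (kcomp l f) m.
have eE p : ev e p = \sum_l ev (kcomp l f) ('X_l * p).
  by rewrite ev_sum; apply: eq_bigr => l _; rewrite capE.
rewrite -eE; suff -> : e = dzero by rewrite ev0.
apply: (@Sq_image_dense d.-1) => [m|p]; last first.
  rewrite eE; under eq_bigr => l _ do rewrite kcompE.
  rewrite -(three_odd_St4 tf) -rmorphXn -rmorphM h tf // cardsT card_ord //.
apply: contraNeq => dm; rewrite /e big1 // => l _; rewrite capXE.
have [dl _] := annih_kcomp l; rewrite (in_deg0 dl) // mdegD mdeg1.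
by apply: contraNneq dm => <-; rewrite add1n.
Qed.

End Down.

(* The inverse of [kcomp] on functionals killed by [v]: it is the Kameko map
   a_j^(b) |-> a_j^(2 b + 1) in the three variables dual to the hyperplane [v = 0]. *)
Definition lift (v : 'cV[k]_4) (h : dual) : dual := fun m =>
  \sum_i v i 0 * (oddset m == ~: [set i])%:R * h (halfm m).

Lemma liftE v h (E : {set 'I_4}) (y : P4) :
  ev (lift v h) (xs E * y ^+ 2) = \sum_i v i 0 * (E == ~: [set i])%:R * ev h y.
Proof.
elim/P4_ind: y => [|p q e1 e2|m].
- by rewrite expr0n mulr0 !raddf0 big1 // => i _; rewrite mulr0.
- rewrite P4_sqrD mulrDr !raddfD /= e1 e2 -big_split.
  by apply: eq_bigr => i _; rewrite mulrDr.
by rewrite -mpolyX_mk !evX /lift oddset_mk halfm_mk.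
Qed.

Lemma lift_three_odd v h : three_odd (lift v h).
Proof.
move=> E y h3; rewrite liftE big1 // => i _; move: h3; case: (E =P ~: [set i]) => [->|_ _]; last by rewrite mulr0 mul0r.
by rewrite card_setC1.
Qed.

Lemma kcomp_lift i v h : kcomp i (lift v h) = fun m => v i 0 * h m.
Proof.
apply: dual_ext => y; rewrite kcompE /X3 liftE ev_scale (bigD1 i) //= eqxx mulr1 big1 ?addr0 // => j ji.
by rewrite (inj_eq (@setC_inj _)) (inj_eq (@set1_inj _)) eq_sym (negbTE ji) mulr0 mul0r.
Qed.

Lemma scale0_dual (h : dual) : (fun m => 0 * h m) = dzero.
Proof. by apply: functional_extensionality => m; rewrite mul0r. Qed.

Lemma scale1_dual (h : dual) : (fun m => 1 * h m) = h.
Proof. by apply: functional_extensionality => m; rewrite mul1r. Qed.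

Lemma lin_fam f v u : ev f (lin v * u) = \sum_l ev (fun m => v l 0 * f m) ('X_l * u).
Proof.
rewrite lin.unlock mulr_suml raddf_sum /=; apply: eq_bigr => l _.
by rewrite -scalerAl evZ ev_scale.
Qed.

Lemma three_odd_scale (c : k) f : three_odd f -> three_odd (fun m => c * f m).
Proof. by move=> tf E y E3; rewrite ev_scale tf ?mulr0. Qed.

Lemma killed_lift v h : killed v h -> killed v (lift v h).
Proof.
move=> kh u; elim/P4_sq_ind: u => [|p q e1 e2|E m]; rewrite ?mulr0 ?raddf0 ?mulrDr ?raddfD /= ?e1 ?e2 ?addr0 //.
have tF l := three_odd_scale (v l 0) (@lift_three_odd v h).
rewrite lin_fam; case: (eqVneq #|E| 4%N) => [/cards4P ->|E4].
  rewrite famT -[RHS](kh 'X_[m]) lin_fam; apply: eq_bigr => l _.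
  by rewrite !kcompE !ev_scale -kcompE kcomp_lift ev_scale mulrA F2_mulxx.
case: (eqVneq #|E| 2%N) => [/cards2C [i [j [ij ->]]]|E2]; last exact: fam_other.
rewrite fam2 // !kcompE !ev_scale -!kcompE !kcomp_lift !ev_scale mulrCA; exact: F2_addxx.
Qed.

Lemma in_deg_lift d v h : in_deg d h -> in_deg (2 * d + 3) (lift v h).
Proof.
move=> dh m nz; rewrite -[m]mk_halfm.
have [i /andP[/eqP oi hi]] : exists i, (oddset m == ~: [set i]) && (h (halfm m) != 0).
  apply/existsP; apply: contraNT nz => /existsPn H; apply/eqP; apply: big1 => i _.
  by have := H i; case: eqP => _ /=; rewrite ?mulr0 ?mul0r // negbK => /eqP ->; rewrite mulr0.
have := xs_sqr_homog (oddset m) (halfm m); rewrite -mpolyX_mk dhomogX /= => /eqP ->.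
by rewrite oi card_setC1 (dh _ hi) addnC.
Qed.

Lemma annih_lift d v h : annih d h -> killed v h -> annih (2 * d + 3) (lift v h).
Proof.
move=> [dh h1] kh; split=> [|p]; first exact: in_deg_lift.
have tF := @lift_three_odd v h.
elim/P4_sq_ind: p => [|p q e1 e2|E m]; rewrite ?rmorph0 ?raddf0 ?rmorphD ?raddfD /= ?e1 ?e2 //.
rewrite rmorphM rmorphXn /=; case: (ltnP #|E| 3) => [E3|].
  by rewrite three_odd_St_low ?tF // ltn_eqF.
rewrite leq_eqVlt => /orP[/eqP/esym/cards3P [i ->]|E3].
  by rewrite three_odd_St3 // -/(X3 i) -!kcompE !kcomp_lift !ev_scale h1.
have -> : E = setT.
  by apply: cards4P; apply/eqP; rewrite eqn_leq E3 andbT; have := max_card (mem E); rewrite card_ord.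
rewrite three_odd_St4 // [RHS]tF ?cardsT ?card_ord // -[RHS](kh (St 'X_[m])) lin_fam.
by apply: eq_bigr => i _; rewrite -kcompE kcomp_lift !ev_scale.
Qed.

Lemma killed_kcomp v f i j : three_odd f -> killed v f ->
  (fun m => v i 0 * kcomp j f m) = (fun m => v j 0 * kcomp i f m).
Proof.
move=> tf kf; case: (eqVneq i j) => [->//|ij].
apply: dual_ext => y; rewrite !ev_scale; apply: F2_addK.
have := kf (xs (~: [set i; j]) * y ^+ 2); rewrite lin_fam fam2 //.
  by rewrite !kcompE !ev_scale.
by move=> l; exact: three_odd_scale.
Qed.

Lemma lift_kcomp v f i : three_odd f -> killed v f -> v i 0 != 0 -> f = lift v (kcomp i f).
Proof.
move=> tf kf /F2_neq0 vi; apply: three_odd_ext => //; first exact: lift_three_odd.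
move=> j; rewrite kcomp_lift -(killed_kcomp i j tf kf) vi.
by rewrite scale1_dual.
Qed.

Lemma killed_lift_inv v h : killed v (lift v h) -> killed v h.
Proof.
move=> kF u; elim/P4_ind: u => [|p q e1 e2|m]; rewrite ?mulr0 ?raddf0 ?mulrDr ?raddfD /= ?e1 ?e2 ?addr0 //.
have := kF (xs setT * 'X_[m] ^+ 2); rewrite !lin_fam famT => H.
rewrite -[RHS]H; by apply: eq_bigr => l _; rewrite kcompE !ev_scale -kcompE kcomp_lift ev_scale mulrA F2_mulxx.
Qed.

Lemma killed_kcomp_killed v f i : three_odd f -> killed v f -> v i 0 != 0 -> killed v (kcomp i f).
Proof. by move=> tf kf vi; apply: killed_lift_inv; rewrite -lift_kcomp. Qed.

Lemma lift_inj v h : v != 0 -> lift v h = dzero -> h = dzero.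
Proof.
move=> /cV0Pn [i /F2_neq0 vi] e; have := kcomp_lift i v h.
rewrite e vi scale1_dual => <-.
by apply: dual_ext => y; rewrite kcompE !ev0.
Qed.

(* The coefficient of [h] is the pairing of [p] with the lift of the degree 0 functional. *)
Lemma lift_cubic v h p : p \is 3.-homog -> exists c : k, forall z : P4, ev (lift v h) (p * z ^+ 2) = c * ev h z.
Proof.
move=> /dhomogP hp; exists (\sum_(m <- msupp p) p@_m * \sum_i v i 0 * (oddset m == ~: [set i])%:R) => z.
rewrite {1}(mpolyE p) mulr_suml raddf_sum mulr_suml /= !big_seq; apply: eq_bigr => m /hp dm.
rewrite -scalerAl evZ -mulrA; congr (_ * _).
rewrite -[in LHS](mk_halfm m) mpolyX_mk -mulrA -exprMn liftE mulr_suml; apply: eq_bigr => i _.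
case: eqP => [oi|_]; last by rewrite mulr0 !mul0r.
suff -> : halfm m = 0%MM by rewrite mpolyX0 mul1r.
apply/eqP; rewrite -mdeg_eq0; have := xs_sqr_homog (oddset m) (halfm m).
rewrite -mpolyX_mk dhomogX /= mk_halfm dm oi card_setC1 => /eqP.
by case: (mdeg _).
Qed.

Lemma X3_homog i : X3 i \is 3.-homog.
Proof. by have := xs_homog (~: [set i]); rewrite card_setC1. Qed.

Lemma sub_homogP g d p : p \is d.-homog -> sub g p \is d.-homog.
Proof.
move=> /dhomogP hp; rewrite (mpolyE p) raddf_sum /= big_seq; apply: rpred_sum => m /hp dm.
by rewrite subZ; apply: rpredZ; rewrite -dm; exact: sub_homog.
Qed.

Lemma act0 g : act dzero g = dzero.
Proof. by apply: dual_ext => p; rewrite actE !ev0. Qed.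

Lemma lift_act d (v v' : 'cV[k]_4) g h : g \in unitmx -> annih d h -> killed v h -> v' != 0 -> v != 0 -> g *m v' = v ->
  act (lift v h) g = lift v' (act h g).
Proof.
move=> ug [dh _] kh v'0 v0 e.
have /cV0Pn [i vi] := v'0.
have tf : three_odd (act (lift v h) g).
  apply: (@three_odd_sing (2 * d + 3)); first exact/in_deg_act/in_deg_lift.
    by rewrite oddD mul2n odd_double.
  exact/sing_act/sing_three_odd/lift_three_odd.
have kf : killed v' (act (lift v h) g) by apply: killed_act e (killed_lift kh).
have [c hc] := lift_cubic v h (sub_homogP g (X3_homog i)).
have ce : kcomp i (act (lift v h) g) = fun m => c * act h g m.
  by apply: dual_ext => y; rewrite kcompE actE rmorphM rmorphXn /= hc ev_scale actE.
have fE := lift_kcomp tf kf vi; rewrite fE ce.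
case: (F2_cases c) ce fE => ->; rewrite ?scale1_dual // scale0_dual => -> fE.
suff -> : h = dzero by rewrite act0.
apply: (lift_inj v0); rewrite -[LHS]act1 -(mulmxV ug) -actM fE.
suff -> : lift v' dzero = dzero by rewrite act0.
apply: functional_extensionality => m; rewrite /lift big1 // => j _; exact: mulr0.
Qed.

(** * Decomposition along hyperplanes *)

Lemma annih_three_odd d f : odd d -> annih (2 * d + 3) f -> three_odd f.
Proof.
move=> od Kf; have [df _] := Kf.
apply: three_odd_sing df _ _; first by rewrite oddD mul2n odd_double.
have e : (2 * d + 3 = 2 * d.+1 + 1)%N by rewrite mulnS addnAC addnC.
by apply: (@annih_sing d.+1); rewrite -?e //= od.
Qed.

Lemma pair_cancel (j : 'I_4) (H : {set 'I_4} -> k) :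
  (forall S, H (j |: S) = H (S :\ j)) -> \sum_S H S = 0.
Proof.
move=> e; rewrite (bigID (fun S : {set 'I_4} => j \in S)) /=.
rewrite [X in _ + X](reindex_onto (fun S => S :\ j) (fun S => j |: S)) /=; last first.
  by move=> S jS; rewrite setU1K.
rewrite [X in _ + X](eq_big (fun S : {set 'I_4} => j \in S) H) ?F2_addxx // => [S|S /andP[_ /eqP jS]].
  rewrite setD11 /=; apply/eqP/idP => [<-|]; [exact: setU11 | exact: setD1K].
by rewrite -e -{1}jS setUA setUid jS.
Qed.

Lemma moebius (c : {set 'I_4} -> k) (T : {set 'I_4}) :
  \sum_(S : {set 'I_4} | T \subset S) \sum_(U : {set 'I_4} | S \subset U) c U = c T.
Proof.
under eq_bigr => S _ do rewrite big_mkcond.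
rewrite exchange_big (bigD1 T) //= [X in _ + X]big1 ?addr0 => [|U UT].
  rewrite -big_mkcondr (big_pred1 T) // => S; rewrite /= eqEsubset andbC //.
case: (boolP (T \subset U)) => [TU|TU]; last first.
  by apply: big1 => S TS; case: ifP => // SU; case/negP: TU; apply: subset_trans SU.
have [j jU jT] : exists2 j, j \in U & j \notin T by apply/subsetPn; move: UT; rewrite eqEsubset TU andbT.
rewrite big_mkcond; apply: (@pair_cancel j) => S.
have -> : (T \subset j |: S) = (T \subset S :\ j).
  by rewrite subsetD1 jT andbT -subDset (setDidPl _) // disjoint_sym disjoints1.
by rewrite subUset sub1set jU subDset (setUidPr _) // sub1set.
Qed.

Definition vec (T : {set 'I_4}) : 'cV[k]_4 := \col_i (i \in T)%:R.

Lemma lin_vec T : lin (vec T) = \sum_(i in T) 'X_i.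
Proof.
rewrite lin.unlock [RHS]big_mkcond; apply: eq_bigr => i _; rewrite mxE.
by case: (i \in T); rewrite ?scale1r ?scale0r.
Qed.

Lemma ev_dsum (G : {set 'I_4} -> dual) (P : pred {set 'I_4}) p :
  ev (fun m => \sum_(S | P S) G S m) p = \sum_(S | P S) ev (G S) p.
Proof. exact: ev_sum. Qed.

Definition upsum (G : {set 'I_4} -> dual) (T : {set 'I_4}) : dual :=
  fun m => \sum_(S : {set 'I_4} | T \subset S) G S m.

Lemma upsum_lin (G : {set 'I_4} -> dual) (T : {set 'I_4}) (u : P4) :
  \sum_(S : {set 'I_4} | T \subset S) \sum_l ev (G (l |: S)) ('X_l * u) =
  ev (upsum G T) (lin (vec T) * u).
Proof.
rewrite lin_vec mulr_suml raddf_sum /= exchange_big (bigID (mem T)) /= [X in _ + X]big1 ?addr0.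
  apply: eq_bigr => l lT; rewrite ev_dsum; apply: eq_bigr => S TS.
  by rewrite (setUidPr _) // sub1set (subsetP TS).
move=> l lT; rewrite big_mkcond; apply: (@pair_cancel l) => S.
have -> : (T \subset l |: S) = (T \subset S :\ l).
  by rewrite subsetD1 lT andbT -subDset (setDidPl _) // disjoint_sym disjoints1.
suff -> : l |: (l |: S) = l |: S :\ l by [].
by apply/setP => i; rewrite !inE; case: eqP.
Qed.

Lemma annih_sum d (I : Type) (r : seq I) (P : pred I) (G : I -> dual) :
  (forall i, P i -> annih d (G i)) -> annih d (fun m => \sum_(i <- r | P i) G i m).
Proof.
move=> h; split=> [m|p]; last by rewrite !ev_sum; apply: eq_bigr => i /h [_].
apply: contraNeq => dm; apply/eqP; apply: big1 => i /h [di _]; exact: in_deg0 di dm.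
Qed.

Section Extend.
(* The values of [G] at [set0] and [setT] are irrelevant: the former is not used and the
   latter gets replaced. *)
Variables (d : nat) (G : {set 'I_4} -> dual).
Hypotheses (d0 : (0 < d)%N) (KG : forall S, annih d (G S)).
Hypothesis rel : forall (S : {set 'I_4}) (u : P4), (#|S| <= 2)%N -> \sum_l ev (G (l |: S)) ('X_l * u) = 0.

Let G' S := if S == setT then dzero else G S.

Let e l (u : P4) := ev (G (~: [set l])) (lin (vec (~: [set l])) * u).

Let KG' S : annih d (G' S). Proof. by rewrite /G'; case: ifP => _; [exact: annih0 | exact: KG]. Qed.

Let KupG' T : annih d (upsum G' T). Proof. by apply: annih_sum. Qed.

Lemma setU1_neqT l (S : {set 'I_4}) : (#|S| <= 2)%N -> (l |: S == setT) = false.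
Proof.
move=> S2; apply/negP => /eqP h; have := cardsU1 l S; rewrite h cardsT card_ord.
by case: (l \in S) S2; case: #|S| => [|[|[|]]].
Qed.

Let relG' (S : {set 'I_4}) (u : P4) : \sum_l ev (G' (l |: S)) ('X_l * u) =
  \sum_l (S == ~: [set l])%:R * e l u.
Proof.
case: (leqP #|S| 2) => S2.
  rewrite -[RHS]addr0 [in RHS]big1 ?add0r => [|l _].
    by rewrite -[RHS](rel u S2); apply: eq_bigr => l _; rewrite /G' setU1_neqT.
  case: eqP => [h|_]; last by rewrite mul0r.
  by move: S2; rewrite h card_setC1.
case: (eqVneq S setT) => [->|ST].
  rewrite !big1 // => l _; first by rewrite eq_sym; case: eqP => [h|_]; rewrite ?mul0r //;
    have := card_setC1 l; rewrite h cardsT card_ord.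
  by rewrite setUT /G' eqxx ev0.
have [l ->] : exists l, S = ~: [set l].
  apply: cards3P; apply/eqP; rewrite eqn_leq S2 andbT.
  have : (#|S| < #|[set: 'I_4]|)%N by rewrite proper_card // properT.
  by rewrite cardsT card_ord ltnS.
rewrite [RHS](bigD1 l) //= eqxx mul1r [X in _ = _ + X]big1 ?addr0 => [|m ml]; last first.
  by rewrite (inj_eq (@setC_inj _)) (inj_eq (@set1_inj _)) eq_sym (negbTE ml) mul0r.
rewrite /e lin_vec mulr_suml raddf_sum /= (bigD1 l) //= setUCr /G' eqxx ev0 add0r.
apply: eq_big => [m|m ml]; first by rewrite !inE.
have -> : m |: ~: [set l] = ~: [set l] by apply/setUidPr; rewrite sub1set !inE.
case: eqP => // h; have := card_setC1 l; by rewrite h cardsT card_ord.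
Qed.

Let lin_upG' T (u : P4) : ev (upsum G' T) (lin (vec T) * u) = \sum_(l | T \subset ~: [set l]) e l u.
Proof.
rewrite -upsum_lin; under eq_bigr => S _ do rewrite relG'.
rewrite exchange_big [RHS]big_mkcond; apply: eq_bigr => l _ /=; rewrite -mulr_suml.
case: ifPn => Tl.
  rewrite (bigD1 (~: [set l])) //= eqxx big1 ?addr0 ?mul1r // => S /andP[_ /negbTE ->] //.
by rewrite big1 ?mul0r // => S TS; case: eqP => // h; move: TS; rewrite h (negbTE Tl).
Qed.

Let sum_e (u : P4) : \sum_l e l u = 0.
Proof.
have := lin_upG' set0 u; rewrite (eq_bigl predT) => [<-|l]; last by rewrite sub0set.
by rewrite lin_vec big_set0 mul0r raddf0.
Qed.

Let e1 l (u : P4) : ev (upsum G' [set l]) ('X_l * u) = e l u.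
Proof.
have := lin_upG' [set l] u; rewrite lin_vec big_set1 => ->.
apply: F2_addK; rewrite -[RHS](sum_e u) [RHS](bigD1 l) //= addrC; congr (_ + _).
by apply: eq_bigl => m; rewrite sub1set !inE eq_sym.
Qed.

Let e2 l m (u : P4) : l != m -> ev (upsum G' [set l; m]) (('X_l + 'X_m) * u) = e l u + e m u.
Proof.
move=> lm; have := lin_upG' [set l; m] u; rewrite lin_vec big_setU1 ?inE // big_set1 => ->.
apply: F2_addK; rewrite -[RHS](sum_e u) [RHS](bigD1 l) //=.
rewrite [X in _ = _ + X](bigD1 m) 1?eq_sym //= [LHS]addrC -[LHS]addrA.
congr (_ + (_ + _)); apply: eq_bigl => i.
by rewrite subUset !sub1set !inE ![_ == i]eq_sym.
Qed.

Let e_Sq l (u : P4) : e l u = e l (St u) + e l ('X_l * St u).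
Proof. by rewrite -!e1 -!(lin_delta l) (annih_cap_Sq _ _ (KupG' _)). Qed.

Let e_sym l m (u : P4) : e l ('X_m * u) = e m ('X_l * u).
Proof.
case: (eqVneq l m) => [->//|lm]; apply: F2_addK.
pose r : dual := fun w => cap 'X_m (cap 'X_l (upsum G' [set l])) w + cap 'X_l (cap 'X_m (upsum G' [set m])) w.
have rE w : ev r w = e l ('X_m * w) + e m ('X_l * w).
  by rewrite -[r]/(dadd _ _) evD !capE !e1.
rewrite -rE; suff -> : r = dzero by rewrite ev0.
apply: (@Sq_image_dense d.-2) => [w|w]; last first.
  have eD i p q : e i (p + q) = e i p + e i q by rewrite /e mulrDr raddfD.
  have L : lin (vec [set l; m]) = 'X_l + 'X_m by rewrite lin_vec big_setU1 ?inE // big_set1.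
  have := e2 w lm; rewrite -{1}L (annih_cap_Sq _ _ (KupG' _)) L !e2 // (e_Sq l w) (e_Sq m w).
  rewrite mulrDl !eD [in RHS]addrACA => /addrI.
  rewrite (addrC (e m _)) addrACA -[RHS]addr0 => /addrI.
  by rewrite rE.
apply: contraNeq => dw; apply/eqP; rewrite /r !capXE.
have h i j : upsum G' [set i] (U_(i) + (U_(j) + w))%MM = 0.
  have [di _] := KupG' [set i]; apply: (in_deg0 di); rewrite !mdegD !mdeg1.
  by apply: contraNneq dw => <-.
by rewrite !h addr0.
Qed.

Let q : dual := fun m => if [pick l | m l != 0%N] is Some l then e l 'X_[m - U_(l)] else 0.

Let q_XM l m : q (U_(l) + m)%MM = e l 'X_[m].
Proof.
rewrite /q; case: pickP => [l' nz|/(_ l)]; last by rewrite mnmDE mnm1E eqxx.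
case: (eqVneq l' l) nz => [-> _|ll nz]; first by rewrite addmC addmK.
have e' : m = (U_(l') + (m - U_(l')))%MM.
  by rewrite addmC submK // lep1mP; move: nz; rewrite mnmDE mnm1E [l == l']eq_sym (negbTE ll).
move: (m - _)%MM e' => m' ->; rewrite addmA (addmC U_(l)%MM) -addmA [X in (X - _)%MM]addmC addmK !mpolyXUD.
exact: e_sym.
Qed.

Let ev_q l (u : P4) : ev q ('X_l * u) = e l u.
Proof.
elim/P4_ind: u => [|x y a1 a2|m]; rewrite /e ?mulr0 ?raddf0 ?mulrDr ?raddfD /= ?a1 ?a2 //.
by rewrite -mpolyXUD evX q_XM.
Qed.

Let Kq : annih d q.
Proof.
split=> [|p].
  elim/mon_ind => [|l m _]; first by rewrite /q; case: pickP => [l|_]; rewrite ?mnmE eqxx.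
  rewrite q_XM -e1 -mpolyXUD evX; have [dl _] := KupG' [set l]; exact: dl.
elim/P4_ind: p => [|x y e1' e2'|m]; rewrite ?rmorph0 ?raddf0 ?rmorphD ?raddfD /= ?e1' ?e2' //.
elim/mon_ind: m => [|l m _]; first by rewrite mpolyX0 rmorph1.
by rewrite mpolyXUD Sq_XM raddfD /= !ev_q -e_Sq.
Qed.

Let G2 S := if S == setT then q else G S.

Let G2E S : S != setT -> G2 S = G S.
Proof. by rewrite /G2 => /negbTE ->. Qed.

Let relG2 (S : {set 'I_4}) (u : P4) : \sum_l ev (G2 (l |: S)) ('X_l * u) = 0.
Proof.
case: (leqP #|S| 2) => S2.
  by rewrite -[RHS](rel u S2); apply: eq_bigr => l _; rewrite G2E ?setU1_neqT.
case: (eqVneq S setT) => [->|ST].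
  by rewrite -[RHS](sum_e u); apply: eq_bigr => l _; rewrite setUT /G2 eqxx ev_q.
have [l ->] : exists l, S = ~: [set l].
  apply: cards3P; apply/eqP; rewrite eqn_leq S2 andbT.
  have : (#|S| < #|[set: 'I_4]|)%N by rewrite proper_card // properT.
  by rewrite cardsT card_ord ltnS.
rewrite (bigD1 l) //= setUCr {1}/G2 eqxx ev_q {1}/e lin_vec mulr_suml raddf_sum /=.
rewrite [X in _ + X](_ : _ = \sum_(i in ~: [set l]) ev (G (~: [set l])) ('X_i * u)) ?F2_addxx //.
apply: eq_big => [m|m ml]; first by rewrite !inE.
have -> : m |: ~: [set l] = ~: [set l] by apply/setUidPr; rewrite sub1set !inE.
rewrite G2E //; apply/eqP => h; have := card_setC1 l; by rewrite h cardsT card_ord.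
Qed.

Lemma extend : exists h : {set 'I_4} -> dual,
  (forall T, annih d (h T) /\ killed (vec T) (h T)) /\
  forall S m, S != setT -> G S m = \sum_(T : {set 'I_4} | S \subset T) h T m.
Proof.
exists (upsum G2); split=> [T|S m ST]; last first.
  by rewrite (moebius (fun S => G2 S m)) G2E.
split=> [|u]; last by rewrite -upsum_lin big1.
by apply: annih_sum => S _; rewrite /G2; case: ifP.
Qed.

End Extend.

Lemma kcomp_sum (I : Type) (r : seq I) (P : pred I) (F : I -> dual) i :
  kcomp i (fun m => \sum_(x <- r | P x) F x m) = fun m => \sum_(x <- r | P x) kcomp i (F x) m.
Proof.
apply: dual_ext => y; rewrite kcompE !ev_sum; apply: eq_bigr => x _; by rewrite kcompE.
Qed.

Lemma three_odd_sum (I : Type) (r : seq I) (P : pred I) (F : I -> dual) :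
  (forall x, P x -> three_odd (F x)) -> three_odd (fun m => \sum_(x <- r | P x) F x m).
Proof. by move=> h E y E3; rewrite ev_sum big1 // => x /h ->. Qed.

Section SupportFamily.
Variable f3 : 'I_4 -> 'I_4 -> 'I_4 -> dual.
Hypotheses (s12 : forall i j l, f3 i j l = f3 j i l) (s23 : forall i j l, f3 i j l = f3 i l j).
Hypothesis s2 : forall i j, f3 i i j = f3 i j j.

Lemma f3_support i j l a b c : [set i; j; l] = [set a; b; c] -> f3 i j l = f3 a b c.
Proof.
move=> e.
have ia : i \in [set a; b; c] by rewrite -e !inE eqxx.
have ja : j \in [set a; b; c] by rewrite -e !inE eqxx orbT.
have la : l \in [set a; b; c] by rewrite -e !inE eqxx orbT.
have ai : a \in [set i; j; l] by rewrite e !inE eqxx.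
have bi : b \in [set i; j; l] by rewrite e !inE eqxx orbT.
have ci : c \in [set i; j; l] by rewrite e !inE eqxx orbT.
clear e; move: ia ja la ai bi ci; rewrite !inE -!orbA.
have z1 x y : f3 x y x = f3 x x y by rewrite s23.
have z2 x y : f3 y x x = f3 x x y by rewrite s12 s23.
have z3 x y : f3 x x y = f3 y y x by rewrite s2 z2.
move=> /or3P[] /eqP-> /or3P[] /eqP-> /or3P[] /eqP-> /or3P[] /eqP E1 /or3P[] /eqP E2 /or3P[] /eqP E3;
 subst => //.
all: rewrite ?z1 ?z2; first [done | by rewrite z3 | by rewrite s12 | by rewrite s23
  | by rewrite s12 s23 | by rewrite s23 s12 | by rewrite s12 s23 s12].
Qed.

Lemma support_family : exists G : {set 'I_4} -> dual, (forall i j l, G [set i; j; l] = f3 i j l) /\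
  forall S, G S = dzero \/ exists i j l, G S = f3 i j l.
Proof.
exists (fun S => if [pick p : 'I_4 * 'I_4 * 'I_4 | [set p.1.1; p.1.2; p.2] == S] is Some p
  then f3 p.1.1 p.1.2 p.2 else dzero); split=> [i j l|S]; last first.
  by case: pickP => [[[a b] c] _|_]; [right; exists a, b, c | left].
case: pickP => [[[a b] c] /= /eqP|/(_ (i, j, l))]; [exact: f3_support | by rewrite eqxx].
Qed.

End SupportFamily.

Definition lift3 v h := lift v (lift v (lift v h)).

Lemma kcomp_scale i (c : k) f : kcomp i (fun m => c * f m) = fun m => c * kcomp i f m.
Proof. by apply: dual_ext => y; rewrite kcompE !ev_scale kcompE. Qed.

Lemma vecK : cancel vec (fun v : 'cV[k]_4 => [set i | v i 0 != 0]).
Proof. by move=> T; apply/setP => i; rewrite inE mxE; case: (i \in T). Qed.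

Lemma vecKV : cancel (fun v : 'cV[k]_4 => [set i | v i 0 != 0]) vec.
Proof.
by move=> v; apply/colP => i; rewrite mxE inE; case: (F2_cases (v i 0)) => ->.
Qed.

Lemma lift_0col h : lift 0 h = dzero.
Proof. by apply: functional_extensionality => m; rewrite /lift big1 // => i _; rewrite mxE !mul0r. Qed.

Lemma kcomp3_lift3 i j l T h :
  kcomp l (kcomp j (kcomp i (lift3 (vec T) h))) = fun m => ([set i; j; l] \subset T)%:R * h m.
Proof.
rewrite /lift3 kcomp_lift !(kcomp_scale, kcomp_lift); apply: functional_extensionality => m.
rewrite !mxE !mulrA -!natrM !mulnb; congr (_%:R * _).
by rewrite !subUset !sub1set.
Qed.

Lemma card_le2P (S : {set 'I_4}) : (#|S| <= 2)%N -> S = set0 \/ exists i j, S = [set i; j].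
Proof.
rewrite leq_eqVlt ltnS leq_eqVlt ltnS leqn0 => /or3P[/cards2P [i [j [_ ->]]]|/cards1P [i ->]|].
- by right; exists i, j.
- by right; exists i, i; rewrite setUid.
- by rewrite cards_eq0 => /eqP; left.
Qed.

(* The threefold component of [f] with indices i, j, l only depends on the set {i, j, l};
   [extend] supplies the missing value at {1, 2, 3, 4}, and inclusion-exclusion over
   supersets then produces the summands. *)
Lemma decomposition d f : odd d -> annih (2 * (2 * (2 * d + 3) + 3) + 3) f ->
  exists h : 'cV[k]_4 -> dual, (forall v, annih d (h v) /\ killed v (h v)) /\
  f = fun m => \sum_(v | v != 0) lift3 v (h v) m.
Proof.
move=> od Kf; set n1 := (2 * d + 3)%N in Kf *; set n2 := (2 * n1 + 3)%N in Kf *.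
have o1 : odd n1 by rewrite oddD mul2n odd_double.
have o2 : odd n2 by rewrite oddD mul2n odd_double.
have tf := annih_three_odd o2 Kf.
pose f1 i := kcomp i f; pose f2 i j := kcomp j (f1 i); pose f3 i j l := kcomp l (f2 i j).
have K1 i : annih n2 (f1 i) by exact: annih_kcomp.
have t1 i : three_odd (f1 i) := annih_three_odd o1 (K1 i).
have K2 i j : annih n1 (f2 i j) by exact: annih_kcomp.
have t2 i j : three_odd (f2 i j) := annih_three_odd od (K2 i j).
have K3 i j l : annih d (f3 i j l) by exact: annih_kcomp.
have r1 := kcomp_rel Kf tf.
have r1i i := kcomp_rel (K1 i) (t1 i).
have r2 i j := kcomp_rel (K2 i j) (t2 i j).
have c2 i j : f2 i j = f2 j i := fam_sym t1 r1 i j.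
have d2 := fam_diag r1.
have c3 i j : f3 i i j = f3 j j i := fam_sym (fun l => t2 l l) d2 i j.
have d3 := fam_diag d2.
have c3' i j l : f3 i j l = f3 i l j := fam_sym (t2 i) (r1i i) j l.
have d3' i := fam_diag (r1i i).
have s12 i j l : f3 i j l = f3 j i l by rewrite /f3 c2.
have s2 i j : f3 i i j = f3 i j j by rewrite c3 c3' s12.
have [G [GE Gf]] := support_family s12 c3' s2.
have KG S : annih d (G S) by case: (Gf S) => [->|[i [j [l ->]]]] //; exact: annih0.
have [|h [hK hG]] := @extend d G KG.
  move=> S u /card_le2P [->|[i [j ->]]].
    rewrite -[RHS](d3 u); apply: eq_bigr => l _; rewrite setU0.
    have <- : [set l; l; l] = [set l] by rewrite !setUid.
    by rewrite GE.
  by rewrite -[RHS](r2 i j u); apply: eq_bigr => l _; rewrite setUC GE.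
exists (fun v => h [set i | v i 0 != 0]); split=> [v|].
  by have := hK [set i | v i 0 != 0]; rewrite vecKV.
pose R : dual := fun m => \sum_T lift3 (vec T) (h T) m.
transitivity R; last first.
  apply: functional_extensionality => m; rewrite /R (reindex vec) /=; last first.
    by exists (fun v : 'cV[k]_4 => [set i | v i 0 != 0]) => ? _; [exact: vecK | exact: vecKV].
  rewrite [RHS]big_mkcond; apply: eq_bigr => T _; rewrite vecK.
  by case: eqP => //= ->; rewrite /lift3 lift_0col.
apply: three_odd_ext => // [|i]; first by apply: three_odd_sum => T _; exact: lift_three_odd.
have T1 T : three_odd (kcomp i (lift3 (vec T) (h T))).
  by rewrite /lift3 kcomp_lift; apply: three_odd_scale; exact: lift_three_odd.
rewrite kcomp_sum; apply: three_odd_ext => [||j]; [exact: t1 | exact: three_odd_sum |].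
have T2 T : three_odd (kcomp j (kcomp i (lift3 (vec T) (h T)))).
  by rewrite /lift3 kcomp_lift kcomp_scale kcomp_lift; do 2!apply: three_odd_scale; exact: lift_three_odd.
rewrite kcomp_sum; apply: three_odd_ext => [||l]; [exact: t2 | by apply: three_odd_sum => T _ |].
rewrite kcomp_sum -[LHS]/(f3 i j l) -GE; apply: functional_extensionality => m.
rewrite hG; last first.
  apply/eqP => e; have : (#|[set i; j; l]| <= 3)%N.
    by rewrite setUC (leq_trans (leq_card_setU _ _)) // cards1 add1n ltnS cards2; case: (i != j).
  by rewrite e cardsT card_ord.
rewrite big_mkcond; apply: eq_bigr => T _; rewrite kcomp3_lift3.
by case: ifP; rewrite ?mul1r ?mul0r.
Qed.

Lemma lift3_sum_inj d (h : 'cV[k]_4 -> dual) : (0 < d)%N -> (forall v, annih d (h v) /\ killed v (h v)) ->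
  (fun m => \sum_(v | v != 0) lift3 v (h v) m) = dzero -> forall v, v != 0 -> h v = dzero.
Proof.
move=> d0 hK e.
pose g T := h (vec T).
have sum0 i j l m : \sum_(T : {set 'I_4} | [set i; j; l] \subset T) g T m = 0.
  have /(congr1 (fun f => kcomp l (kcomp j (kcomp i f)) m)) := e; rewrite !kcomp_sum.
  have -> : kcomp l (kcomp j (kcomp i dzero)) m = 0 by rewrite -evX !kcompE ev0.
  rewrite (reindex vec) /=; last first.
    by exists (fun v : 'cV[k]_4 => [set i | v i 0 != 0]) => ? _; [exact: vecK | exact: vecKV].
  move=> H; rewrite -[RHS]H big_mkcond [RHS]big_mkcond; apply: eq_bigr => T _ /=.
  rewrite kcomp3_lift3; case: ifP => sT; case: eqP => //= v0; rewrite ?mul1r ?mul0r //.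
  move: sT; rewrite -(vecK T) v0 !subUset !sub1set !inE mxE eqxx //.
have top T m : T != set0 -> g T m = g setT m.
  move=> T0; rewrite -(moebius (fun T => g T m) T) (bigD1 setT) ?subsetT //=.
  rewrite (big_pred1 setT) => [|U]; last by rewrite /= subTset.
  rewrite big1 ?addr0 // => S /andP[TS ST].
  have [i [j [l ->]]] : exists i j l, S = [set i; j; l]; last exact: sum0.
  have /set0Pn [i iS] : S != set0 by apply: contraNneq T0 => S0; rewrite S0 subset0 in TS.
  have := cardsD1 i S; rewrite iS => cS.
  have /card_le2P : (#|S :\ i| <= 2)%N.
    have : (#|S| < #|[set: 'I_4]|)%N by rewrite proper_card // properT.
    by rewrite cardsT card_ord cS add1n !ltnS.
  move=> H; rewrite -(setD1K iS); case: H => [->|[j [l ->]]]; first by exists i, i, i; rewrite setU0 !setUid.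
  by exists i, j, l; rewrite setUA.
have z : g setT = dzero.
  apply: functional_extensionality => m; have [Kg _] := hK (vec setT).
  have [dg _] := Kg; case: (eqVneq (mdeg m) d) => [dm|]; last exact: in_deg0 dg.
  elim/mon_ind: m dm => [|i m _ _]; first by rewrite mdeg0 => d0'; rewrite -d0' in d0.
  have i0 : [set i] != set0 by apply/set0Pn; exists i; rewrite inE.
  rewrite -(top _ _ i0) -evX mpolyXUD; have [_ /(_ 'X_[m])] := hK (vec [set i]).
  by rewrite lin_vec big_set1.
move=> v v0; rewrite -[v]vecKV -/(g _); apply: functional_extensionality => m.
rewrite top ?z //; apply: contraNneq v0 => e0.
by rewrite -[v]vecKV e0; apply/eqP/colP => i; rewrite !mxE inE.
Qed.

(** * Computing with exponents *)

Definition q4 : Type := (nat * nat * nat * nat)%type.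
Definition tm (t : q4) : mon := let: (a, b, c, d) := t in mon4 a b c d.
Definition i0 : 'I_4 := @Ordinal 4 0 isT.
Definition i1 : 'I_4 := @Ordinal 4 1 isT.
Definition i2 : 'I_4 := @Ordinal 4 2 isT.
Definition i3 : 'I_4 := @Ordinal 4 3 isT.
Definition qm (m : mon) : q4 := (m i0, m i1, m i2, m i3).
Definition qdeg (t : q4) : nat := let: (a, b, c, d) := t in (a + b + c + d)%N.

Lemma ord4_ind (Q : 'I_4 -> Prop) : Q i0 -> Q i1 -> Q i2 -> Q i3 -> forall i, Q i.
Proof.
move=> h0 h1 h2 h3 [[|[|[|[|i]]]] hi] //.
- by have -> : Ordinal hi = i0 by exact: val_inj.
- by have -> : Ordinal hi = i1 by exact: val_inj.
- by have -> : Ordinal hi = i2 by exact: val_inj.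
- by have -> : Ordinal hi = i3 by exact: val_inj.
Qed.

Lemma big_ord4 (R : Type) (idx : R) (op : Monoid.law idx) (F : 'I_4 -> R) :
  \big[op/idx]_i F i = op (F i0) (op (F i1) (op (F i2) (F i3))).
Proof.
rewrite !big_ord_recl big_ord0 Monoid.mulm1.
by congr (op (F _) (op (F _) (op (F _) (F _)))); exact: val_inj.
Qed.

Lemma mon4E a b c d : (mon4 a b c d i0 = a) * (mon4 a b c d i1 = b) *
  (mon4 a b c d i2 = c) * (mon4 a b c d i3 = d).
Proof. by []. Qed.

Lemma tmK : cancel tm qm.
Proof. by case=> [[[a b] c] d]. Qed.

Lemma qmK : cancel qm tm.
Proof. by move=> m; apply/mnmP; apply: ord4_ind. Qed.

Lemma mdeg_tm t : mdeg (tm t) = qdeg t.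
Proof. by case: t => [[[a b] c] d]; rewrite mdegE big_ord4 /tm !mon4E /= !addnA. Qed.

Definition lP (l : seq q4) : P4 := \sum_(t <- l) 'X_[tm t].

Lemma ev_lP f l : ev f (lP l) = \sum_(t <- l) f (tm t).
Proof. by rewrite /lP raddf_sum; apply: eq_bigr => t _; exact: evX. Qed.

Fixpoint pascal (n : nat) : seq bool :=
  if n is n'.+1 then let s := pascal n' in [seq x.1 (+) x.2 | x <- zip (false :: s) (rcons s false)]
  else [:: true].

Lemma size_pascal n : size (pascal n) = n.+1.
Proof. by elim: n => //= n IH; rewrite size_map size_zip /= size_rcons IH minnn. Qed.

Lemma nth_pascal n j : nth false (pascal n) j = odd 'C(n, j).
Proof.
elim: n j => [[|[|j]]|n IH j] //=; case: (ltnP j n.+2) => hj; last first.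
  by rewrite nth_default ?bin_small // size_map size_zip /= size_rcons size_pascal minnn.
rewrite (nth_map (false, false)) ?size_zip /= ?size_rcons ?size_pascal ?minnn // nth_zip /=; last first.
  by rewrite size_rcons.
rewrite nth_rcons size_pascal; have -> : (if (j < n.+1)%N then nth false (pascal n) j
   else if j == n.+1 then false else false) = odd 'C(n, j).
  by case: ltnP => [_|h]; rewrite ?IH // if_same bin_small.
by case: j {hj} => [|j] /=; rewrite ?bin0 // IH binS oddD addbC.
Qed.

Definition S1 (n : nat) : seq nat := let s := pascal n in
  [seq (n + j)%N | j <- index_iota 0 n.+1 & nth false s j].

Definition Stl (t : q4) : seq q4 := let: (a, b, c, d) := t in
  [seq (x, l) | x <- [seq (x, j) | x <- [seq (i, j) | i <- S1 a, j <- S1 b], j <- S1 c], l <- S1 d].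

Lemma S1E i n : ('X_i + 'X_i ^+ 2 : P4) ^+ n = \sum_(j <- S1 n) 'X_i ^+ j.
Proof.
rewrite /S1 big_map big_filter exprDn [RHS]big_mkcond.
rewrite big_mkord; apply: eq_bigr => j _; rewrite nth_pascal.
rewrite -exprM -exprD -mulr_natl.
have -> : (n - j + 2 * j = n + j)%N by rewrite mul2n -addnn addnA subnK // -ltnS.
have -> : (('C(n, j))%:R : P4) = (odd 'C(n, j))%:R.
  rewrite -{1}[X in X%:R]odd_double_half natrD -mul2n natrM.
  have -> : (2%:R : P4) = 0 by rewrite mulr2n P4_addxx.
  by rewrite mul0r addr0.
by case: odd; rewrite ?mul1r ?mul0r.
Qed.

Lemma StE t : St 'X_[tm t] = lP (Stl t).
Proof.
case: t => [[[a b] c] d]; rewrite mpolyXE_id rmorph_prod /=.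
under eq_bigr => i _ do rewrite rmorphXn /= StX S1E.
rewrite big_ord4 /tm !mon4E /lP /Stl /=.
rewrite !big_allpairs mulr_suml; apply: eq_bigr => i _.
rewrite mulrA mulr_sumr mulr_suml; apply: eq_bigr => j _.
rewrite mulr_suml mulr_sumr; apply: eq_bigr => l _.
rewrite !mulr_sumr; apply: eq_bigr => m _.
by rewrite [RHS]mpolyXE_id [RHS]big_ord4 /tm !mon4E /= !mulrA.
Qed.

Definition bdual (b : q4 -> bool) : dual := fun m => (b (qm m))%:R.

Lemma bdualE b t : bdual b (tm t) = (b t)%:R.
Proof. by rewrite /bdual tmK. Qed.

Lemma F2_natr n : n%:R = (odd n)%:R :> k.
Proof.
rewrite -[in LHS](odd_double_half n) natrD -mul2n natrM.
have -> : (2%:R : k) = 0 by rewrite mulr2n F2_addxx.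
by rewrite mul0r addr0.
Qed.

Lemma F2_sum_count (I : Type) (b : I -> bool) (l : seq I) : \sum_(x <- l) (b x)%:R = (odd (count b l))%:R :> k.
Proof. by rewrite -F2_natr -sum1_count natr_sum [RHS]big_mkcond; apply: eq_bigr => x _; case: (b x). Qed.

Lemma ev_bdual b l : ev (bdual b) (lP l) = (odd (count b l))%:R.
Proof.
by rewrite ev_lP -F2_sum_count; apply: eq_bigr => t _; rewrite bdualE.
Qed.

Definition mons (d : nat) : seq q4 :=
  [seq t <- [seq (x, (d - x.1.1 - x.1.2 - x.2)%N) | x <-
    [seq (x, l) | x <- [seq (i, j) | i <- iota 0 d.+1, j <- iota 0 d.+1], l <- iota 0 d.+1]]
  | qdeg t == d].

Lemma mem_mons d t : qdeg t = d -> t \in mons d.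
Proof.
move=> h; rewrite mem_filter h eqxx andTb; move: h; case: t => [[[a b] c] e]; rewrite /qdeg => h.
apply/mapP; exists (a, b, c); last by rewrite /= -h -!addnA !addKn.
apply: allpairs_f; first apply: allpairs_f.
all: rewrite mem_iota /= add0n ltnS -h.
- by rewrite -!addnA leq_addr.
- by rewrite (addnC a) -!addnA leq_addr.
- by rewrite addnAC leq_addl.
Qed.

Definition in_degb n (b : q4 -> bool) := forall t, b t -> qdeg t = n.

Definition annih_check n (b : q4 -> bool) :=
  all (fun d => all (fun t => ~~ odd (count b [seq u <- Stl t | qdeg u == n])) (mons d)) (iota 0 n).

Lemma annih_bdual n b : in_degb n b -> annih_check n b -> annih n (bdual b).
Proof.
move=> db /allP hc.
have dd : in_deg n (bdual b).
  move=> m; rewrite /bdual -{2}[m]qmK mdeg_tm => nz; apply: db.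
  by case: (b _) nz; rewrite ?eqxx.
split=> //; elim/P4_ind => [|p q e1 e2|m]; rewrite ?rmorph0 ?raddf0 ?rmorphD ?raddfD /= ?e1 ?e2 //.
case: (leqP n (mdeg m)) => [h|lt]; first by rewrite evX (Sq_bottom dd).
rewrite evX (in_deg0 dd) ?ltn_eqF // -[m]qmK StE ev_bdual.
have := hc (mdeg m); rewrite mem_iota => /(_ lt) /allP /(_ (qm m)).
rewrite mem_mons; last by rewrite -mdeg_tm qmK.
move=> /(_ isT) /negbTE; rewrite count_filter => e.
rewrite -(@eq_count _ (predI b (fun u => qdeg u == n))) ?e // => u /=.
by case: (b u) (db u) => // ->; rewrite ?eqxx.
Qed.

(** * Propagation of zeros along relations *)

Section Peel.
Variable I : eqType.

(* A relation with a single unknown term forces that term to vanish; [new] holds the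
   unknowns found in the previous round, which are removed from the relations. *)
Fixpoint peel (n : nat) (known new : seq I) (rels : seq (seq I)) : seq I :=
  if n is n'.+1 then
    let rels' := [seq [seq x <- r | x \notin new] | r <- rels] in
    let new' := undup (pmap (fun r => if r is [:: x] then Some x else None) rels') in
    peel n' (new' ++ known) new' [seq r <- rels' | 1 < size r]%N
  else known.

Lemma peelP (val : I -> k) n known new rels :
  {in known, forall x, val x = 0} -> {in new, forall x, val x = 0} ->
  (forall r, r \in rels -> \sum_(x <- r) val x = 0) ->
  {in peel n known new rels, forall x, val x = 0}.
Proof.
elim: n known new rels => [|n IH] known new rels hk hn hr //=.
set rels' := [seq [seq x <- r | x \notin new] | r <- rels].
have hr' r : r \in rels' -> \sum_(x <- r) val x = 0.
  move=> /mapP [r0 /hr h ->]; rewrite -[RHS]h big_filter.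
  rewrite [RHS](bigID (fun x => x \in new)) /= [X in _ = X + _]big1 ?add0r // => x; exact: hn.
set new' := undup _.
have hn' : {in new', forall x, val x = 0}.
  move=> x; rewrite mem_undup mem_pmap => /mapP [r rr]; case: r rr => [|y [|y' r]] // rr [->].
  by have := hr' _ rr; rewrite big_seq1.
apply: IH => // [x|r]; last by rewrite mem_filter => /andP[_ /hr'].
by rewrite mem_cat => /orP[/hn'|/hk].
Qed.

End Peel.

(** * Degree 7 *)

Definition e1 : 'cV[k]_4 := delta_mx i0 0.
Definition er (i : 'I_4) : 'rV[k]_4 := delta_mx 0 i.

Lemma er_col i (v : 'cV[k]_4) : er i *m v = (v i 0)%:M.
Proof. by rewrite -rowE; apply/matrixP => a b; rewrite !ord1 !mxE eqxx. Qed.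

Lemma row_delta (r : 'rV[k]_4) i : r *m delta_mx i 0 = (r 0 i)%:M.
Proof. by rewrite -colE; apply/matrixP => a b; rewrite !ord1 !mxE eqxx. Qed.

Lemma e1_neq0 : e1 != 0.
Proof. by apply/cV0Pn; exists i0; rewrite mxE !eqxx. Qed.

Lemma unit_mx2 n (g h : 'M[k]_n) : g *m h = 1%:M -> g \in unitmx.
Proof. by case/mulmx1_unit. Qed.

(* [1 + u r] with [r u = 0] is its own inverse. *)
Lemma unit_transv (u : 'cV[k]_4) (r : 'rV[k]_4) : r *m u = 0 -> 1%:M + u *m r \in unitmx.
Proof.
move=> h; apply: (@unit_mx2 _ _ (1%:M + u *m r)).
rewrite mulmxDl mul1mx mulmxDr mulmx1 -mulmxA (mulmxA r) h mul0mx mulmx0 addr0 -addrA.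
suff -> : u *m r + u *m r = 0 by rewrite addr0.
by apply/matrixP => a b; rewrite !mxE F2_addxx.
Qed.

Lemma mx_addxx m n (A : 'M[k]_(m, n)) : A + A = 0.
Proof. by apply/matrixP => a b; rewrite !mxE F2_addxx. Qed.

Lemma col_trans (v : 'cV[k]_4) : v != 0 -> exists2 g, g \in unitmx & g *m v = e1.
Proof.
move=> /cV0Pn [i vi]; pose w := tperm_mx i i0 *m v.
have w1 : w i0 0 = 1.
  by rewrite /w -xrowE mxE tpermR; exact: F2_neq0.
exists ((1%:M + (w + e1) *m er i0) *m tperm_mx i i0).
  rewrite unitmx_mul unitmx_perm andbT; apply: unit_transv.
  rewrite er_col; have -> : (w + e1) i0 0 = 0 by rewrite [LHS]mxE w1 /e1 mxE eqxx F2_addxx.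
  exact: raddf0.
rewrite -(mulmxA _ _ v) -/w.
rewrite mulmxDl mul1mx -mulmxA er_col w1 mulmx1 addrA mx_addxx add0r //.
Qed.

Lemma row_trans (r : 'rV[k]_4) : r != 0 -> r *m e1 = 0 ->
  exists2 g, g \in unitmx & g *m e1 = e1 /\ er i3 *m g = r.
Proof.
move=> /rV0Pn [j rj] re.
have r0 : r 0 i0 = 0 by move/matrixP: re => /(_ 0 0); rewrite -colE !mxE.
have j0 : j != i0 by apply: contraNneq rj => ->; rewrite r0.
pose w := r *m tperm_mx i3 j.
have wE a : w 0 a = r 0 (tperm i3 j a) by rewrite /w -xcolE mxE.
have three_odd : tperm_mx i3 j *m tperm_mx i3 j = 1%:M :> 'M[k]_4.
  by rewrite -perm_mxM tperm2 perm_mx1.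
pose u : 'cV[k]_4 := delta_mx i3 0.
have te : tperm_mx i3 j *m e1 = e1.
  by rewrite -xrowE; apply/colP => a; rewrite !mxE; case: tpermP => // ->; rewrite ?(negbTE j0).
have ru : (w + er i3) *m u = 0.
  rewrite row_delta; have -> : (w + er i3) 0 i3 = 0.
    by rewrite [LHS]mxE wE tpermL (F2_neq0 rj) mxE !eqxx F2_addxx.
  exact: raddf0.
exists ((1%:M + u *m (w + er i3)) *m tperm_mx i3 j).
  by rewrite unitmx_mul unitmx_perm andbT; exact: unit_transv.
split.
  rewrite -mulmxA te mulmxDl mul1mx -mulmxA row_delta.
  have -> : (w + er i3) 0 i0 = 0.
    by rewrite [LHS]mxE wE tpermD // r0 add0r mxE.
  by rewrite raddf0 mulmx0 addr0.
rewrite mulmxA mulmxDr mulmx1 mulmxA er_col mxE !eqxx mul1mx addrCA mx_addxx addr0.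
by rewrite /w -mulmxA three_odd mulmx1.
Qed.

Lemma pair_trans (v : 'cV[k]_4) (r : 'rV[k]_4) : v != 0 -> r != 0 -> r *m v = 0 ->
  exists2 g, g \in unitmx & g *m v = e1 /\ er i3 *m g = r.
Proof.
move=> v0 r0 rv; have [g ug ge] := col_trans v0.
have [||h uh [he hr]] := @row_trans (r *m invmx g).
- by apply: contraNneq r0 => h; rewrite -[r]mulmx1 -(mulVmx ug) mulmxA h mul0mx.
- by rewrite -ge mulmxA mulmxKV.
exists (h *m g); first by rewrite unitmx_mul uh.
by rewrite -mulmxA ge he mulmxA hr mulmxKV.
Qed.

(* The functional dual to evaluation at the point [r]: in degree 7 it is the divided
   power of the linear form sum r_i a_i. *)
Definition point (r : 'rV[k]_4) : dual := fun m => (mdeg m == 7)%:R * ('X_[m] : P4).@[fun i => r 0 i].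

Lemma point_deg r : in_deg 7 (point r).
Proof. by move=> m; rewrite /point; case: (mdeg m =P 7%N) => // _; rewrite mul0r eqxx. Qed.

Lemma ev_point r p : p \is 7.-homog -> ev (point r) p = p.@[fun i => r 0 i].
Proof.
move=> /dhomogP hp; rewrite (mpolyE p) raddf_sum raddf_sum /= !big_seq.
by apply: eq_bigr => m /hp dm; rewrite evZ mevalZ evX /point dm eqxx mul1r.
Qed.

Lemma meval_lin (r : 'rV[k]_4) v : (lin v).@[fun i => r 0 i] = (r *m v) 0 0.
Proof.
rewrite lin.unlock raddf_sum mxE /=; apply: eq_bigr => i _.
by rewrite mevalZ mevalXU mulrC.
Qed.

Lemma meval_sub (r : 'rV[k]_4) g (p : P4) :
  (sub g p).@[fun i => r 0 i] = p.@[fun i => (r *m g) 0 i].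
Proof.
elim/P4_ind: p => [|p q a1 a2|]; rewrite ?raddf0 ?raddfD /= ?a1 ?a2 //.
elim/mon_ind => [|i m IH]; first by rewrite mpolyX0 rmorph1 !meval1.
rewrite mpolyXUD rmorphM /= !mevalM IH subX meval_lin mevalXU; congr (_ * _).
by rewrite !mxE; apply: eq_bigr => a _; rewrite mxE.
Qed.

Lemma act_point r g : act (point r) g = point (r *m g).
Proof.
apply: functional_extensionality => m; rewrite -evX actE.
case: (eqVneq (mdeg m) 7%N) => [dm|dm].
  by rewrite ev_point -?dm; [rewrite meval_sub /point dm eqxx mul1r | exact: sub_homog].
by rewrite (ev_homog (@point_deg r) (sub_homog _ _)) // /point (negbTE dm) mul0r.
Qed.

Lemma killed_point r v : r *m v = 0 -> killed v (point r).
Proof.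
move=> rv u; elim/P4_ind: u => [|p q a1 a2|m]; rewrite ?mulr0 ?raddf0 ?mulrDr ?raddfD /= ?a1 ?a2 ?addr0 //.
have h : lin v * 'X_[m] \is (1 + mdeg m).-homog.
  by apply: dhomogM; [exact: lin_homog | rewrite dhomogX /=].
case: (eqVneq (1 + mdeg m)%N 7%N) => [dm|dm]; last exact: ev_homog (@point_deg r) h dm.
by rewrite ev_point -?dm // mevalM meval_lin rv mxE mul0r.
Qed.

Definition qsupp (t : q4) (r : bool * bool * bool * bool) : bool :=
  let: (a, b, c, d) := t in let: (x, y, z, w) := r in
  [&& (a == 0%N) || x, (b == 0%N) || y, (c == 0%N) || z & (d == 0%N) || w].

Definition bv : Type := (bool * bool * bool * bool)%type.
Definition bnth (r : bv) (i : 'I_4) : bool :=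
  let: (x, y, z, w) := r in nth false [:: x; y; z; w] i.
Definition toC (v : bv) : 'cV[k]_4 := \col_i (bnth v i)%:R.
Definition toR (r : bv) : 'rV[k]_4 := \row_i (bnth r i)%:R.

Lemma point_tm r t : point (toR r) (tm t) = ((qdeg t == 7) && qsupp t r)%:R.
Proof.
rewrite /point mdeg_tm; case: eqP => _; last by rewrite mul0r.
rewrite mul1r mevalX big_ord4 !mxE; case: t => [[[a b] c] d]; rewrite /tm !mon4E.
have nb (x : bool) n : (x%:R : k) ^+ n = ((n == 0%N) || x)%:R.
  by case: x; rewrite ?expr1n ?orbT // orbF expr0n.
case: r => [[[x y] z] w]; rewrite /qsupp /= !nb -!natrM !mulnb //.
Qed.

Lemma F2_nz (a : k) : a = (a != 0)%:R.
Proof. by case: (F2_cases a) => ->; rewrite ?eqxx ?oner_eq0. Qed.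

Lemma toC_surj v : exists b, v = toC b.
Proof.
exists (v i0 0 != 0, v i1 0 != 0, v i2 0 != 0, v i3 0 != 0); apply/colP.
by move=> i; elim/ord4_ind: i; rewrite mxE /=; exact: F2_nz.
Qed.

Lemma toR_surj r : exists b, r = toR b.
Proof.
exists (r 0 i0 != 0, r 0 i1 != 0, r 0 i2 != 0, r 0 i3 != 0); apply/rowP.
by move=> i; elim/ord4_ind: i; rewrite mxE /=; exact: F2_nz.
Qed.

Definition bdot (r v : bv) : bool :=
  let: (a, b, c, d) := r in let: (x, y, z, w) := v in
  (a && x) (+) (b && y) (+) (c && z) (+) (d && w).

Lemma F2_addb (x y : bool) : x%:R + y%:R = (x (+) y)%:R :> k.
Proof. by case: x; case: y; rewrite ?addr0 ?add0r ?F2_addxx. Qed.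

Lemma toR_toC r v : toR r *m toC v = (bdot r v)%:R%:M.
Proof.
apply/matrixP => a b; rewrite !ord1 !mxE eqxx mulr1n big_ord4 !mxE.
case: r => [[[x y] z] w]; case: v => [[[x' y'] z'] w'] /=.
by rewrite -!natrM !mulnb !F2_addb !addbA.
Qed.

Lemma bdotP r v : bdot r v = false -> toR r *m toC v = 0.
Proof. by rewrite toR_toC => ->; exact: raddf0. Qed.

Definition b0 : bv := (false, false, false, false).

Lemma toR_neq0 r : r != b0 -> toR r != 0.
Proof.
apply: contraNneq => /rowP e; have b i : bnth r i = false.
  by have := e i; rewrite !mxE; case: (bnth r i) => // /eqP; rewrite oner_eq0.
have := (b i0, b i1, b i2, b i3); case: r {e b} => [[[x y] z] w] /= [[[]]].
by move=> -> -> -> ->.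
Qed.

Lemma toC_neq0 r : r != b0 -> toC r != 0.
Proof.
apply: contraNneq => /colP e; have b i : bnth r i = false.
  by have := e i; rewrite !mxE; case: (bnth r i) => // /eqP; rewrite oner_eq0.
have := (b i0, b i1, b i2, b i3); case: r {e b} => [[[x y] z] w] /= [[[]]].
by move=> -> -> -> ->.
Qed.

Lemma er_neq0 i : er i != 0.
Proof. by apply/rV0Pn; exists i; rewrite mxE !eqxx. Qed.

Lemma point_er3 : point (er i3) = amon 0 0 0 7.
Proof.
apply: functional_extensionality => m; rewrite -[m]qmK.
have -> : er i3 = toR (false, false, false, true).
  by apply/rowP => i; elim/ord4_ind: i; rewrite !mxE.
rewrite point_tm /amon -[mon4 0 0 0 7]/(tm (0, 0, 0, 7)%N) (can_eq tmK).
case: (qm m) => [[[a b] c] d] /=; rewrite !orbF orbT andbT.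
rewrite -!pair_eqE /= -!pair_eqE /= -!pair_eqE /=; congr (_%:R); congr nat_of_bool.
case: a => [|a]; case: b => [|b]; case: c => [|c] //=; rewrite ?andbF ?andbT //.
Qed.

Lemma amon_bdual a b c d : amon a b c d = bdual (fun t => t == (a, b, c, d)).
Proof.
apply: functional_extensionality => m; rewrite -[m]qmK bdualE /amon.
by rewrite -[mon4 a b c d]/(tm (a, b, c, d)) (can_eq tmK).
Qed.

Lemma annih_point r : r != 0 -> annih 7 (point r).
Proof.
move=> r0.
have K4 : annih 7 (point (er i3)).
  rewrite point_er3 amon_bdual; apply: annih_bdual => [t /eqP -> //|].
  by vm_compute.
have [v v0 rv] : exists2 v : 'cV[k]_4, v != 0 & r *m v = 0.
  have [[[[x y] z] w] ->] := toR_surj r.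
  exists (toC (if x then (if y then (true, true, false, false) else (false, true, false, false))
               else (true, false, false, false))).
    by apply: toC_neq0; case: x; case: y.
  by apply: bdotP; case: x; case: y; case: z; case: w.
have [g ug [_ <-]] := pair_trans v0 r0 rv.
by rewrite -act_point; exact: annih_act.
Qed.

Definition wedge (p q : 'rV[k]_4) : dual := fun m => (mdeg m == 2)%:R *
  ((\sum_i p 0 i * (m i)%:R) * (\sum_i q 0 i * (m i)%:R) + \sum_i p 0 i * q 0 i * (m i)%:R).

Lemma wedge_deg p q : in_deg 2 (wedge p q).
Proof. by move=> m; rewrite /wedge; case: (mdeg m =P 2%N) => // _; rewrite mul0r eqxx. Qed.

Lemma sum_U2 (c : 'I_4 -> k) a b : \sum_i c i * ((U_(a) + U_(b))%MM i)%:R = c a + c b.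
Proof.
have s1 e : \sum_i c i * (U_(e)%MM i)%:R = c e.
  rewrite (bigD1 e) //= mnm1E eqxx mulr1 big1 ?addr0 // => i ie.
  by rewrite mnm1E eq_sym (negbTE ie) mulr0.
rewrite -(s1 a) -(s1 b) -big_split; apply: eq_bigr => i _.
by rewrite mnmDE natrD mulrDr.
Qed.

Lemma wedgeU2 p q a b : wedge p q (U_(a) + U_(b))%MM = p 0 a * q 0 b + p 0 b * q 0 a.
Proof.
rewrite /wedge mdegD !mdeg1 eqxx mul1r !sum_U2 mulrDl !mulrDr.
rewrite [X in X + _]addrACA -addrA [X in _ + X]addrC addrA.
by rewrite addrC !addrA addrAC; case: (F2_cases (p 0 a)) => ->; case: (F2_cases (p 0 b)) => ->;
  case: (F2_cases (q 0 a)) => ->; case: (F2_cases (q 0 b)) => ->; apply/val_inj.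
Qed.

Lemma wedge_lin p q u w : ev (wedge p q) (lin u * lin w) =
  (p *m u) 0 0 * (q *m w) 0 0 + (p *m w) 0 0 * (q *m u) 0 0.
Proof.
transitivity (\sum_a \sum_b u a 0 * (w b 0 * (p 0 a * q 0 b + p 0 b * q 0 a))).
  rewrite !lin.unlock mulr_suml raddf_sum; apply: eq_bigr => a _.
  rewrite mulr_sumr raddf_sum; apply: eq_bigr => b _ /=.
  by rewrite -scalerAl -scalerAr !evZ -mpolyXUD evX wedgeU2.
rewrite !mxE !big_distrlr /= [X in _ + X]exchange_big -big_split; apply: eq_bigr => a _.
rewrite -big_split; apply: eq_bigr => b _ /=.
by ring.
Qed.

Lemma deg2P (m : mon) : mdeg m = 2%N -> exists a b, m = (U_(a) + U_(b))%MM.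
Proof.
elim/mon_ind: m => [|a m _]; first by rewrite mdeg0.
rewrite mdegD mdeg1 => -[]; elim/mon_ind: m => [|b m _]; first by rewrite mdeg0.
rewrite mdegD mdeg1 => -[] /eqP; rewrite mdeg_eq0 => /eqP ->.
by exists a, b; rewrite addm0.
Qed.

Lemma act_wedge p q g : act (wedge p q) g = wedge (p *m g) (q *m g).
Proof.
apply: functional_extensionality => m.
case: (eqVneq (mdeg m) 2%N) => [/deg2P [a [b ->]]|dm]; last first.
  by rewrite (in_deg0 (in_deg_act (@wedge_deg p q)) dm) (in_deg0 (@wedge_deg _ _) dm).
rewrite -evX actE mpolyXUD rmorphM /= !subX wedge_lin wedgeU2 !colE !mulmxA -!colE.
by rewrite !mxE.
Qed.

Lemma killed_wedge p q v : p *m v = 0 -> q *m v = 0 -> killed v (wedge p q).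
Proof.
move=> pv qv u; elim/P4_ind: u => [|f g a1 a2|m]; rewrite ?mulr0 ?raddf0 ?mulrDr ?raddfD /= ?a1 ?a2 ?addr0 //.
have h : lin v * 'X_[m] \is (1 + mdeg m).-homog.
  by apply: dhomogM; [exact: lin_homog | rewrite dhomogX /=].
case: (eqVneq (1 + mdeg m)%N 2%N) => [dm|dm]; last exact: ev_homog (@wedge_deg p q) h dm.
have /mdeg1P [b /eqP ->] : mdeg m == 1%N by rewrite -(eqn_add2l 1) dm.
by rewrite -(lin_delta b) wedge_lin pv qv !mxE mul0r mulr0 addr0.
Qed.

Lemma annih_wedge p q : annih 2 (wedge p q).
Proof.
have dd := @wedge_deg p q; split=> //.
elim/P4_ind => [|f g a1 a2|m]; rewrite ?rmorph0 ?raddf0 ?rmorphD ?raddfD /= ?a1 ?a2 //.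
case: (leqP 2 (mdeg m)) => [h|]; first by rewrite evX (Sq_bottom dd).
rewrite ltnS leq_eqVlt ltnS leqn0 => /orP[/mdeg1P [b /eqP ->]|].
  rewrite StX raddfD /= -(lin_delta b) expr2 wedge_lin F2_addxx addr0 //.
by rewrite mdeg_eq0 => /eqP ->; rewrite mpolyX0 rmorph1.
Qed.

Lemma wedgeDr p q r : wedge p (q + r) = dadd (wedge p q) (wedge p r).
Proof.
apply: functional_extensionality => m; rewrite /wedge /dadd -mulrDr; congr (_ * _).
rewrite addrACA -mulrDr -!big_split; congr (_ * _ + _); apply: eq_bigr => i _ /=.
  by rewrite mxE mulrDl.
by rewrite mxE mulrDr mulrDl.
Qed.

Definition fold4 (t : q4) (r : bv) : bool :=
  let: (a, b, c, d) := t in let: (x, y, z, w) := r in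
  (x && odd a) (+) (y && odd b) (+) (z && odd c) (+) (w && odd d).

Definition band4 (p q : bv) : bv :=
  let: (x, y, z, w) := p in let: (x', y', z', w') := q in (x && x', y && y', z && z', w && w').

Definition wedgeb (p q : bv) (t : q4) : bool :=
  (qdeg t == 2) && ((fold4 t p && fold4 t q) (+) fold4 t (band4 p q)).

Lemma wedge_tm p q t : wedge (toR p) (toR q) (tm t) = (wedgeb p q t)%:R.
Proof.
rewrite /wedge mdeg_tm /wedgeb; case: (qdeg t == 2%N); last by rewrite mul0r.
rewrite mul1r /=.
case: t => [[[a b] c] d]; case: p => [[[x y] z] w]; case: q => [[[x' y'] z'] w'].
rewrite !big_ord4 /tm !mon4E !mxE /= !(F2_natr a) !(F2_natr b) !(F2_natr c) !(F2_natr d).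
by rewrite -!natrM !mulnb !F2_addb !addbA -natrM mulnb F2_addb !addbA.
Qed.

Definition qhalf (t : q4) : q4 := let: (a, b, c, d) := t in (a./2, b./2, c./2, d./2).

Definition liftb (v : bv) (hb : q4 -> bool) (t : q4) : bool :=
  let: (a, b, c, d) := t in let: (x, y, z, w) := v in
  match odd a, odd b, odd c, odd d with
  | false, true, true, true => x
  | true, false, true, true => y
  | true, true, false, true => z
  | true, true, true, false => w
  | _, _, _, _ => false
  end && hb (qhalf t).

Lemma set4_eq (E F : {set 'I_4}) : (E == F) = [&& (i0 \in E) == (i0 \in F),
  (i1 \in E) == (i1 \in F), (i2 \in E) == (i2 \in F) & (i3 \in E) == (i3 \in F)].
Proof.
apply/eqP/idP => [->|/and4P [/eqP h0 /eqP h1 /eqP h2 /eqP h3]]; first by rewrite !eqxx.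
by apply/setP => i; elim/ord4_ind: i.
Qed.

Lemma halfm_tm t : halfm (tm t) = tm (qhalf t).
Proof.
case: t => [[[a b] c] d]; apply/mnmP => i; rewrite mnmE.
by elim/ord4_ind: i.
Qed.

Lemma lift_tm (v : bv) (h : dual) (hb : q4 -> bool) (t : q4) : (forall u, h (tm u) = (hb u)%:R) ->
  lift (toC v) h (tm t) = (liftb v hb t)%:R.
Proof.
move=> hh; rewrite /lift halfm_tm hh -mulr_suml /liftb.
case: t => [[[a b] c] d]; case: v => [[[x y] z] w]; rewrite -mulnb natrM; congr (_ * _).
rewrite big_ord4 !set4_eq !inE /tm !mon4E /= !mxE /=.
by case: (odd a); case: (odd b); case: (odd c); case: (odd d);
  rewrite /= ?mulr0 ?mulr1 ?addr0 ?add0r.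
Qed.

(** * Spans *)

Inductive Span (P : dual -> Prop) : dual -> Prop :=
| Span0 : Span P dzero
| SpanS g f : P g -> Span P f -> Span P (dadd g f).

Lemma dadd0r f : dadd dzero f = f.
Proof. by apply: functional_extensionality => m; rewrite /dadd add0r. Qed.

Lemma daddr0 f : dadd f dzero = f.
Proof. by apply: functional_extensionality => m; rewrite /dadd addr0. Qed.

Lemma daddA f g h : dadd f (dadd g h) = dadd (dadd f g) h.
Proof. by apply: functional_extensionality => m; rewrite /dadd addrA. Qed.

Lemma daddC f g : dadd f g = dadd g f.
Proof. by apply: functional_extensionality => m; rewrite /dadd addrC. Qed.

Lemma daddxx f : dadd f f = dzero.
Proof. by apply: functional_extensionality => m; rewrite /dadd F2_addxx. Qed.

Lemma Span1 P f : P f -> Span P f.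
Proof. by move=> h; rewrite -[f]daddr0; apply: SpanS => //; exact: Span0. Qed.

Lemma SpanD P f g : Span P f -> Span P g -> Span P (dadd f g).
Proof.
elim=> [|h f' hP _ IH] sg; first by rewrite dadd0r.
by rewrite -daddA; apply: SpanS => //; exact: IH.
Qed.

Lemma Span_map (P Q : dual -> Prop) (L : dual -> dual) : L dzero = dzero ->
  (forall f g, L (dadd f g) = dadd (L f) (L g)) -> (forall f, P f -> Span Q (L f)) ->
  forall f, Span P f -> Span Q (L f).
Proof.
move=> L0 LD PQ f; elim=> [|g f' Pg _ IH]; first by rewrite L0; exact: Span0.
by rewrite LD; apply: SpanD => //; exact: PQ.
Qed.

Lemma Span_sum (P : dual -> Prop) (I : Type) (r : seq I) (Q : pred I) (F : I -> dual) :
  (forall i, Q i -> Span P (F i)) -> Span P (fun m => \sum_(i <- r | Q i) F i m).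
Proof.
move=> h; elim: r => [|i r IH].
  have -> : (fun m => \sum_(i <- [::] | Q i) F i m) = dzero.
    by apply: functional_extensionality => m; rewrite big_nil.
  exact: Span0.
case Qi : (Q i); last first.
  have -> // : (fun m => \sum_(i <- i :: r | Q i) F i m) = fun m => \sum_(i <- r | Q i) F i m.
  by apply: functional_extensionality => m; rewrite big_cons Qi.
have -> : (fun m => \sum_(i <- i :: r | Q i) F i m) = dadd (F i) (fun m => \sum_(i <- r | Q i) F i m).
  by apply: functional_extensionality => m; rewrite big_cons Qi.
by apply: SpanD => //; exact: h.
Qed.

Section Eliminate.
Variables (X : eqType) (G : Type) (cf : dual -> X -> k) (sem : G -> dual) (val : G -> X -> bool).
Hypothesis cfD : forall f g x, cf (dadd f g) x = cf f x + cf g x.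
Hypothesis cf0 : forall x, cf dzero x = 0.

Fixpoint triangular (L : seq (X * G)) : bool :=
  if L is (x, g) :: L' then [&& val g x, all (fun y => ~~ val y.2 x) L' & triangular L'] else true.

Definition evaluates (P : G -> Prop) := forall g x, P g -> cf (sem g) x = (val g x)%:R.

(* The generators vanish at the earlier coordinates, which are therefore killed for good. *)
Lemma eliminate (P : G -> Prop) (Pb : G -> bool) L f : (forall g, Pb g -> P g) -> evaluates P ->
  all (fun y => Pb y.2) L -> triangular L ->
  exists c, Span (fun h => exists2 g, P g & h = sem g) c /\
    forall x, x \in [seq y.1 | y <- L] -> cf (dadd f c) x = 0.
Proof.
move=> PbP hv; pose Q L' x := all (fun y : X * G => ~~ val y.2 x) L'.
suff H : all (fun y => Pb y.2) L -> triangular L -> exists c,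
    [/\ Span (fun h => exists2 g, P g & h = sem g) c, forall x, Q L x -> cf c x = 0 &
    forall x, x \in [seq y.1 | y <- L] -> cf (dadd f c) x = 0].
  by move=> aL tL; have [c [h1 _ h3]] := H aL tL; exists c.
elim: L f => [|[x g] L IH] f; first by move=> _ _; exists dzero; split=> //; exact: Span0.
move=> /= /andP[/PbP Pg aL] /and3P[gx Lx tL].
pose f1 := if cf f x == 0 then f else dadd f (sem g).
have [c [sc c0 cL]] := IH f1 aL tL.
have f1x : cf f1 x = 0.
  rewrite /f1; case: eqP => // /eqP /F2_neq0 h.
  by rewrite cfD h hv // gx F2_addxx.
exists (if cf f x == 0 then c else dadd (sem g) c); split.
- by case: ifP => // _; apply: SpanS => //; exists g.
- move=> y /andP[gy Ly]; case: ifP => _; first exact: c0.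
  by rewrite cfD hv // (negbTE gy) add0r; exact: c0.
move=> y; rewrite inE => yL.
have -> : dadd f (if cf f x == 0 then c else dadd (sem g) c) = dadd f1 c.
  by rewrite /f1; case: ifP => // _; rewrite daddA.
case/predU1P: yL => [->|]; last exact: cL.
by rewrite cfD f1x c0 ?addr0.
Qed.

End Eliminate.

Definition eb1 : bv := (true, false, false, false).

Lemma toC_eb1 : toC eb1 = e1.
Proof. by apply/colP => i; elim/ord4_ind: i; rewrite !mxE. Qed.

(* [inl r] stands for the point [r], [inr (p, q)] for the lift along [v] of the product of
   the linear forms [p] and [q]. *)
Definition gen7 : Type := (bv + bv * bv)%type.

Definition gen7_val (v : bv) (g : gen7) (t : q4) : bool :=
  match g with
  | inl r => (qdeg t == 7) && qsupp t r
  | inr (p, q) => liftb v (wedgeb p q) t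
  end.

Definition gen7_sem (v : bv) (g : gen7) : dual :=
  match g with
  | inl r => point (toR r)
  | inr (p, q) => lift (toC v) (wedge (toR p) (toR q))
  end.

Definition gen7_ok (v : bv) (g : gen7) : bool :=
  match g with
  | inl r => (r != b0) && ~~ bdot r v
  | inr (p, q) => ~~ bdot p v && ~~ bdot q v
  end.

Lemma gen7_tm v g t : gen7_sem v g (tm t) = (gen7_val v g t)%:R.
Proof.
case: g => [r|[p q]] /=; first exact: point_tm.
by apply: lift_tm => u; exact: wedge_tm.
Qed.

Lemma gen7_annih v g : gen7_ok v g -> annih 7 (gen7_sem v g) /\ killed (toC v) (gen7_sem v g).
Proof.
case: g => [r /andP[r0 /negbTE rv]|[p q] /andP[/negbTE pv /negbTE qv]] /=.
  by split; [apply/annih_point/toR_neq0 | apply/killed_point/bdotP].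
have kw : killed (toC v) (wedge (toR p) (toR q)) by apply: killed_wedge; exact: bdotP.
by split; [apply: (@annih_lift 2) => //; exact: annih_wedge | exact: killed_lift].
Qed.

Definition base_gens : seq (q4 * gen7) :=
  let o := false in let l := true in
  [:: ((0, 1, 2, 4), inl (o, l, l, l));
      ((0, 1, 6, 0), inl (o, l, l, o)); ((0, 1, 0, 6), inl (o, l, o, l)); ((0, 0, 1, 6), inl (o, o, l, l));
      ((0, 7, 0, 0), inl (o, l, o, o)); ((0, 0, 7, 0), inl (o, o, l, o)); ((0, 0, 0, 7), inl (o, o, o, l));
      ((0, 3, 3, 1), inr ((o, l, o, o), (o, o, l, o)));
      ((0, 3, 1, 3), inr ((o, l, o, o), (o, o, o, l)));
      ((0, 1, 3, 3), inr ((o, o, l, o), (o, o, o, l)))]%N.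

Definition base_rels : seq (seq q4) :=
  [seq [seq u <- Stl t | qdeg u == 7] | t <- flatten [seq mons d | d <- iota 0 7] & t.1.1.1 == 0%N].

Lemma base_gens_ok : all (gen7_ok eb1) [seq y.2 | y <- base_gens].
Proof. by []. Qed.

Lemma base_peel_ok : let D := [seq y.1 | y <- base_gens] in let Z := peel 9 D D base_rels in
  all (fun t => (t.1.1.1 != 0%N) || (t \in Z)) (mons 7).
Proof. by vm_compute. Qed.

Lemma annih_rel n f t : annih n f -> (qdeg t < n)%N ->
  \sum_(u <- [seq u <- Stl t | qdeg u == n]) f (tm u) = 0.
Proof.
move=> [df h] lt; rewrite big_filter.
have := h 'X_[tm t]; rewrite StE evX ev_lP (in_deg0 df) ?mdeg_tm ?ltn_eqF // => e.
rewrite -[RHS]e [RHS](bigID (fun u => qdeg u == n)) /= [X in _ + X]big1 ?addr0 // => u nu.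
by rewrite (in_deg0 df) // mdeg_tm.
Qed.

Lemma base_span f : annih 7 f -> killed e1 f ->
  Span (fun h => exists2 g, g \in [seq y.2 | y <- base_gens] & h = gen7_sem eb1 g) f.
Proof.
move=> Kf kf.
pose cf (f : dual) t := f (tm t).
have [c [sc hc]] := @eliminate _ _ cf (gen7_sem eb1) (gen7_val eb1) (fun _ _ _ => erefl) (fun _ => erefl)
  (fun g => g \in [seq y.2 | y <- base_gens]) (fun g => g \in [seq y.2 | y <- base_gens]) base_gens f (fun _ => id) (fun g t _ => gen7_tm eb1 g t) isT isT.
suff z : dadd f c = dzero.
  have -> // : f = c by rewrite -[f]daddr0 -(daddxx c) daddA z dadd0r.
have [Kc kc] : annih 7 c /\ killed e1 c.
  elim: sc => [|h c' [g gok ->] _ [K' k']].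
    by split; [exact: annih0 | move=> u; exact: ev0].
  have [Kg kg] := gen7_annih (allP base_gens_ok _ gok); split; first exact: annihD.
  by move=> u; rewrite evD -toC_eb1 kg toC_eb1 k' addr0.
have Kz := annihD Kf Kc.
have kz : killed e1 (dadd f c) by move=> u; rewrite evD kf kc addr0.
have [dz _] := Kz.
apply: functional_extensionality => m.
case: (eqVneq (mdeg m) 7%N) => [dm|]; last exact: in_deg0.
have /allP/(_ (qm m)) := base_peel_ok; rewrite mem_mons -?mdeg_tm ?qmK // => /(_ isT) /orP[m0|].
  have e : m = (U_(i0) + (m - U_(i0)))%MM by rewrite addmC submK // lep1mP.
  by rewrite e -evX mpolyXUD -(lin_delta i0) kz.
rewrite -[m in RHS]qmK -{2}[m]qmK.
apply: (peelP (val := fun t => dadd f c (tm t))) => // r /mapP [t].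
rewrite mem_filter => /andP[_ /flattenP [s' /mapP [d]]].
rewrite mem_iota add0n => /andP[_ d7] -> td ->; apply: annih_rel => //.
by move: td; rewrite mem_filter => /andP[/eqP -> _].
Qed.

(** * Coinvariants *)

Definition degn s : nat := (2 ^ (s + 3) + 2 ^ (s + 1) - 3)%N.

Lemma degnS s : degn s.+1 = (2 * degn s + 3)%N.
Proof.
rewrite /degn !addSn !expnS -mulnDr.
have h : (3 <= 2 ^ (s + 3) + 2 ^ (s + 1))%N.
  by rewrite (leq_trans _ (leq_addr _ _)) // addnC expnD (leq_trans _ (leq_pmulr _ _)) ?expn_gt0.
by rewrite mulnBr -[3%N in RHS]/(6 - 3)%N addnBA // subnK // (leq_trans (_ : 6 <= 2 * 3)%N) // leq_mul2l.
Qed.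

Lemma odd_degn s : odd (degn s).
Proof. by case: s => [//|s]; rewrite degnS oddD mul2n odd_double. Qed.

Lemma degn_gt0 s : (0 < degn s)%N.
Proof. by have := odd_degn s; case: (degn s). Qed.

Definition liftn s (v : 'cV[k]_4) (h : dual) : dual := iter s (lift v) h.

Lemma liftD v f g : lift v (dadd f g) = dadd (lift v f) (lift v g).
Proof.
apply: functional_extensionality => m; rewrite /lift /dadd -big_split.
by apply: eq_bigr => i _; rewrite mulrDr.
Qed.

Lemma lift_zero v : lift v dzero = dzero.
Proof. by apply: functional_extensionality => m; rewrite /lift big1 // => i _; rewrite mulr0. Qed.

Lemma liftnD s v f g : liftn s v (dadd f g) = dadd (liftn s v f) (liftn s v g).
Proof. by elim: s => //= s ->; exact: liftD. Qed.

Lemma liftn_zero s v : liftn s v dzero = dzero.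
Proof. by elim: s => //= s ->; exact: lift_zero. Qed.

Lemma annih_liftn s v h : annih 7 h -> killed v h -> annih (degn s) (liftn s v h) /\ killed v (liftn s v h).
Proof.
move=> Kh kh; elim: s => [//|s [K1 k1]]; rewrite degnS.
by split; [exact: annih_lift | exact: killed_lift].
Qed.

Lemma liftn_act s (v v' : 'cV[k]_4) g h : g \in unitmx -> annih 7 h -> killed v h -> v' != 0 -> v != 0 ->
  g *m v' = v -> act (liftn s v h) g = liftn s v' (act h g).
Proof.
move=> ug Kh kh v'0 v0 e; elim: s => //= s <-.
by have [K1 k1] := annih_liftn s Kh kh; exact: lift_act K1 k1 _ _ e.
Qed.

Lemma liftn_down s v f : annih (degn s) f -> killed v f -> v != 0 ->
  exists h, [/\ annih 7 h, killed v h & f = liftn s v h].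
Proof.
move=> Kf kf v0; elim: s f Kf kf => [|s IH] f; first by exists f.
rewrite degnS => Kf kf; have /cV0Pn [i vi] := v0.
have tf := annih_three_odd (odd_degn s) Kf.
have [h [Kh kh e]] := IH _ (annih_kcomp Kf tf i) (killed_kcomp_killed tf kf vi).
by exists h; split=> //=; rewrite -/(liftn s v h) -e; exact: lift_kcomp.
Qed.

Definition coinv0 n := Span (fun h => exists f g, [/\ annih n f, g \in unitmx & h = dadd (act f g) f]).

Lemma dscaleN f : dscale (-1) f = f.
Proof. by apply: functional_extensionality => m; rewrite /dscale F2_opp mul1r. Qed.

Lemma coinv0_coinv n f : coinv0 n f <-> coinv_zero n f.
Proof.
split=> [|[s]].
  elim=> [|h f' [f1 [g [K1 ug ->]]] _ [s [hs e]]]; first by exists [::].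
  exists ((f1, g) :: s); split=> [|m]; first by split=> //; exact/PA_annih.
  by rewrite /= dscaleN /dadd -e act.unlock.
elim: s f => [|[f1 g] s IH] f /= [].
  by move=> _ e; have -> : f = dzero by [exact: functional_extensionality]; exact: Span0.
case=> ug /PA_annih K1 hs e.
have -> : f = dadd (dadd (act f1 g) f1) (dsum [seq dadd (dact fg.1 fg.2) (dscale (-1) fg.1) | fg <- s]).
  by apply: functional_extensionality => m; rewrite e dscaleN act.unlock.
apply: SpanS; first by exists f1, g.
exact: IH.
Qed.

Lemma coinv0_act n f g : annih n f -> g \in unitmx -> coinv0 n (dadd (act f g) f).
Proof. by move=> Kf ug; apply: Span1; exists f, g. Qed.

Definition spike s : dual := liftn s e1 (point (er i3)).

Lemma er3_e1 : er i3 *m e1 = 0.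
Proof. by rewrite er_col mxE; exact: raddf0. Qed.

Lemma annih_spike s : annih (degn s) (spike s) /\ killed e1 (spike s).
Proof. by apply: annih_liftn; [exact/annih_point/er_neq0 | exact/killed_point/er3_e1]. Qed.

Lemma coinv0_point s v r : v != 0 -> r != 0 -> r *m v = 0 -> coinv0 (degn s) (dadd (liftn s v (point r)) (spike s)).
Proof.
move=> v0 r0 rv; have [g ug [gv gr]] := pair_trans v0 r0 rv.
rewrite -gr -act_point -(@liftn_act _ e1) ?e1_neq0 //.
- by apply: coinv0_act => //; case: (annih_spike s).
- exact/annih_point/er_neq0.
- exact/killed_point/er3_e1.
Qed.

Lemma coinv0_wedge s j l t : j != i0 -> l != i0 -> t != i0 -> j != t -> l != t ->
  coinv0 (degn s) (liftn s e1 (lift e1 (wedge (er j) (er l)))).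
Proof.
move=> j0 l0 t0 jt lt.
have ee i : i != i0 -> er i *m e1 = 0.
  by move=> h; rewrite er_col mxE (negbTE h); exact: raddf0.
have h0 a : er a *m (delta_mx t 0 : 'cV[k]_4) = (a == t)%:R%:M.
  by rewrite er_col mxE eqxx andbT.
pose g : 'M[k]_4 := 1%:M + delta_mx t 0 *m er l.
have ug : g \in unitmx by apply: unit_transv; rewrite h0 (negbTE lt); exact: raddf0.
have ge : g *m e1 = e1 by rewrite mulmxDl mul1mx -mulmxA ee // mulmx0 addr0.
have gj : er j *m g = er j.
  by rewrite mulmxDr mulmx1 mulmxA h0 (negbTE jt) raddf0 mul0mx addr0.
have gt : er t *m g = er t + er l by rewrite mulmxDr mulmx1 mulmxA h0 eqxx mul1mx.
pose w := lift e1 (wedge (er j) (er t)).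
have kw : killed e1 (wedge (er j) (er t)) by apply: killed_wedge; exact: ee.
have Kw : annih 7 w by apply: (@annih_lift 2) => //; exact: annih_wedge.
have kFw : killed e1 w by exact: killed_lift.
have -> : liftn s e1 (lift e1 (wedge (er j) (er l))) = dadd (act (liftn s e1 w) g) (liftn s e1 w).
  rewrite (@liftn_act _ _ e1) ?e1_neq0 // /w (@lift_act 2 _ e1) ?e1_neq0 //; last exact: annih_wedge.
  rewrite act_wedge gj gt wedgeDr liftD liftnD daddC daddA daddxx dadd0r //.
by apply: coinv0_act => //; case: (annih_liftn s Kw kFw).
Qed.

Definition mult_spike s f := coinv0 (degn s) f \/ coinv0 (degn s) (dadd f (spike s)).

Lemma mult_spikeD s f g : mult_spike s f -> mult_spike s g -> mult_spike s (dadd f g).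
Proof.
move=> [h1|h1] [h2|h2]; have := SpanD h1 h2; [by left | | |].
- by rewrite daddA; right.
- by rewrite -daddA (daddC (spike s)) daddA; right.
- by rewrite -daddA (daddA (spike s)) (daddC (spike s)) -daddA daddxx daddr0 => h; left.
Qed.

Lemma mult_spike_coinv0 s f g : coinv0 (degn s) (dadd f g) -> mult_spike s g -> mult_spike s f.
Proof.
move=> h hg; have -> : f = dadd (dadd f g) g by rewrite -daddA daddxx daddr0.
by apply: mult_spikeD => //; left.
Qed.

Lemma mult_spike_Span s (P : dual -> Prop) f : (forall g, P g -> mult_spike s g) -> Span P f -> mult_spike s f.
Proof. by move=> h; elim=> [|g f' /h g1 _ IH]; [left; exact: Span0 | exact: mult_spikeD]. Qed.

Lemma toR_er (b : bv) i : (forall j, bnth b j = (j == i)) -> toR b = er i.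
Proof. by move=> h; apply/rowP => j; rewrite !mxE h eqxx. Qed.

Lemma killed_mult_spike s v f : annih (degn s) f -> killed v f -> v != 0 -> mult_spike s f.
Proof.
move=> Kf kf v0; have [g ug ge] := col_trans v0.
have ui : invmx g \in unitmx by rewrite unitmx_inv.
have gi : invmx g *m e1 = v by rewrite -ge mulKmx.
apply: (@mult_spike_coinv0 _ _ (act f (invmx g))); first by rewrite daddC; exact: coinv0_act.
have {kf gi}kf := killed_act gi kf; have {Kf}Kf := annih_act (invmx g) Kf.
have [h [Kh kh ->]] := liftn_down Kf kf e1_neq0.
have := Span_map (liftn_zero s e1) (liftnD s e1) _ (base_span Kh kh).
move=> /(_ (fun f => exists2 g, g \in [seq y.2 | y <- base_gens] & f = liftn s e1 (gen7_sem eb1 g))) H.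
apply: mult_spike_Span (H _) => [_ [x xi ->]|_ [x xi ->]]; last by apply: Span1; exists x.
case: x xi => [r|[p q]] /= xi.
  right; have /allP/(_ _ xi) /= /andP[r0 /negbTE rv] := base_gens_ok.
  by apply: coinv0_point; [exact: e1_neq0 | exact: toR_neq0 | rewrite -toC_eb1; exact: bdotP].
left; rewrite toC_eb1; move: xi; rewrite !inE /=.
have er1 : toR (false, true, false, false) = er i1 by apply: toR_er => j; elim/ord4_ind: j.
have er2 : toR (false, false, true, false) = er i2 by apply: toR_er => j; elim/ord4_ind: j.
have er3 : toR (false, false, false, true) = er i3 by apply: toR_er => j; elim/ord4_ind: j.
move=> /or3P[] /eqP [-> ->]; rewrite ?er1 ?er2 ?er3.
- exact: (@coinv0_wedge _ _ _ i3).
- exact: (@coinv0_wedge _ _ _ i2).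
- exact: (@coinv0_wedge _ _ _ i1).
Qed.

Lemma lift_amon b c d : lift e1 (amon 0 b c d) = amon 0 (2 * b + 1) (2 * c + 1) (2 * d + 1).
Proof.
apply: functional_extensionality => m; rewrite -[m]qmK -toC_eb1 !amon_bdual.
rewrite (lift_tm _ _ (bdualE _)) bdualE; case: (qm m) => [[[a' b'] c'] d'] /=.
have H x y : (x == (2 * y + 1)%N) = odd x && (x./2 == y).
  rewrite -{1}[x]odd_double_half addnC mul2n; case: (odd x) => /=.
    by rewrite eqn_add2r -!mul2n eqn_mul2l.
  by rewrite addn0; apply/eqP => /(congr1 odd); rewrite addn1 /= !odd_double.
have H0 x : (x == 0%N) = ~~ odd x && (x./2 == 0%N).
  by case: x => [|[|x]] //=; rewrite andbF.
rewrite !xpair_eqE (H0 a') !H; congr (_%:R); congr nat_of_bool.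
move: (odd a') (odd b') (odd c') (odd d') (a'./2 == 0%N) (b'./2 == b) (c'./2 == c) (d'./2 == d).
by do 8!case.
Qed.

Lemma spikeE s : spike s = amon 0 (2 ^ s - 1) (2 ^ s - 1) (2 ^ (s + 3) - 1).
Proof.
elim: s => [|s IH]; first by rewrite /spike /= point_er3.
rewrite /spike /= -/(spike s) IH lift_amon.
have H j : (2 * (2 ^ j - 1) + 1 = 2 ^ j.+1 - 1)%N.
  have : (0 < 2 ^ j)%N by rewrite expn_gt0.
  case e : (2 ^ j)%N => [|x] // _; rewrite expnS e subn1 /= mulnS addnC.
  by rewrite -[(2 + _ - 1)%N]/(1 + 2 * x)%N.
by rewrite !H addSn.
Qed.

#[local] Arguments liftn : simpl never.

(** * The case [s >= 3] *)

Lemma degn3 s : degn s.+3 = (2 * (2 * (2 * degn s + 3) + 3) + 3)%N.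
Proof. by rewrite !degnS. Qed.

Lemma liftn_inj s v h : v != 0 -> liftn s v h = dzero -> h = dzero.
Proof. by move=> v0; rewrite /liftn; elim: s => //= s IH /(lift_inj v0) /IH. Qed.

Lemma killed0 v : killed v dzero. Proof. by move=> u; rewrite ev0. Qed.

Lemma killedD v f g : killed v f -> killed v g -> killed v (dadd f g).
Proof. by move=> h1 h2 u; rewrite evD h1 h2 addr0. Qed.

Definition hyp_family (h : 'cV[k]_4 -> dual) := forall v, annih 7 (h v) /\ killed v (h v).

Lemma decompose7 s f : annih (degn s.+3) f -> exists h, hyp_family h /\
  f = fun m => \sum_(v | v != 0) liftn s.+3 v (h v) m.
Proof.
rewrite degn3 => /(decomposition (odd_degn s)) [h [hK ->]].
have H v : exists h', [/\ annih 7 h', killed v h' & (v != 0 -> h v = liftn s v h')].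
  case: (eqVneq v 0) => [_|v0]; first by exists dzero; split=> //; [exact: annih0 | exact: killed0].
  by have [K1 k1] := hK v; have [h' [? ? ?]] := liftn_down K1 k1 v0; exists h'.
have [h' hh'] := fin_all_exists H.
exists h'; split=> [v|]; first by have [? ? _] := hh' v.
apply: functional_extensionality => m; apply: eq_bigr => v v0.
by have [_ _ ->] := hh' v.
Qed.

Lemma family_inj s h : hyp_family h ->
  (fun m => \sum_(v | v != 0) liftn s.+3 v (h v) m) = dzero -> forall v, v != 0 -> h v = dzero.
Proof.
move=> hK e v v0; apply: (@liftn_inj s v) => //.
apply: (@lift3_sum_inj (degn s) (fun v => liftn s v (h v)) (degn_gt0 s)) => // w.
by have [K1 k1] := hK w; exact: annih_liftn.
Qed.

(* Sum of the coefficients of the points in a functional killed by [v], computed on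
   the polynomial 1 + prod_(j <> i) (1 + x_j) without constant term, homogenized by
   weight (1,1,1), where [v_i = 1]. *)
Definition or_poly (i : 'I_4) : seq q4 :=
  nth [::] [::
    [:: (0, 7, 0, 0); (0, 0, 7, 0); (0, 0, 0, 7); (0, 1, 6, 0); (0, 1, 0, 6); (0, 0, 1, 6); (0, 1, 2, 4)];
    [:: (7, 0, 0, 0); (0, 0, 7, 0); (0, 0, 0, 7); (1, 0, 6, 0); (1, 0, 0, 6); (0, 0, 1, 6); (1, 0, 2, 4)];
    [:: (7, 0, 0, 0); (0, 7, 0, 0); (0, 0, 0, 7); (1, 6, 0, 0); (1, 0, 0, 6); (0, 1, 0, 6); (1, 2, 0, 4)];
    [:: (7, 0, 0, 0); (0, 7, 0, 0); (0, 0, 7, 0); (1, 6, 0, 0); (1, 0, 6, 0); (0, 1, 6, 0); (1, 2, 4, 0)]]%N i.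

Definition point_count (v : 'cV[k]_4) (f : dual) : k :=
  if [pick i | v i 0 != 0] is Some i then ev f (lP (or_poly i)) else 0.

Lemma point_countD v f g : point_count v (dadd f g) = point_count v f + point_count v g.
Proof. by rewrite /point_count; case: pickP => [i _|_]; rewrite ?evD ?addr0. Qed.

Lemma point_count0 v : point_count v dzero = 0.
Proof. by rewrite /point_count; case: pickP => [i _|_] //; rewrite ev0. Qed.

Lemma point_count_point v r : v != 0 -> r != 0 -> r *m v = 0 -> point_count v (point r) = 1.
Proof.
move=> v0 r0 rv; rewrite /point_count; case: pickP => [i vi|h]; last first.
  by case/negP: v0; apply/eqP/colP => i; have /negbFE/eqP := h i; rewrite mxE.
have [rb er] := toR_surj r; have [vb ev'] := toC_surj v.
rewrite er ev_lP; under eq_bigr => t _ do rewrite point_tm.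
have rb0 : rb != b0.
  apply: contraNneq r0 => e; rewrite er e; apply/eqP/rowP => j.
  by rewrite !mxE; elim/ord4_ind: j.
have rv0 : bdot rb vb = false.
  have := rv; rewrite er ev' toR_toC => /matrixP/(_ 0 0); rewrite !mxE eqxx.
  by case: bdot => // /eqP; rewrite oner_eq0.
have vbi : bnth vb i by move: vi; rewrite ev' mxE; case: bnth; rewrite ?eqxx.
rewrite -(natr_sum _ _ _ _) F2_natr; suff -> : odd (\sum_(t <- or_poly i) ((qdeg t == 7%N) && qsupp t rb)) by [].
move: rb0 rv0 vbi; case: rb {er} => [[[x y] z] w]; case: vb {ev'} => [[[x' y'] z'] w'].
elim/ord4_ind: i {vi} => /=; rewrite unlock /=;
  case: x; case: y; case: z; case: w; case: x'; case: y'; case: z'; by case: w'.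
Qed.

Lemma sing_tm f t : sing f -> #|oddset (tm t)| = 1%N -> f (tm t) = 0.
Proof.
move=> sf /eqP/cards1P [i e]; rewrite -(mk_halfm (tm t)) e -evX mpolyX_mk xs1.
exact: sf.
Qed.

Lemma card_oddset t : #|oddset (tm t)| = let: (a, b, c, d) := t in (odd a + odd b + odd c + odd d)%N.
Proof.
case: t => [[[a b] c] d]; rewrite -sum1_card big_mkcond big_ord4 /= !inE /tm !mon4E !addnA.
by case: (odd a); case: (odd b); case: (odd c); case: (odd d).
Qed.

Lemma point_count_sing v f : sing f -> point_count v f = 0.
Proof.
move=> sf; rewrite /point_count; case: pickP => [i _|//]; rewrite ev_lP big_seq big1 // => t ti.
apply: sing_tm => //; rewrite card_oddset; move: ti; elim/ord4_ind: i; rewrite !inE /=.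
all: by do 6?[move=> /predU1P [->|] //]; move=> /eqP ->.
Qed.

Lemma sing_lift v h : sing (lift v h).
Proof. exact/sing_three_odd/lift_three_odd. Qed.

Lemma span7 v f : v != 0 -> annih 7 f -> killed v f ->
  Span (fun h => sing h \/ exists r, [/\ r != 0, r *m v = 0 & h = point r]) f.
Proof.
move=> v0 Kf kf; have [g ug ge] := col_trans v0.
have gi : invmx g *m e1 = v by rewrite -ge mulKmx.
rewrite -[f]act1 -(mulVmx ug) -actM.
apply: (Span_map (act0 g) (fun f h => actD f h g) _ (base_span (annih_act (invmx g) Kf) (killed_act gi kf))).
move=> _ [x xi ->]; apply: Span1; case: x xi => [r|[p q]] /= xi; last first.
  by left; apply: sing_act; exact: sing_lift.
have /allP/(_ _ xi) /= /andP[r0 /negbTE rv] := base_gens_ok.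
right; exists (toR r *m g); rewrite act_point; split=> //.
  apply: contraNneq (toR_neq0 r0) => h.
  by rewrite -[toR r]mulmx1 -(mulmxV ug) mulmxA h mul0mx.
by rewrite -mulmxA ge -toC_eb1; exact: bdotP.
Qed.

Lemma point_count_act (v v' : 'cV[k]_4) g f : g \in unitmx -> v != 0 -> g *m v' = v -> annih 7 f -> killed v f ->
  point_count v' (act f g) = point_count v f.
Proof.
move=> ug v0 gv Kf kf; have v'0 : v' != 0 by apply: contraNneq v0 => h; rewrite -gv h mulmx0.
elim: (span7 v0 Kf kf) => [|h f' hh _ IH]; first by rewrite act0 !point_count0.
rewrite actD !point_countD IH; congr (_ + _); case: hh => [sh|[r [r0 rv ->]]].
  by rewrite !point_count_sing //; exact: sing_act.
rewrite act_point !point_count_point //.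
- by apply: contraNneq r0 => h0; rewrite -[r]mulmx1 -(mulmxV ug) mulmxA h0 mul0mx.
- by rewrite -mulmxA gv.
Qed.

Definition point_sum s f (c : k) := exists h, [/\ hyp_family h,
  f = (fun m => \sum_(v | v != 0) liftn s.+3 v (h v) m) & c = \sum_(v | v != 0) point_count v (h v)].

Lemma point_sumD s f f' c c' : point_sum s f c -> point_sum s f' c' ->
  point_sum s (dadd f f') (c + c').
Proof.
move=> [h [hK -> ->]] [h' [hK' -> ->]]; exists (fun v => dadd (h v) (h' v)); split.
- move=> v; have [? ?] := hK v; have [? ?] := hK' v.
  by split; [exact: annihD | exact: killedD].
- apply: functional_extensionality => m; rewrite /dadd -big_split; apply: eq_bigr => v _.
  by rewrite -/(dadd _ _) liftnD.
- by rewrite -big_split; apply: eq_bigr => v _; rewrite point_countD.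
Qed.

Lemma point_sum_uniq s f c : point_sum s f c -> f = dzero -> c = 0.
Proof.
move=> [h [hK -> ->]] e; rewrite big1 // => v v0.
by rewrite (family_inj hK e v0) point_count0.
Qed.

Lemma point_sum_act s f c g : g \in unitmx -> point_sum s f c -> point_sum s (act f g) c.
Proof.
move=> ug [h [hK -> ->]].
have g0 v : (g *m v != 0) = (v != 0).
  apply/idP/idP; apply: contraNneq => e; first by rewrite e mulmx0.
  by rewrite -[v](mulKmx ug) e mulmx0.
have gbij : {on [pred v : 'cV[k]_4 | v != 0], bijective (fun v : 'cV[k]_4 => g *m v)}.
  by apply: onW_bij; exists (fun v => invmx g *m v) => v; rewrite ?mulKmx ?mulKVmx.
exists (fun v => act (h (g *m v)) g); split.
- move=> v; have [? ?] := hK (g *m v).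
  by split; [exact: annih_act | exact: (@killed_act (g *m v))].
- apply: dual_ext => p; rewrite actE !ev_sum (reindex _ gbij) /=.
  apply: eq_big => [v|v v0]; first exact: g0.
  have [K1 k1] := hK (g *m v); rewrite -actE; congr (ev _ _).
  by apply: (@liftn_act s.+3 (g *m v) v g _ ug K1 k1 _ v0 erefl); rewrite -g0.
- rewrite (reindex _ gbij) /=; apply: eq_big => [v|v v0]; first exact: g0.
  by have [K1 k1] := hK (g *m v); rewrite (@point_count_act (g *m v)).
Qed.

Lemma coinv0_point_sum s f : coinv0 (degn s.+3) f -> point_sum s f 0.
Proof.
elim=> [|_ f' [f1 [g [K1 ug ->]]] _ IH].
  exists (fun=> dzero); split=> [v||]; first by split; [exact: annih0 | exact: killed0].
    by apply: functional_extensionality => m; rewrite big1 // => v _; rewrite liftn_zero.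
  by rewrite big1 // => v _; exact: point_count0.
have [h [hK e]] := decompose7 K1.
have R1 : point_sum s f1 (\sum_(v | v != 0) point_count v (h v)) by exists h.
have := point_sumD (point_sumD (point_sum_act ug R1) R1) IH.
by rewrite F2_addxx addr0.
Qed.

Lemma spike_point_sum s : point_sum s (spike s.+3) 1.
Proof.
exists (fun v => if v == e1 then point (er i3) else dzero); split=> [v||].
- case: eqP => [->|_]; last by split; [exact: annih0 | exact: killed0].
  by split; [exact/annih_point/er_neq0 | exact/killed_point/er3_e1].
- apply: functional_extensionality => m; rewrite (bigD1 e1) ?e1_neq0 //= eqxx big1 ?addr0 // => v /andP[_ /negbTE ->].
  by rewrite liftn_zero.
rewrite (bigD1 e1) ?e1_neq0 //= eqxx big1 ?addr0 => [|v /andP[_ /negbTE ->]]; last exact: point_count0.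
by rewrite point_count_point ?e1_neq0 ?er_neq0 ?er3_e1.
Qed.

Lemma spike_nonzero s : ~ coinv0 (degn s.+3) (spike s.+3).
Proof.
move=> /coinv0_point_sum R; have := point_sumD R (spike_point_sum s); rewrite add0r daddxx.
by move=> /point_sum_uniq/(_ erefl)/eqP; rewrite oner_eq0.
Qed.

Lemma coinv_s3 s : coinv_spanned_by (degn s.+3) (spike s.+3).
Proof.
split; first by apply/PA_annih; case: (annih_spike s.+3).
split=> [/coinv0_coinv/spike_nonzero //|f /PA_annih Kf].
have : mult_spike s.+3 f.
  have [h [hK ->]] := decompose7 Kf.
  have sp : Span (fun g => exists v, [/\ v != 0, annih (degn s.+3) g & killed v g])
      (fun m => \sum_(v | v != 0) liftn s.+3 v (h v) m).
    apply: Span_sum => v v0; apply: Span1; exists v; have [K1 k1] := hK v.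
    by have [K2 k2] := annih_liftn s.+3 K1 k1.
  apply: mult_spike_Span sp => g [v [v0 Kg kg]]; exact: killed_mult_spike Kg kg v0.
case=> h; [exists 0 | exists 1]; apply/coinv0_coinv.
  have -> // : dadd f (dscale (- 0) (spike s.+3)) = f.
  by apply: functional_extensionality => m; rewrite /dadd /dscale oppr0 mul0r addr0.
by rewrite dscaleN.
Qed.

(** * The cases [s = 1] and [s = 2] *)

(* Bit [i] of [n] is the coordinate of index [i]. *)
Definition bn (n : nat) : bv := (odd n, odd n./2, odd n./2./2, odd n./2./2./2).

Definition bor (a v : bv) : bv :=
  let: (x, y, z, w) := a in let: (x', y', z', w') := v in (x || x', y || y', z || z', w || w').

Definition bsing (i : 'I_4) : bv := bn (2 ^ i).

Definition bfst (a : bv) : 'I_4 :=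
  let: (x, y, z, w) := a in if x then i0 else if y then i1 else if z then i2 else i3.

Definition blst (a : bv) : 'I_4 :=
  let: (x, y, z, w) := a in if w then i3 else if z then i2 else if y then i1 else i0.

Definition ords : seq 'I_4 := [:: i0; i1; i2; i3].

Definition addU (t : q4) (i : 'I_4) : q4 :=
  let: (a, b, c, d) := t in
  nth t [:: (a.+1, b, c, d); (a, b.+1, c, d); (a, b, c.+1, d); (a, b, c, d.+1)] i.

Lemma tm_addU t i : tm (addU t i) = (U_(i) + tm t)%MM.
Proof.
case: t => [[[a b] c] d]; apply/mnmP => j; rewrite mnmDE mnm1E.
by elim/ord4_ind: i; elim/ord4_ind: j.
Qed.

Lemma sum_ords (F : 'I_4 -> k) : \sum_(j <- ords) F j = \sum_j F j.
Proof. by rewrite big_ord4 /ords !big_cons big_nil addr0. Qed.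

(* A coordinate [(a, t)] is the value at [t] of the component f_i ([s = 1]) or f_ij
   ([s = 2]) where [a] is the indicator of {i} resp. {i, j}. *)
Definition coord : Type := (bv * q4)%type.

Definition cf1 (f : dual) (x : coord) : k := kcomp (bfst x.1) f (tm x.2).
Definition cf2 (f : dual) (x : coord) : k := kcomp (blst x.1) (kcomp (bfst x.1) f) (tm x.2).

Definition sings : seq bv := [seq bsing i | i <- ords].
Definition pairs : seq bv := [seq bn i | i <- [:: 1; 2; 4; 8; 3; 5; 9; 6; 10; 12]%N].

Definition hit_rels (A : seq bv) : seq (seq coord) :=
  [seq [seq (a, u) | u <- [seq u <- Stl t | qdeg u == 7]] |
    a <- A, t <- flatten [seq mons d | d <- iota 0 7]].

Definition diag_rels : seq (seq coord) :=
  [seq [seq (bsing j, addU t j) | j <- ords] | t <- mons 6].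

Definition row_rels : seq (seq coord) :=
  [seq [seq (bor (bsing i) (bsing j), addU t j) | j <- ords] | i <- ords, t <- mons 6].

(* A generator: a flag for [zeta] and a list of functionals killed by nonzero vectors. *)
Definition gens : Type := (bool * seq (bv * gen7))%type.

Definition P (v r : nat) : bv * gen7 := (bn v, inl (bn r)).
Definition W (v p q : nat) : bv * gen7 := (bn v, inr (bn p, bn q)).
Definition D (a b c d e : nat) (l : seq (bv * gen7)) : coord * gens := ((bn a, (b, c, d, e)), (false, l)).
Definition Dz (a b c d e : nat) (l : seq (bv * gen7)) : coord * gens := ((bn a, (b, c, d, e)), (true, l)).

Definition zlist : seq q4 := [::
 (5, 5, 5, 2); (5, 5, 6, 1); (3, 5, 8, 1); (5, 3, 8, 1); (3, 6, 7, 1);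
 (5, 7, 4, 1); (7, 5, 4, 1); (3, 9, 4, 1); (9, 3, 4, 1); (3, 9, 3, 2);
 (9, 3, 3, 2); (5, 9, 2, 1); (9, 5, 2, 1); (5, 10, 1, 1); (9, 6, 1, 1);
 (3, 11, 2, 1); (11, 3, 2, 1); (5, 5, 3, 4); (5, 3, 5, 4); (3, 5, 5, 4);
 (3, 12, 1, 1); (11, 4, 1, 1); (7, 8, 1, 1); (7, 7, 1, 2); (13, 2, 1, 1);
 (14, 1, 1, 1); (6, 5, 3, 3); (5, 3, 6, 3); (3, 6, 5, 3); (6, 3, 3, 5);
 (3, 3, 6, 5); (3, 6, 3, 5); (5, 3, 3, 6); (3, 5, 3, 6); (3, 3, 5, 6);
 (3, 3, 3, 8); (3, 3, 4, 7); (3, 5, 2, 7); (3, 6, 1, 7); (3, 3, 9, 2);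
 (3, 3, 10, 1); (5, 3, 7, 2); (5, 7, 3, 2); (7, 5, 3, 2)]%N.

Lemma zeta_bdual : zeta = bdual (fun t => odd (count_mem t zlist)).
Proof.
have H l : dsum [seq amon t.1.1.1 t.1.1.2 t.1.2 t.2 | t <- l] = bdual (fun t => odd (count_mem t l)).
  apply: functional_extensionality => m; elim: l => [|[[[a b] c] d] l IH] //=.
  by rewrite /dadd IH amon_bdual /bdual F2_addb oddD eq_sym; case: eqP.
exact: (H zlist).
Qed.

Lemma annih_zeta : annih 17 zeta.
Proof.
rewrite zeta_bdual; apply: annih_bdual; last by vm_compute.
move=> t; have : all (fun u => qdeg u == 17) zlist by [].
move=> /allP H; case: (boolP (t \in zlist)) => [/H /eqP //|].
by move=> /count_memPn ->.
Qed.

Definition kameko (i : 'I_4) (t : q4) : q4 :=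
  let: (a, b, c, d) := t in
  (2 * a + (i != i0), 2 * b + (i != i1), 2 * c + (i != i2), 2 * d + (i != i3))%N.

Lemma kcomp_bdual i b t : kcomp i (bdual b) (tm t) = (b (kameko i t))%:R.
Proof.
rewrite kcomp.unlock -mpolyX_mk evX -bdualE; congr (bdual b _).
case: t => [[[x y] z] w]; apply/mnmP => j; rewrite mnmE !inE addnC.
by elim/ord4_ind: j; elim/ord4_ind: i.
Qed.

(* The parameter [q] distinguishes [s = 2] ([cf2]) from [s = 1] ([cf1]). *)
Definition gens_ok (q : bool) (g : gens) : bool :=
  (g.1 ==> ~~ q) && all (fun y => (y.1 != b0) && gen7_ok y.1 y.2) g.2.

Definition gens_sem (q : bool) (g : gens) : dual := fun m =>
  g.1%:R * zeta m + \sum_(y <- g.2) liftn q.+1 (toC y.1) (gen7_sem y.1 y.2) m.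

Definition gens_val (q : bool) (g : gens) (x : coord) : bool :=
  (g.1 && odd (count_mem (kameko (bfst x.1) x.2) zlist)) (+)
  odd (count (fun y => [&& bnth y.1 (bfst x.1), q ==> bnth y.1 (blst x.1) & gen7_val y.1 y.2 x.2]) g.2).

Definition cf (q : bool) := if q then cf2 else cf1.

Lemma cfD q f g x : cf q (dadd f g) x = cf q f x + cf q g x.
Proof.
case: q; rewrite /= /cf2 /cf1; last by rewrite -evX kcompE evD -!kcompE !evX.
by rewrite -evX !kcompE evD -!kcompE !evX.
Qed.

Lemma cf_dzero q x : cf q dzero x = 0.
Proof. by case: q; rewrite /= /cf2 /cf1 -evX !kcompE ev0. Qed.

Lemma cf_sum (q : bool) (I : Type) (r : seq I) (F : I -> dual) x :
  cf q (fun m => \sum_(i <- r) F i m) x = \sum_(i <- r) cf q (F i) x.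
Proof.
by case: q; rewrite /= /cf2 /cf1 !kcomp_sum.
Qed.

Lemma cf_scale (q : bool) (c : k) f x : cf q (fun m => c * f m) x = c * cf q f x.
Proof. by case: q; rewrite /= /cf2 /cf1 !kcomp_scale. Qed.

Lemma cf_liftn (q : bool) v h x : cf q (liftn q.+1 (toC v) h) x =
  (bnth v (bfst x.1) && (q ==> bnth v (blst x.1)))%:R * h (tm x.2).
Proof.
case: q; rewrite /= /cf2 /cf1 /liftn /= kcomp_lift ?kcomp_scale ?kcomp_lift !mxE ?andbT //.
by rewrite mulrA -natrM mulnb.
Qed.

Lemma gens_evaluates (q : bool) : evaluates (cf q) (gens_sem q) (gens_val q) (gens_ok q).
Proof.
move=> [b l] x /andP[/= bq _]; rewrite /gens_sem -[fun m => _ + _]/(dadd (fun m => _) (fun m => _)).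
rewrite cfD cf_scale cf_sum /gens_val -F2_addb; congr (_ + _).
  case: b bq => /=; last by rewrite mul0r.
  by case: q => // _; rewrite mul1r /= /cf1 zeta_bdual kcomp_bdual.
rewrite -F2_sum_count; apply: eq_bigr => y _.
by rewrite cf_liftn gen7_tm -natrM mulnb -andbA.
Qed.

Lemma hit_relP (G : bv -> dual) A r : (forall a, annih 7 (G a)) -> r \in hit_rels A ->
  \sum_(x <- r) G x.1 (tm x.2) = 0.
Proof.
move=> h /allpairsP [[a t] [_ ht ->]]; rewrite /= big_map; apply: (annih_rel (h a)).
have /flattenP [l /mapP [d]] := ht; rewrite mem_iota add0n => /andP[_ d7] ->.
by rewrite mem_filter => /andP[/eqP -> _].
Qed.

Lemma diag_relP (G : bv -> dual) (g : 'I_4 -> dual) r : (forall i, G (bsing i) = g i) ->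
  (forall u, \sum_l ev (g l) ('X_l * u) = 0) -> r \in diag_rels -> \sum_(x <- r) G x.1 (tm x.2) = 0.
Proof.
move=> e h /mapP [t _ ->]; rewrite big_map -[RHS](h 'X_[tm t]) -sum_ords.
by apply: eq_bigr => l _; rewrite /= e tm_addU -mpolyXUD evX.
Qed.

Lemma row_relP (G : bv -> dual) (g : 'I_4 -> 'I_4 -> dual) r :
  (forall i j, G (bor (bsing i) (bsing j)) = g i j) ->
  (forall i u, \sum_l ev (g i l) ('X_l * u) = 0) -> r \in row_rels -> \sum_(x <- r) G x.1 (tm x.2) = 0.
Proof.
move=> e h /allpairsP [[i t] [_ _ ->]].
rewrite -[X in \big[_/_]_(_ <- X) _]/[seq (bor (bsing i) (bsing j), addU t j) | j <- ords] big_map -[RHS](h i 'X_[tm t]) -sum_ords.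
by apply: eq_bigr => l _; rewrite /= e tm_addU -mpolyXUD evX.
Qed.

Definition rels (q : bool) : seq (seq coord) :=
  if q then hit_rels pairs ++ row_rels ++ diag_rels else hit_rels sings ++ diag_rels.

Lemma relsP (q : bool) f r : annih (degn q.+1) f -> r \in rels q -> \sum_(x <- r) cf q f x = 0.
Proof.
have sing_fst i : bfst (bsing i) = i by elim/ord4_ind: i.
have sing_lst i : blst (bsing i) = i by elim/ord4_ind: i.
case: q => Kf; rewrite /rels; last first.
  rewrite (mem_cat r (hit_rels sings)) => rr.
  have tf : three_odd f := @annih_three_odd 7 f isT Kf.
  pose G a := kcomp (bfst a) f.
  case/orP: rr => h; [apply: (@hit_relP G) h | apply: (@diag_relP G (fun i => kcomp i f)) h].
  - by move=> a; exact: (@annih_kcomp 7 f Kf tf _).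
  - by move=> i; rewrite /G sing_fst.
  - by move=> u; exact: (@kcomp_rel 7 f Kf tf u).
rewrite (mem_cat r (hit_rels pairs)) (mem_cat r row_rels) => rr.
have tf : three_odd f := @annih_three_odd 17 f isT Kf.
have K1 i : annih (degn 1) (kcomp i f) := @annih_kcomp 17 f Kf tf i.
have t1 i : three_odd (kcomp i f) := @annih_three_odd 7 _ isT (K1 i).
have K2 i j : annih 7 (kcomp j (kcomp i f)) := (@annih_kcomp 7 _ (K1 i) (t1 i) j).
have sym i j := fam_sym t1 (@kcomp_rel 17 f Kf tf) i j.
pose G a := kcomp (blst a) (kcomp (bfst a) f).
have GE i j : G (bor (bsing i) (bsing j)) = kcomp j (kcomp i f).
  by elim/ord4_ind: i; elim/ord4_ind: j; rewrite /G //= sym.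
case/or3P: rr => h; [apply: (@hit_relP G) h | apply: (@row_relP G) GE _ h | apply: (@diag_relP G (fun i => kcomp i (kcomp i f))) h].
- by move=> a; exact: K2.
- by move=> i u; exact: (@kcomp_rel 7 _ (K1 i) (t1 i) u).
- by move=> i; rewrite /G sing_fst sing_lst.
- by move=> u; exact: (fam_diag (@kcomp_rel 17 f Kf tf) u).
Qed.

Definition coords (q : bool) : seq coord := [seq (a, t) | a <- if q then pairs else sings, t <- mons 7].

Lemma coords_eq0 (q : bool) f : annih (degn q.+1) f -> (forall x, x \in coords q -> cf q f x = 0) -> f = dzero.
Proof.
have z7 g : annih 7 g -> (forall t, t \in mons 7 -> g (tm t) = 0) -> g = dzero.
  move=> [dg _] h; apply: functional_extensionality => m.
  case: (eqVneq (mdeg m) 7%N) => [dm|]; last exact: in_deg0.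
  by rewrite -[m]qmK h // mem_mons // -mdeg_tm qmK.
have c0 i : kcomp i dzero = dzero by apply: dual_ext => y; rewrite kcompE !ev0.
have t0 : three_odd dzero by move=> E y _; rewrite ev0.
case: q => Kf h.
  have tf : three_odd f := @annih_three_odd 17 f isT Kf.
  have K1 i : annih (degn 1) (kcomp i f) := @annih_kcomp 17 f Kf tf i.
  have t1 i : three_odd (kcomp i f) := @annih_three_odd 7 _ isT (K1 i).
  have sym i j := fam_sym t1 (@kcomp_rel 17 f Kf tf) i j.
  apply: three_odd_ext => // i; rewrite c0; apply: three_odd_ext => // j; rewrite c0.
  apply: z7 => [|t t7]; first exact: (@annih_kcomp 7 _ (K1 i) (t1 i) j).
  have : bor (bsing i) (bsing j) \in pairs by elim/ord4_ind: i; elim/ord4_ind: j.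
  move=> aP; have := h (bor (bsing i) (bsing j), t); rewrite allpairs_f // => /(_ isT).
  by rewrite /cf /cf2 /=; elim/ord4_ind: i {aP}; elim/ord4_ind: j => //=; rewrite sym.
have tf : three_odd f := @annih_three_odd 7 f isT Kf.
apply: three_odd_ext => // i; rewrite c0; apply: z7 => [|t t7]; first exact: (@annih_kcomp 7 f Kf tf i).
have : bsing i \in sings by apply: map_f; elim/ord4_ind: i.
move=> aP; have := h (bsing i, t); rewrite allpairs_f // => /(_ isT).
by rewrite /cf /cf1 /=; elim/ord4_ind: i {aP}.
Qed.

Lemma gens_annih (q : bool) g : gens_ok q g -> annih (degn q.+1) (gens_sem q g).
Proof.
case: g => [b l] /andP[/= bq /allP al].
apply: (@annihD _ (fun m => b%:R * zeta m)).
  case: b bq => bq; last by rewrite scale0_dual; exact: annih0.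
  by case: q bq {al} => // _; rewrite scale1_dual; exact: annih_zeta.
have -> : (fun m => \sum_(y <- l) liftn q.+1 (toC y.1) (gen7_sem y.1 y.2) m) =
  fun m => \sum_(y <- l | (y.1 != b0) && gen7_ok y.1 y.2) liftn q.+1 (toC y.1) (gen7_sem y.1 y.2) m.
  apply: functional_extensionality => m; rewrite big_seq [RHS]big_seq_cond.
  by apply: eq_bigl => y; case: (boolP (y \in l)) => // /al /andP[-> ->].
apply: annih_sum => y /andP[_ ok]; have [K1 k1] := gen7_annih ok.
by have [] := annih_liftn q.+1 K1 k1.
Qed.

Definition detects (q : bool) (D : seq coord) : bool :=
  let Z := peel 40 D D (rels q) in all (fun x => x \in Z) (coords q).

Lemma detectsP q D : detects q D -> {subset coords q <= peel 40 D D (rels q)}.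
Proof. by move/allP. Qed.

Lemma small_span (q : bool) (L : seq (coord * gens)) f :
  all (fun y => gens_ok q y.2) L -> triangular (gens_val q) L ->
  detects q [seq y.1 | y <- L] ->
  annih (degn q.+1) f -> Span (fun h => exists2 g, gens_ok q g & h = gens_sem q g) f.
Proof.
move=> aL tL /detectsP peel_ok Kf.
have [c [sc hc]] := @eliminate _ _ _ _ _ (cfD q) (cf_dzero q) (gens_ok q) (gens_ok q) L f (fun g => id) (@gens_evaluates q) aL tL.
suff z : dadd f c = dzero.
  have -> // : f = c by rewrite -[f]daddr0 -(daddxx c) daddA z dadd0r.
have Kc : annih (degn q.+1) c.
  by elim: sc => [|h c' [g gok ->] _ K']; [exact: annih0 | apply: annihD => //; exact: gens_annih].
have Kz := annihD Kf Kc.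
apply: (coords_eq0 Kz) => x /peel_ok xZ.
have rz r : r \in rels q -> \sum_(x <- r) cf q (dadd f c) x = 0 := fun rr => relsP Kz rr.
exact: (peelP hc hc rz xZ).
Qed.

(* Found by computer. Each generator is listed with a coordinate that it sees and that the
   later generators do not see. *)
Definition gens1 : seq (coord * gens) :=
  [:: D 1 2 1 2 2 [:: P 9 15]; D 1 0 2 4 1 [:: P 1 14]; D 4 2 2 1 2 [:: P 12 15];
   D 4 2 4 0 1 [:: P 4 11]; D 4 0 2 1 4 [:: P 12 14]; D 4 0 1 0 6 [:: P 4 10];
   D 4 2 0 2 3 [:: P 12 13]; D 4 5 0 0 2 [:: P 4 9]; D 4 0 0 2 5 [:: P 12 12];
   D 4 0 0 0 7 [:: P 4 8]; D 1 1 0 1 5 [:: P 9 13]; D 1 0 0 6 1 [:: P 1 12];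
   D 8 1 0 5 1 [:: P 10 15]; Dz 8 2 1 2 2 [:: ]; D 8 2 4 1 0 [:: P 8 7]; D 8 2 0 5 0 [:: P 8 5];
   D 2 2 0 1 4 [:: P 2 13]; D 2 4 2 1 0 [:: P 6 7]; D 2 4 0 3 0 [:: P 2 5];
   D 8 1 2 0 4 [:: P 10 11]; D 8 6 1 0 0 [:: P 8 3]; D 2 0 4 2 1 [:: P 10 14];
   D 2 0 1 6 0 [:: P 6 6]; D 2 0 0 4 3 [:: P 2 12]; D 8 0 6 0 1 [:: P 10 10];
   D 8 0 3 4 0 [:: P 8 6]; D 8 0 7 0 0 [:: P 8 2]; D 8 0 0 7 0 [:: P 8 4]; D 2 0 0 7 0 [:: P 2 4];
   D 2 1 4 0 2 [:: P 3 11]; D 2 5 0 0 2 [:: P 2 9]; D 2 3 4 0 0 [:: P 3 3]; D 2 0 0 0 7 [:: P 2 8];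
   D 1 1 6 0 0 [:: P 5 7]; D 4 3 4 0 0 [:: P 4 3]; D 4 0 7 0 0 [:: P 4 2]; D 1 0 2 5 0 [:: P 1 6];
   D 2 7 0 0 0 [:: P 2 1]; D 4 1 0 6 0 [:: P 5 5]; D 1 0 0 7 0 [:: P 1 4]; D 4 7 0 0 0 [:: P 4 1];
   D 1 0 2 0 5 [:: P 1 10]; D 1 0 7 0 0 [:: P 1 2]; D 8 6 0 0 1 [:: P 9 9]; D 1 0 0 0 7 [:: P 1 8];
   D 8 7 0 0 0 [:: P 8 1]; D 4 1 1 3 2 [:: W 14 12 10]; D 2 1 3 1 2 [:: W 11 10 9];
   D 1 1 3 1 2 [:: W 9 2 9]; D 4 1 0 3 3 [:: W 6 8 6]; D 4 1 2 1 3 [:: W 7 8 3];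
   D 2 3 1 0 3 [:: W 6 8 1]; D 4 1 1 2 3 [:: W 5 8 5]; D 4 3 1 0 3 [:: W 4 8 1];
   D 1 3 1 2 1 [:: W 7 6 5]; D 1 3 3 0 1 [:: W 5 2 5]; D 2 2 1 3 1 [:: W 3 4 3];
   D 4 3 0 3 1 [:: W 6 6 1]; D 8 1 3 0 3 [:: W 12 12 2]; D 2 1 2 3 1 [:: W 10 4 10];
   D 8 1 1 3 2 [:: W 9 4 9]; D 2 1 0 3 3 [:: W 2 8 4]; D 2 3 0 3 1 [:: W 2 4 1];
   D 8 0 1 3 3 [:: W 11 4 10; W 10 4 10]; D 4 0 1 3 3 [:: W 7 8 6; W 6 8 6];
   D 1 1 3 0 3 [:: W 5 8 2]; D 2 0 3 1 3 [:: W 3 8 3]; D 2 3 0 1 3 [:: W 2 8 1];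
   D 4 1 3 0 3 [:: W 4 8 2]; D 1 0 3 1 3 [:: W 1 8 2]; D 4 3 2 1 1 [:: W 14 10 1; W 6 8 1];
   D 8 3 1 0 3 [:: W 4 8 1; W 12 12 1]; D 8 3 1 2 1 [:: W 6 6 1; W 14 6 1];
   D 4 3 3 1 0 [:: W 12 2 1]; D 4 3 3 0 1 [:: W 4 2 1]; D 2 0 1 3 3 [:: W 3 8 4; W 2 8 4];
   D 1 0 1 3 3 [:: W 1 8 4]; D 8 1 2 3 1 [:: W 11 4 3; W 3 4 3]; D 8 0 3 3 1 [:: W 9 4 2];
   D 8 1 3 3 0 [:: W 8 4 2]; D 1 0 3 3 1 [:: W 1 4 2]; D 8 3 0 3 1 [:: W 10 4 1; W 2 4 1];
   D 8 3 1 3 0 [:: W 8 4 1]; D 8 3 3 1 0 [:: W 8 2 1];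
   D 2 3 3 1 0 [:: W 2 8 1; W 10 10 1; W 8 2 1];
   D 8 1 3 2 1 [:: W 13 2 5; W 9 4 2; W 4 2 1; W 12 2 1; W 5 2 5; W 1 4 2];
   D 1 1 3 2 1 [:: W 8 4 2; W 1 8 2; W 4 8 2; W 12 12 2; W 9 4 2; W 8 2 1; W 5 8 2; W 9 2 9; W 13 12 2]]%N.

Definition gens2 : seq (coord * gens) :=
  [:: D 12 4 1 1 1 [:: P 12 15]; D 4 2 1 2 2 [:: P 6 15]; D 12 1 1 5 0 [:: P 14 7];
   D 12 0 2 1 4 [:: P 12 14]; D 8 2 2 2 1 [:: P 10 15]; D 8 0 1 2 4 [:: P 10 14];
   D 8 2 4 1 0 [:: P 8 7]; D 10 0 4 1 2 [:: P 10 15; P 9 15]; D 10 2 0 1 4 [:: P 14 13];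
   D 8 4 0 2 1 [:: P 12 13]; D 10 1 4 2 0 [:: P 13 7; P 14 7]; D 10 0 6 1 0 [:: P 14 6];
   D 8 0 4 3 0 [:: P 8 6]; D 10 1 0 6 0 [:: P 10 5]; D 8 4 0 3 0 [:: P 8 5];
   D 9 0 1 1 5 [:: P 13 14; P 12 14]; D 9 0 5 2 0 [:: P 9 6; P 8 6];
   D 9 2 0 4 1 [:: P 9 13; P 12 13]; D 4 4 0 2 1 [:: P 5 13]; D 9 0 0 2 5 [:: P 13 12];
   D 12 0 0 6 1 [:: P 12 12]; D 5 2 0 1 4 [:: P 5 15; P 6 15]; D 6 2 3 0 2 [:: P 14 11];
   D 4 1 4 0 2 [:: P 4 11]; D 6 3 2 2 0 [:: P 6 7]; D 5 0 2 4 1 [:: P 7 14];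
   D 5 2 1 4 0 [:: P 5 7]; D 9 4 0 3 0 [:: P 13 5; P 8 5]; D 9 0 0 7 0 [:: P 9 4];
   D 4 4 0 3 0 [:: P 5 5]; D 8 0 0 7 0 [:: P 8 4]; D 6 4 0 2 1 [:: P 7 13; P 5 13];
   D 6 6 0 0 1 [:: P 6 9]; D 4 3 0 0 4 [:: P 4 9]; D 3 2 0 3 2 [:: P 3 15];
   D 3 2 3 0 2 [:: P 3 11]; D 3 5 0 0 2 [:: P 11 9]; D 1 2 2 3 0 [:: P 3 7];
   D 2 3 0 2 2 [:: P 2 13]; D 2 5 0 2 0 [:: P 2 5]; D 2 0 2 1 4 [:: P 6 14];
   D 6 0 5 0 2 [:: P 14 10]; D 4 0 2 0 5 [:: P 4 10]; D 4 0 5 2 0 [:: P 6 6];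
   D 2 5 1 0 1 [:: P 10 11]; D 8 4 2 0 1 [:: P 9 11]; D 10 5 2 0 0 [:: P 11 3];
   D 1 6 1 0 0 [:: P 3 3]; D 8 5 2 0 0 [:: P 8 3]; D 2 3 0 0 4 [:: P 2 9]; D 1 6 0 0 1 [:: P 9 9];
   D 8 0 3 0 4 [:: P 10 10]; D 1 0 1 2 4 [:: P 1 14]; D 1 0 3 4 0 [:: P 1 6];
   D 1 0 0 2 5 [:: P 1 12]; D 1 0 0 7 0 [:: P 1 4]; D 10 7 0 0 0 [:: P 10 1];
   D 8 7 0 0 0 [:: P 8 1]; D 2 7 0 0 0 [:: P 2 1]; D 6 0 0 4 3 [:: P 14 12; P 12 12];
   D 6 0 0 0 7 [:: P 6 8]; D 2 0 0 5 2 [:: P 2 12]; D 4 0 0 0 7 [:: P 4 8]; D 2 0 0 0 7 [:: P 2 8];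
   D 10 0 0 7 0 [:: P 8 4; P 10 4]; D 2 0 0 7 0 [:: P 2 4]; D 9 0 4 0 3 [:: P 11 10; P 10 10];
   D 9 0 7 0 0 [:: P 9 2]; D 8 0 7 0 0 [:: P 8 2]; D 1 0 2 0 5 [:: P 1 10]; D 1 0 7 0 0 [:: P 1 2];
   D 1 0 0 0 7 [:: P 1 8]; D 4 5 2 0 0 [:: P 4 3]; D 4 0 7 0 0 [:: P 4 2]; D 4 7 0 0 0 [:: P 4 1];
   D 3 0 7 0 0 [:: P 1 6; P 6 6; P 7 6]; D 3 0 0 6 1 [:: P 2 12; P 1 12; P 3 12];
   D 3 4 0 3 0 [:: P 7 5; P 5 5; P 2 5]; D 3 0 0 7 0 [:: P 2 4; P 1 4; P 3 4];
   D 5 3 2 0 2 [:: P 13 11; P 4 11; P 9 11]; D 5 5 2 0 0 [:: P 4 3; P 3 3; P 7 3];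
   D 12 1 6 0 0 [:: P 12 3; P 4 3; P 8 3]; D 12 0 7 0 0 [:: P 8 2; P 12 2; P 4 2];
   D 5 3 0 0 4 [:: P 4 9; P 9 9; P 13 9]; D 12 7 0 0 0 [:: P 8 1; P 12 1; P 4 1];
   D 6 7 0 0 0 [:: P 2 1; P 6 1; P 4 1]; D 5 0 2 0 5 [:: P 1 10; P 4 10; P 5 10];
   D 5 0 7 0 0 [:: P 5 2; P 1 2; P 4 2]; D 5 0 0 0 7 [:: P 5 8; P 1 8; P 4 8];
   D 3 0 0 0 7 [:: P 2 8; P 1 8; P 3 8]; D 10 1 1 2 3 [:: W 14 12 10]; D 2 1 3 1 2 [:: W 11 10 9];
   D 10 2 3 1 1 [:: W 15 6 5]; D 8 2 1 1 3 [:: W 13 12 9]; D 9 1 1 2 3 [:: W 14 12 10; W 15 12 10];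
   D 6 0 3 3 1 [:: W 7 6 5]; D 3 1 3 3 0 [:: W 11 4 10]; D 1 1 2 3 1 [:: W 3 4 3];
   D 2 1 2 3 1 [:: W 10 4 10]; D 10 1 0 3 3 [:: W 11 4 9]; D 9 1 1 3 2 [:: W 9 4 9];
   D 5 3 1 1 2 [:: W 11 10 9; W 15 10 9]; D 9 3 3 0 1 [:: W 13 2 9]; D 5 3 3 0 1 [:: W 5 2 5];
   D 1 1 3 2 1 [:: W 13 12 2]; D 1 1 3 1 2 [:: W 9 2 9]; D 9 1 3 3 0 [:: W 9 4 2];
   D 1 0 3 3 1 [:: W 1 4 2]; D 10 3 1 0 3 [:: W 14 12 1]; D 8 3 0 1 3 [:: W 10 10 1];
   D 10 3 3 0 1 [:: W 14 6 1]; D 12 3 1 2 1 [:: W 12 12 1]; D 10 3 1 3 0 [:: W 10 4 1];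
   D 8 3 1 3 0 [:: W 8 4 1]; D 12 3 3 0 1 [:: W 12 2 1]; D 8 3 3 1 0 [:: W 8 2 1];
   D 4 3 0 3 1 [:: W 6 6 1]; D 4 3 3 0 1 [:: W 4 2 1]; D 2 3 0 3 1 [:: W 2 4 1];
   D 12 1 3 2 1 [:: W 12 12 2]; D 8 1 3 3 0 [:: W 8 4 2]; D 6 1 3 0 3 [:: W 6 8 6];
   D 6 1 0 3 3 [:: W 7 8 5]; D 2 3 1 0 3 [:: W 6 8 1]; D 4 1 1 2 3 [:: W 5 8 5];
   D 4 3 1 0 3 [:: W 4 8 1]; D 1 1 1 2 3 [:: W 6 8 6; W 7 8 6]; D 1 1 3 0 3 [:: W 5 8 2];
   D 4 1 3 0 3 [:: W 4 8 2]; D 3 0 3 1 3 [:: W 3 8 3]; D 2 3 0 1 3 [:: W 2 8 1];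
   D 2 0 1 3 3 [:: W 3 8 4]; D 2 1 0 3 3 [:: W 2 8 4]; D 1 0 1 3 3 [:: W 1 8 4];
   D 1 0 3 1 3 [:: W 1 8 2]]%N.

Lemma gens1_peel : detects false [seq y.1 | y <- gens1].
Proof. by vm_compute. Qed.

Lemma gens2_peel : detects true [seq y.1 | y <- gens2].
Proof. by vm_compute. Qed.

Lemma gens1_ok : all (fun y => gens_ok false y.2) gens1.
Proof. by vm_compute. Qed.

Lemma gens2_ok : all (fun y => gens_ok true y.2) gens2.
Proof. by vm_compute. Qed.

Lemma gens1_triangular : triangular (gens_val false) gens1.
Proof. by vm_compute. Qed.

Lemma gens2_triangular : triangular (gens_val true) gens2.
Proof. by vm_compute. Qed.

#[local] Arguments spike : simpl never.

(* In the second and first Kameko steps the lifts of a_4^(7) along the seven hyperplanes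
   containing it add up to zero, since a sum over F_2^3 of a function of degree at most
   two vanishes; each lift is equivalent to [spike], so an odd multiple of [spike] is trivial. *)
Lemma coinv0_spike_small (q : bool) : coinv0 (degn q.+1) (spike q.+1).
Proof.
pose T : seq bv := [seq bn i | i <- iota 1 7].
have er3 : er i3 = toR (bn 8) by apply/rowP => j; rewrite !mxE; elim/ord4_ind: j.
pose f : dual := fun m => \sum_(v <- T) liftn q.+1 (toC v) (point (er i3)) m.
have Tok v : v \in T -> toC v != 0 /\ er i3 *m toC v = 0.
  move=> vT; have : all (fun v => (v != b0) && ~~ bdot (bn 8) v) T by [].
  move/allP/(_ v vT)/andP => [v0 /negbTE rv]; split; first exact: toC_neq0.
  by rewrite er3; exact: bdotP.
have f0 : f = dzero.
  have t0 : three_odd dzero by move=> E y _; rewrite ev0.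
  have c0 i : kcomp i dzero = dzero by apply: dual_ext => y; rewrite kcompE !ev0.
  have tF v h : three_odd (liftn q.+1 v h) by exact: lift_three_odd.
  have sum0 (b : bv -> bool) x : odd (count b T) = false -> \sum_(v <- T) (b v)%:R * x = 0 :> k.
    by move=> b0; rewrite -mulr_suml F2_sum_count b0 mul0r.
  apply: three_odd_ext => // [|i]; first by apply: three_odd_sum => v _; exact: tF.
  rewrite kcomp_sum c0; case: (q); last first.
    apply: functional_extensionality => m; under eq_bigr => v _ do rewrite /liftn /= kcomp_lift mxE.
    by rewrite sum0 //; elim/ord4_ind: i.
  apply: three_odd_ext => // [|j].
    by apply: three_odd_sum => v _; rewrite /liftn /= kcomp_lift; apply: three_odd_scale; exact: lift_three_odd.
  rewrite kcomp_sum c0; apply: functional_extensionality => m.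
  under eq_bigr => v _ do rewrite /liftn /= kcomp_lift kcomp_scale kcomp_lift !mxE mulrA -natrM mulnb.
  by rewrite sum0 //; elim/ord4_ind: i; elim/ord4_ind: j.
have -> : spike q.+1 = fun m => \sum_(v <- T | v \in T) dadd (liftn q.+1 (toC v) (point (er i3))) (spike q.+1) m.
  apply: functional_extensionality => m; rewrite -big_seq /dadd big_split /=.
  rewrite -/(f m) f0 add0r big_const_seq count_predT; move: (spike q.+1 m) => x.
  by case: (F2_cases x) => ->; apply/val_inj.
apply: Span_sum => v /Tok [v0 rv]; apply: coinv0_point => //; exact: er_neq0.
Qed.

Definition hyperplane_sum s := Span (fun h => exists v, [/\ v != 0, annih (degn s) h & killed v h]).

Lemma hyp_coinv0 (q : bool) f : hyperplane_sum q.+1 f -> coinv0 (degn q.+1) f.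
Proof.
elim=> [|h f' [v [v0 Kh kh]] _ IH]; first exact: Span0.
apply: SpanD IH; case: (killed_mult_spike Kh kh v0) => // hz.
have -> : h = dadd (dadd h (spike q.+1)) (spike q.+1) by rewrite -daddA daddxx daddr0.
exact: SpanD hz (coinv0_spike_small q).
Qed.

Lemma hyp_act s f g : g \in unitmx -> hyperplane_sum s f -> hyperplane_sum s (act f g).
Proof.
move=> ug; apply: (Span_map (act0 g) (fun f h => actD f h g)) => h [v [v0 Kh kh]].
have e : g *m (invmx g *m v) = v by rewrite mulKVmx.
apply: Span1; exists (invmx g *m v); split; [|exact: annih_act|exact: killed_act e kh].
by apply: contraNneq v0 => h0; rewrite -e h0 mulmx0.
Qed.

Lemma small_hyp (q : bool) f : annih (degn q.+1) f ->
  exists c : k, (q -> c = 0) /\ hyperplane_sum q.+1 (dadd f (fun m => c * zeta m)).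
Proof.
move=> Kf.
have sp : Span (fun h => exists2 g, gens_ok q g & h = gens_sem q g) f.
  case: q Kf => Kf; [apply: (@small_span true gens2) Kf | apply: (@small_span false gens1) Kf].
  - exact: gens2_ok.
  - exact: gens2_triangular.
  - exact: gens2_peel.
  - exact: gens1_ok.
  - exact: gens1_triangular.
  - exact: gens1_peel.
elim: sp => [|_ f' [[b l] /andP[/= bq /allP al] ->] _ [c [qc IH]]].
  exists 0; split=> //; have -> : dadd dzero (fun m => 0 * zeta m) = dzero; last exact: Span0.
  by apply: functional_extensionality => m; rewrite /dadd mul0r addr0.
exists (b%:R + c); split=> [hq|]; first by rewrite qc // addr0; move: bq; rewrite hq; case: (b).
have -> : dadd (dadd (gens_sem q (b, l)) f') (fun m => (b%:R + c) * zeta m) =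
    dadd (fun m => \sum_(y <- l | y \in l) liftn q.+1 (toC y.1) (gen7_sem y.1 y.2) m)
         (dadd f' (fun m => c * zeta m)).
  apply: functional_extensionality => m; rewrite /dadd /gens_sem -big_seq mulrDl.
  have H (B S F C : k) : B + S + F + (B + C) = S + (F + C).
    by rewrite addrACA (addrC B) -(addrA S) F2_addxx addr0 addrA.
  exact: H.
apply: SpanD IH; apply: Span_sum => y /al /andP[y0 yok].
have [K1 k1] := gen7_annih yok; have [K2 k2] := annih_liftn q.+1 K1 k1.
by apply: Span1; exists (toC y.1); split=> //; exact: toC_neq0.
Qed.

Lemma coinv_s2 : coinv_trivial (degn 2).
Proof.
move=> f /PA_annih Kf; apply/coinv0_coinv; have [c [c0 hf]] := @small_hyp true f Kf.
have -> : f = dadd f (fun m => c * zeta m); last exact: (@hyp_coinv0 true).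
by apply: functional_extensionality => m; rewrite /dadd c0 // mul0r addr0.
Qed.

Definition all_gen7 : seq gen7 := [seq inl (bn r) | r <- iota 0 16] ++
  [seq inr (bn p, bn q) | p <- iota 0 16, q <- iota 0 16].

Lemma bn_surj (b : bv) : exists2 n, n \in iota 0 16 & b = bn n.
Proof.
case: b => [[[x y] z] w]; exists (x + 2 * y + 4 * z + 8 * w)%N;
  by case: x; case: y; case: z; case: w.
Qed.

Lemma mem_all_gen7 g : g \in all_gen7.
Proof.
case: g => [r|[p q]]; rewrite mem_cat; apply/orP; [left | right].
  by have [n ni ->] := bn_surj r; exact: (map_f (fun r => inl (bn r))).
have [n ni ->] := bn_surj p; have [n' ni' ->] := bn_surj q.
exact: (allpairs_f (fun p q => inr (bn p, bn q))).
Qed.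

Lemma span7_gens (v : bv) f : v != b0 -> annih 7 f -> killed (toC v) f ->
  Span (fun h => exists2 g, gen7_ok v g & h = gen7_sem v g) f.
Proof.
move=> vb Kf kf; have v0 := toC_neq0 vb; have [g ug ge] := col_trans v0.
have gi : invmx g *m e1 = toC v by rewrite -ge mulKmx.
rewrite -[f]act1 -(mulVmx ug) -actM.
apply: (Span_map (act0 g) (fun f h => actD f h g) _ (base_span (annih_act (invmx g) Kf) (killed_act gi kf))).
have row0 (r : bv) : bdot r eb1 = false -> toR r *m g *m toC v = 0.
  by move=> h; rewrite -mulmxA ge -toC_eb1; exact: bdotP.
have dot0 (r r' : bv) : toR r *m g = toR r' -> bdot r eb1 = false -> bdot r' v = false.
  move=> h /row0; rewrite h toR_toC => /matrixP/(_ 0 0); rewrite !mxE eqxx.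
  by case: bdot => // /eqP; rewrite oner_eq0.
move=> _ [x xi ->]; apply: Span1; have /allP/(_ _ xi) := base_gens_ok.
case: x {xi} => [r|[p q]] /= /andP[].
  move=> r0 /negbTE rv; have [r' hr'] := toR_surj (toR r *m g).
  exists (inl r'); last by rewrite act_point hr'.
  rewrite /= (dot0 _ _ hr' rv) andbT; apply: contraNneq (toR_neq0 r0) => h.
  rewrite -[toR r]mulmx1 -(mulmxV ug) mulmxA hr' h (_ : toR b0 = 0) ?mul0mx //.
  by apply/rowP => j; rewrite !mxE; elim/ord4_ind: j.
move=> /negbTE pv /negbTE qv.
have [p' hp] := toR_surj (toR p *m g); have [q' hq] := toR_surj (toR q *m g).
exists (inr (p', q')); first by rewrite /= (dot0 _ _ hp pv) (dot0 _ _ hq qv).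
rewrite /= -hp -hq -act_wedge; apply: (@lift_act 2) => //; first exact: annih_wedge.
- by rewrite toC_eb1; apply: killed_wedge; rewrite -toC_eb1; exact: bdotP.
- by rewrite toC_eb1 e1_neq0.
- by rewrite toC_eb1.
Qed.

(* Found by computer. *)
Definition ztest_exp (i : 'I_4) : q4 :=
  nth (0, 0, 0, 0)%N [:: (1, 1, 1, 4); (4, 1, 1, 1); (1, 1, 1, 4); (1, 1, 4, 1)]%N i.

Definition ztest (f : dual) : k := \sum_i kcomp i f (tm (ztest_exp i)).

Lemma ztestD f g : ztest (dadd f g) = ztest f + ztest g.
Proof.
rewrite /ztest -big_split; apply: eq_bigr => i _ /=.
by rewrite -evX kcompE evD -!kcompE !evX.
Qed.

Lemma ztest_check : all (fun v => all (fun g => gen7_ok (bn v) g ==>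
  ~~ odd (count (fun i => bnth (bn v) i && gen7_val (bn v) g (ztest_exp i)) ords)) all_gen7) (iota 0 16).
Proof. by vm_compute. Qed.

Lemma ztest_hyp f : hyperplane_sum 1 f -> ztest f = 0.
Proof.
elim=> [|h f' [v [v0 Kh kh]] _ IH].
  by rewrite /ztest big1 // => i _; rewrite -evX kcompE ev0.
rewrite ztestD IH addr0; have [g [Kg kg ->]] := @liftn_down 1 v h Kh kh v0.
rewrite /ztest /liftn /=; under eq_bigr => i _ do rewrite kcomp_lift.
have [b eb] := toC_surj v; rewrite eb in v0 kg *.
have vb : b != b0.
  by apply: contraNneq v0 => ->; apply/eqP/colP => j; rewrite !mxE; elim/ord4_ind: j.
elim: (span7_gens vb Kg kg) => [|_ f2 [x xok ->] _ IH2].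
  by rewrite big1 // => i _; rewrite /dzero mulr0.
under eq_bigr => i _ do rewrite /dadd mulrDr mxE gen7_tm -natrM mulnb.
rewrite big_split /= -sum_ords F2_sum_count.
have [n ni en] := bn_surj b.
have /allP/(_ _ ni)/allP/(_ x (mem_all_gen7 x)) := ztest_check.
rewrite -en xok /= => /negbTE ->; rewrite add0r -[RHS]IH2.
by apply: eq_bigr => i _; rewrite mxE.
Qed.

Lemma ztest_zeta : ztest zeta = 1.
Proof.
rewrite /ztest -sum_ords zeta_bdual; under eq_bigr => i _ do rewrite kcomp_bdual.
by rewrite F2_sum_count; vm_compute.
Qed.

Lemma zeta_not_hyp : ~ hyperplane_sum 1 zeta.
Proof. by move=> /ztest_hyp/eqP; rewrite ztest_zeta oner_eq0. Qed.

(* The quotient by [hyperplane_sum 1] is one-dimensional, so GL_4 acts trivially on it. *)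
Lemma act_hyp f g : annih (degn 1) f -> g \in unitmx -> hyperplane_sum 1 (dadd (act f g) f).
Proof.
move=> Kf ug.
have hz : hyperplane_sum 1 (dadd (act zeta g) zeta).
  have [c [_ h]] := @small_hyp false (act zeta g) (annih_act g annih_zeta).
  case: (F2_cases c) h => ->; rewrite ?scale1_dual // scale0_dual daddr0 => h.
  case: zeta_not_hyp; rewrite -[zeta]act1 -(mulmxV ug) -actM.
  by apply: hyp_act h; rewrite unitmx_inv.
have [c [_ h]] := @small_hyp false f Kf.
have := SpanD (hyp_act ug h) h; rewrite actD.
case: (F2_cases c) => ->; rewrite ?scale1_dual ?scale0_dual ?act0 ?daddr0 // => h'.
have := SpanD h' hz.
have -> // : dadd (dadd (dadd (act f g) (act zeta g)) (dadd f zeta)) (dadd (act zeta g) zeta) = dadd (act f g) f.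
apply: functional_extensionality => m; rewrite /dadd.
have H (A B C E : k) : A + B + (C + E) + (B + E) = A + C.
  by rewrite (addrACA A) -(addrA (A + C)) F2_addxx addr0.
exact: H.
Qed.

Lemma coinv_s1 : coinv_spanned_by (degn 1) zeta.
Proof.
split; first exact/PA_annih/annih_zeta.
split=> [/coinv0_coinv h|f /PA_annih Kf].
  apply: zeta_not_hyp; elim: h => [|_ f' [f1 [g [K1 ug ->]]] _ IH]; first exact: Span0.
  by apply: SpanD IH; exact: act_hyp.
have [c [_ h]] := @small_hyp false f Kf; exists c; apply/coinv0_coinv.
by rewrite /dscale F2_opp; exact: (@hyp_coinv0 false).
Qed.

Theorem theorem2p1p4 (s : nat) (hs : (0 < s)%N) :
  let n := (2 ^ (s + 3) + 2 ^ (s + 1) - 3)%N in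
  [/\ s = 1%N -> coinv_spanned_by n zeta,
      s = 2%N -> coinv_trivial n
    & (3 <= s)%N -> coinv_spanned_by n (amon 0 (2 ^ s - 1) (2 ^ s - 1) (2 ^ (s + 3) - 1))].
Proof.
rewrite /= -/(degn s); split=> [->|->|s3]; [exact: coinv_s1 | exact: coinv_s2 |].
by case: s s3 {hs} => [|[|[|s]]] // _; rewrite -spikeE; exact: coinv_s3.
Qed.
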